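(* Let $k\ge2$, let $\mathbb{Z}/k$ act on a unital $C^*$-algebra $A$, and let $\gamma$ denote a generator of the dual group $\widehat{\mathbb{Z}/k}\cong\mathbb{Z}/k$. Then $$\mathrm{dim}^{\mathbb{Z}/k}_{\mathrm{LT}}(A)=\min\Big\{n\in\mathbb{N}:\exists\text{ normal }a_0,\ldots,a_n\in A_\gamma,\ \sigma(a_i)\subseteq\mathrm{Star}_k,\ \sum_{i=0}^na_ia_i^*=1\Big\},$$ $$\mathrm{dim}^{\mathbb{Z}/k}_{\mathrm{WLT}}(A)=\min\Big\{n\in\mathbb{N}:\exists\text{ normal }a_0,\ldots,a_n\in A_\gamma,\ \sigma(a_i)\subseteq\mathrm{Star}_k,\ \sum_{i=0}^na_ia_i^*\text{ is invertible}\Big\},$$ and $$\mathrm{dim}^{\mathbb{Z}/k}_{\mathrm{SLT}}(A)=\min\Big\{n\in\mathbb{N}:\exists\text{ normal, pairwise commuting }a_0,\ldots,a_n\in A_\gamma,\ \sigma(a_i)\subseteq\mathrm{Star}_k,\ \sum_{i=0}^na_ia_i^*=1\Big\}.$$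
   Context: $\mathbb{N}$ includes $0$, and the minimum of the empty set is $\infty$. $\sigma(a)$ is the spectrum of $a$, and $\mathrm{Star}_k:=\{se^{2\pi im/k}:0\le s\le1,\ m\in\{0,\ldots,k-1\}\}=\{z\in\mathbb{C}:z^k\in[0,1]\}$. For an action $\alpha$ of a compact abelian group $G$ on $A$ and a character $\lambda\in\widehat G$, the spectral subspace is $A_\lambda=\{a\in A:\alpha_g(a)=\lambda(g)a\text{ for all }g\in G\}$. Local-triviality dimensions: let a compact group $G$ act on a unital $C^*$-algebra $A$. Equip $C(G)$ with $(\alpha_gf)(h)=f(hg)$ and $C_0((0,1])\otimes C(G)$ with the action on the second factor, and let $t$ be the identity function in $C_0((0,1])$. The plain dimension $\mathrm{dim}^G_{\mathrm{LT}}(A)$ (resp. weak dimension $\mathrm{dim}^G_{\mathrm{WLT}}(A)$) is the smallest $n\ge0$ for which there exist $G$-equivariant $*$-homomorphisms $\rho_0,\ldots,\rho_n:C_0((0,1])\otimes C(G)\to A$ such that $\sum_{i=0}^n\rho_i(t\otimes1)$ equals $1$ (resp. is invertible). The strong dimension $\mathrm{dim}^G_{\mathrm{SLT}}(A)$ is the smallest $n\ge 0$ for which there is a $G$-equivariant unital $*$-homomorphism $C(E_nG)\to A$, where $E_0G=G$, $E_{n+1}G=E_nG*G$ (topological join) with the diagonal action of $G$. If no such $n$ exists, the dimension is $\infty$. *)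

(* Defs.v *)
From HB Require Import structures.
From mathcomp Require Import all_boot all_order all_algebra.
From mathcomp Require Import complex.
From mathcomp Require Import all_classical all_reals all_analysis.

Set Implicit Arguments.
Unset Strict Implicit.
Unset Printing Implicit Defensive.

Import Order.TTheory GRing.Theory Num.Theory.
Import numFieldNormedType.Exports.

Local Open Scope classical_set_scope.
Local Open Scope ring_scope.
Local Open Scope complex_scope.
Local Open Scope quotient_scope.

(* The ascription is needed: the topology and norm of MathComp-Analysis are
   found on a [numClosedFieldType], but not on a bare [R[i]]. *)
Definition Cplx (R : realType) : numClosedFieldType := R[i].

(* Unital C*-algebras (the zero algebra is allowed).  The product and the unit
   are fields of the mixin because Hierarchy Builder does not accept the join of
   [CompleteNormedModule] with [GRing.PzRing]: every structure that is both
   normed and a ring would have to be declared before [Num.NumDomain]. *)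
HB.mixin Record isCStarAlgebra (R : realType) A
    of CompleteNormedModule (Cplx R) A := {
  amul : A -> A -> A;
  aone : A;
  star : A -> A;
  amulA : associative amul;
  amul1l : left_id aone amul;
  amul1r : right_id aone amul;
  amulDl : left_distributive amul +%R;
  amulDr : right_distributive amul +%R;
  ascaleAl : forall (c : Cplx R) (a b : A), c *: amul a b = amul (c *: a) b;
  ascaleAr : forall (c : Cplx R) (a b : A), c *: amul a b = amul a (c *: b);
  anormM : forall a b : A, `|amul a b| <= `|a| * `|b| :> Cplx R;
  starK : involutive star;
  starD : {morph star : a b / a + b};
  starZ : forall (c : Cplx R) (a : A), star (c *: a) = Num.conj c *: star a;
  starM : forall a b : A, star (amul a b) = amul (star b) (star a);
  cstar_norm : forall a : A, `|amul (star a) a| = `|a| ^+ 2 :> Cplx R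
}.

#[short(type="cstarAlgType")]
HB.structure Definition CStarAlgebra (R : realType) :=
  {A of CompleteNormedModule (Cplx R) A & isCStarAlgebra R A}.

Declare Scope cstar_scope.
Delimit Scope cstar_scope with A.
Notation "a ** b" := (amul a b) (at level 40, left associativity) : cstar_scope.
Notation "1" := aone : cstar_scope.
Notation "a ^*" := (star a) : cstar_scope.

(* [None] stands for infinity. *)
Definition min_infty (P : set nat) : option nat :=
  if pselect (exists n, `[< P n >]) is left exP then Some (ex_minn exP)
  else None.

Section CStar.
Context {R : realType} {A : cstarAlgType R}.
Local Notation C := (Cplx R).
Implicit Types a : A.

Definition invertible a : Prop := exists b : A, (a ** b = 1 /\ b ** a = 1)%A.

Definition spectrum a : set C := [set z | ~ invertible (a - z *: 1%A)].

Definition normal_elt a : Prop := (a ** a^* = a^* ** a)%A.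

End CStar.

(* s e^{2 pi i m / k} with 0 <= s <= 1 and m in {0, ..., k-1} *)
Definition Star (R : realType) (k : nat) : set (Cplx R) :=
  [set z | exists (s : R) (m : nat), [/\ 0 <= s <= 1, (m < k)%N &
     z = s%:C * (cos (2 * pi * m%:R / k%:R) +i* sin (2 * pi * m%:R / k%:R))]].

(* From here on G is a finite abelian group, written additively and carrying
   the discrete topology, so that actions on C*-algebras and characters of G
   are automatically continuous. *)

Section Actions.
Context {R : realType} {G : finZmodType} {A : cstarAlgType R}.
Local Notation C := (Cplx R).

Record is_action (alpha : G -> A -> A) : Prop := IsAction {
  action0 : forall a, alpha 0 a = a;
  actionD : forall g h a, alpha (g + h) a = alpha g (alpha h a);
  action_add : forall g a b, alpha g (a + b) = alpha g a + alpha g b;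
  action_scale : forall g (c : C) a, alpha g (c *: a) = c *: alpha g a;
  action_mul : forall g a b, (alpha g (a ** b) = alpha g a ** alpha g b)%A;
  action_one : forall g, alpha g 1%A = 1%A;
  action_star : forall g a, (alpha g a^* = (alpha g a)^*)%A
}.

Definition is_character (chi : G -> C) : Prop :=
  (forall g h, chi (g + h) = chi g * chi h) /\ (forall g, `|chi g| = 1).

Definition dual_generator (gamma : G -> C) : Prop :=
  is_character gamma /\
  forall chi, is_character chi ->
    exists m : int, forall g, chi g = (gamma g) ^ m.

Definition spectral_subspace (alpha : G -> A -> A) (lambda : G -> C) : set A :=
  [set a | forall g, alpha g a = lambda g *: a].

End Actions.

(* [gact g x] is the right translate x g. *)
Record gspace (G : finZmodType) := GSpace {
  gcarrier :> topologicalType;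
  gact : G -> gcarrier -> gcarrier
}.

Definition group_gspace (G : finZmodType) : gspace G :=
  @GSpace G (discrete_topology G) (fun g h => (h : G) + g).

(* (0,1] x G with G acting on the second factor *)
Definition cone_gspace (R : realType) (G : finZmodType) : gspace G :=
  @GSpace G (set_type `]0%R, 1%R : R] * group_gspace G)%type
    (fun g p => (p.1, gact g p.2)).

Section Join.
Context (R : realType) (X Y : topologicalType).
Let I := set_type `[0%R, 1%R : R].

(* (x, s, y) ~ (x', s, y') when s = 0 and x = x', or s = 1 and y = y'. *)
Let join_rel' (p q : X * I * Y) : bool :=
  `[< [/\ p.1.2 = q.1.2,
          val p.1.2 < 1 -> p.1.1 = q.1.1 &
          0 < val p.1.2 -> p.2 = q.2] >].

Local Lemma join_rel_refl : reflexive join_rel'.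
Proof. by move=> p; apply/asboolP. Qed.

Local Lemma join_rel_sym : symmetric join_rel'.
Proof.
by move=> p q; apply/asboolP/asboolP => -[e h1 h2]; split=> //;
  rewrite -?e ?e => h; apply/esym; (apply: h1 || apply: h2); rewrite ?e // -e.
Qed.

Local Lemma join_rel_trans : transitive join_rel'.
Proof.
move=> q p r /asboolP[e h1 h2] /asboolP[e' h1' h2']; apply/asboolP.
split; first by rewrite e.
  by move=> h; rewrite h1 // h1' // -e.
by move=> h; rewrite h2 // h2' // -e.
Qed.

Definition join_rel := EquivRel _ join_rel_refl join_rel_sym join_rel_trans.

Definition join := {eq_quot join_rel}.

HB.instance Definition _ := Topological.copy join (quotient_topology join).
HB.instance Definition _ := Quotient.on join.

End Join.

Definition join_gspace (R : realType) (G : finZmodType) (X Y : gspace G) :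
    gspace G :=
  @GSpace G (join R X Y)
    (fun g p => let q := repr p in
       \pi_(join R X Y) (gact g q.1.1, q.1.2, gact g q.2)).

Fixpoint EG (R : realType) (G : finZmodType) (n : nat) : gspace G :=
  if n is m.+1 then join_gspace R (EG R G m) (group_gspace G)
  else group_gspace G.

Section LocalTriviality.
Context {R : realType} {G : finZmodType} {A : cstarAlgType R}.
Local Notation C := (Cplx R).

Definition Ccont (X : topologicalType) : set (X -> C) :=
  [set f | continuous f].

Definition Czero (X : topologicalType) : set (X -> C) :=
  [set f | continuous f /\
     forall e : R, 0 < e -> compact [set x | e%:C <= `|f x|]].

(* The domain of the *-homomorphism is the *-algebra F of functions on X; the
   values of rho outside F are irrelevant. *)
Record star_hom (X : Type) (F : set (X -> C)) (rho : (X -> C) -> A) : Prop :=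
    StarHom {
  star_hom_add : forall f1 f2, F f1 -> F f2 ->
    rho (fun x => f1 x + f2 x) = rho f1 + rho f2;
  star_hom_scale : forall (c : C) f, F f ->
    rho (fun x => c * f x) = c *: rho f;
  star_hom_mul : forall f1 f2, F f1 -> F f2 ->
    rho (fun x => f1 x * f2 x) = (rho f1 ** rho f2)%A;
  star_hom_star : forall f, F f ->
    rho (fun x => Num.conj (f x)) = (rho f)^*%A
}.

Definition equivariant (alpha : G -> A -> A) (X : gspace G) (F : set (X -> C))
    (rho : (X -> C) -> A) : Prop :=
  forall g f, F f -> rho (fun x => f (gact g x)) = alpha g (rho f).

(* C_0((0,1]) (x) C(G) is identified with C_0((0,1] x G), the elementary tensor
   u (x) v being the function (s, h) |-> u s * v h. *)
Definition cone_hom (alpha : G -> A -> A)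
    (rho : (cone_gspace R G -> C) -> A) : Prop :=
  let F := @Czero (cone_gspace R G) in
  star_hom F rho /\ equivariant alpha F rho.

Definition tensor (u : set_type `]0%R, 1%R : R] -> C) (v : group_gspace G -> C) :
  cone_gspace R G -> C := fun p => u p.1 * v p.2.

Definition t_tensor_1 : cone_gspace R G -> C :=
  tensor (fun s => (val s)%:C) (fun=> 1).

Definition dimLT (alpha : G -> A -> A) : option nat :=
  min_infty [set n | exists rho : 'I_n.+1 -> (cone_gspace R G -> C) -> A,
    (forall i, cone_hom alpha (rho i)) /\
    \sum_(i < n.+1) rho i t_tensor_1 = 1%A].

Definition dimWLT (alpha : G -> A -> A) : option nat :=
  min_infty [set n | exists rho : 'I_n.+1 -> (cone_gspace R G -> C) -> A,
    (forall i, cone_hom alpha (rho i)) /\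
    invertible (\sum_(i < n.+1) rho i t_tensor_1)].

Definition dimSLT (alpha : G -> A -> A) : option nat :=
  min_infty [set n | exists rho : (EG R G n -> C) -> A,
    [/\ star_hom (@Ccont (EG R G n)) rho,
        rho (fun=> 1) = 1%A &
        equivariant alpha (@Ccont (EG R G n)) rho]].

End LocalTriviality.

(* Main.v *)
(* A *-homomorphism out of C(K) or C_0(K), where K carries coordinate functions
   phi_i separating points, is determined by commuting normal elements a_i, the images
   of the phi_i.  For the cone (0,1] x Z/k the coordinate is sqrt(s) gamma(h),
   with values in the star; for the n-th join it is a family of n + 1 functions
   with values in the star and square sum 1.  One direction of each formula takes
   the images of the coordinates.

   Conversely the homomorphism is built without Gelfand theory.  Let B be the
   bicommutant of the a_i.  A "state" E is a positive unital B-linear map from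
   B-valued functions to B, to be thought of as a random point x with E(phi_i(x))
   close to a_i; if the variance E(sum_i |phi_i(x) - a_i|^2) tends to 0, then E(f)
   converges to an element f(a), and f |-> f(a) is a *-homomorphism, because
   |f(x) - f(y)| <= e + c sum_i |phi_i(x) - phi_i(y)|^2 by compactness.  For one
   normal element, the means of independent copies of a four-point state with
   expectation a have small variance.  A bump function near a point outside the
   spectrum is mapped to 0, so the random point can be moved into the star;
   products of such states then treat several elements, and a radial projection
   enforces the square sum 1.  Positivity only uses the C*-identity and a square
   root obtained by a contraction.  For the strong dimension the adjoints have to
   commute as well: on the star, conj(z) is a uniform limit of polynomials in z. *)

From HB Require Import structures.
Require Import Defs.
From mathcomp Require Import all_boot all_order all_algebra complex ring lra.
From mathcomp Require Import all_classical all_reals all_analysis.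

Set Implicit Arguments.
Unset Strict Implicit.
Unset Printing Implicit Defensive.

Import Order.TTheory GRing.Theory Num.Theory.
Import numFieldNormedType.Exports.

Local Open Scope classical_set_scope.
Local Open Scope ring_scope.
Local Open Scope complex_scope.
Local Open Scope quotient_scope.

(** * Positive elements of a commutative C*-algebra *)

Notation cabs := ComplexField.Normc.normc.

Section ComplexModulus.
Context {R : realType}.
Local Notation C := (Cplx R).
Implicit Types z w : C.

Definition sqmod (z : C) : R := complex.Re z ^+ 2 + complex.Im z ^+ 2.

Lemma sqmod_ge0 z : 0 <= sqmod z.
Proof. by rewrite addr_ge0 ?sqr_ge0. Qed.

Lemma cabs_ge0 z : 0 <= cabs z.
Proof. by case: z => x y; rewrite sqrtr_ge0. Qed.

Lemma sqr_cabs z : cabs z ^+ 2 = sqmod z.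
Proof. by case: z => x y; rewrite /= sqr_sqrtr // addr_ge0 ?sqr_ge0. Qed.

Lemma cabs_real (r : R) : cabs (r%:C : C) = `|r|.
Proof. by rewrite /= expr0n addr0 sqrtr_sqr. Qed.

Lemma Re_le_cabs z : `|complex.Re z| <= cabs z.
Proof.
by case: z => x y; rewrite -sqrtr_sqr ler_wsqrtr //= lerDl sqr_ge0.
Qed.

Lemma Im_le_cabs z : `|complex.Im z| <= cabs z.
Proof.
by case: z => x y; rewrite -sqrtr_sqr ler_wsqrtr //= lerDr sqr_ge0.
Qed.

Lemma sqmodE z : ((sqmod z)%:C : C) = Num.conj z * z.
Proof. by rewrite mulrC -normCK -add_Re2_Im2. Qed.

Lemma normCE z : `|z| = (cabs z)%:C :> C.
Proof. by case: z. Qed.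

Lemma conjCE z : Num.conj z = conjc z :> C.
Proof. by []. Qed.

Lemma cplxE z : z = (complex.Re z)%:C + 'i%C * (complex.Im z)%:C :> C.
Proof. exact: complexE. Qed.

Lemma sqmodM z w : sqmod (z * w) = sqmod z * sqmod w.
Proof. by rewrite -!sqr_cabs ComplexField.Normc.normcM exprMn. Qed.

Lemma sqmod0 : sqmod (0 : C) = 0.
Proof. by rewrite /sqmod /= expr0n addr0. Qed.

Lemma sqmod_eq0 z : sqmod z = 0 -> z = 0.
Proof.
move=> h; apply: ComplexField.Normc.eq0_normc; apply/eqP.
by rewrite -sqrf_eq0 sqr_cabs h.
Qed.

Lemma sqmodN z : sqmod (- z) = sqmod z.
Proof. by case: z => x y; rewrite /sqmod /= !sqrrN. Qed.

Lemma sqmodD_le z w : sqmod (z + w) <= 2 * (sqmod z + sqmod w).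
Proof.
case: z w => [x y] [x' y']; rewrite /sqmod /=.
have := sqr_ge0 (x - x'); have := sqr_ge0 (y - y'); lra.
Qed.

Lemma cabsX z n : cabs (z ^+ n) = cabs z ^+ n.
Proof.
elim: n => [|n ih]; first by rewrite !expr0 ComplexField.Normc.normc1.
by rewrite !exprS ComplexField.Normc.normcM ih.
Qed.

Lemma cabs_root k z : (0 < k)%N -> z ^+ k = 1 -> cabs z = 1.
Proof.
move=> k0 zk; have : cabs z ^+ k == 1 by rewrite -cabsX zk ComplexField.Normc.normc1.
by rewrite pexprn_eq1 ?cabs_ge0 // (gtn_eqF k0) => /eqP.
Qed.

End ComplexModulus.

Record comCStar (R : realType) := ComCStar {
  ccar :> comPzRingType;
  csc : {rmorphism Cplx R -> ccar};
  cadj : {rmorphism ccar -> ccar};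
  cnr : ccar -> R;
  cnrD : forall x y, cnr (x + y) <= cnr x + cnr y;
  cnrM : forall x y, cnr (x * y) <= cnr x * cnr y;
  cnrZ : forall c x, cnr (csc c * x) = cabs c * cnr x;
  cnr_eq0 : forall x, cnr x = 0 -> x = 0;
  cadjK : involutive cadj;
  cadj_sc : forall c, cadj (csc c) = csc (Num.conj c);
  cnr_stM : forall x, cnr (cadj x * x) = cnr x ^+ 2;
  c_complete : forall u : nat -> ccar,
    (forall e, 0 < e -> exists N, forall m n, (N <= m)%N -> (N <= n)%N ->
       cnr (u m - u n) <= e) ->
    exists l, forall e, 0 < e -> exists N, forall n, (N <= n)%N ->
       cnr (u n - l) <= e
}.

Section Positivity.
Context {R : realType} {B : comCStar R}.
Local Notation C := (Cplx R).
Local Notation sc := (@csc R B).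
Local Notation st := (@cadj R B).
Local Notation nr := (@cnr R B).
Local Notation rs r := (sc (real_complex R r)).
Implicit Types (x y z w d : B) (r s t e : R).

Lemma st_rs r : st (rs r) = rs r.
Proof. by rewrite cadj_sc conjCE conjc_real. Qed.

Lemma rs_nat n : rs n%:R = n%:R.
Proof. by rewrite (rmorph_nat (real_complex R)) rmorph_nat. Qed.

Lemma rs_half : 2 * rs 2^-1 = 1.
Proof.
by rewrite -rs_nat -rmorphM -rmorphM divff //= !rmorph1.
Qed.

Lemma cnr0 : nr 0 = 0.
Proof.
by rewrite -(mul0r 1) -(rmorph0 sc) cnrZ ComplexField.Normc.normc0 mul0r.
Qed.

Lemma cnrN x : nr (- x) = nr x.
Proof.
have -> : - x = rs (-1) * x by rewrite !rmorphN1 mulN1r.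
by rewrite cnrZ cabs_real normrN1 mul1r.
Qed.

Lemma cnr_ge0 x : 0 <= nr x.
Proof. by have := cnrD x (- x); rewrite subrr cnr0 cnrN; lra. Qed.

Lemma cnr1_le : nr 1 <= 1.
Proof.
have := cnr_stM (1 : B); rewrite rmorph1 mul1r => h.
have := cnr_ge0 1; nra.
Qed.

Lemma cnr_rs r : nr (rs r) <= `|r|.
Proof.
rewrite -[rs r]mulr1 cnrZ cabs_real ler_piMr //; exact: cnr1_le.
Qed.

Lemma cnrB x y : nr (x - y) <= nr x + nr y.
Proof. by rewrite (le_trans (cnrD _ _)) // cnrN. Qed.

Lemma cnr_distC x y : nr (x - y) = nr (y - x).
Proof. by rewrite -cnrN opprB. Qed.

Lemma cnr_st x : nr (st x) = nr x.
Proof.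
have H z : nr z <= nr (st z).
  have := cnr_stM z; have := cnrM (st z) z; have := cnr_ge0 z.
  have := cnr_ge0 (st z).
  have [->|z0] := eqVneq (nr z) 0; first by [].
  by move=> h1 h2 h3 h4; rewrite -(ler_pM2r (x := nr z)) ?lt_neqAle 1?eq_sym ?z0//; nra.
by apply/eqP; rewrite eq_le H andbT -{2}(cadjK x) H.
Qed.

Lemma cnr_sa x : st x = x -> nr (x ^+ 2) = nr x ^+ 2.
Proof. by move=> h; rewrite -cnr_stM h expr2. Qed.

Lemma sqrt1_sub w q : st w = w -> nr w <= q -> q < 1 ->
  exists2 e, st e = e & e ^+ 2 = 1 - w.
Proof.
move=> sw wq q1.
have q0 : 0 <= q by apply: le_trans wq; exact: cnr_ge0.
pose v := fix v n := if n is m.+1 then rs 2^-1 * (w + v m ^+ 2) else 0.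
have nhalf x : nr (rs 2^-1 * x) = nr x / 2.
  by rewrite cnrZ cabs_real gtr0_norm ?invr_gt0 // mulrC.
have nv n : nr (v n) <= q.
  elim: n => [|n ih] /=; first by rewrite cnr0.
  rewrite nhalf; have := cnrD w (v n ^+ 2); have := cnrM (v n) (v n).
  rewrite -expr2; have := cnr_ge0 (v n); nra.
have sv n : st (v n) = v n.
  elim: n => [|n ih] /=; first by rewrite rmorph0.
  by rewrite rmorphM rmorphD rmorphXn /= ih sw st_rs.
have dv n : nr (v n.+1 - v n) <= q ^+ n.
  elim: n => [|n ih]; first by rewrite expr0 subr0 (le_trans (nv 1%N)) // ltW.
  have -> : v n.+2 - v n.+1 = rs 2^-1 * ((v n.+1 + v n) * (v n.+1 - v n)).
    have -> : v n.+2 = rs 2^-1 * (w + v n.+1 ^+ 2) by [].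
    have {2}-> : v n.+1 = rs 2^-1 * (w + v n ^+ 2) by [].
    ring.
  rewrite nhalf ler_pdivrMr // (le_trans (cnrM _ _)) //.
  have h : nr (v n.+1 + v n) <= 2 * q.
    by rewrite (le_trans (cnrD _ _)) // mulr2n mulrDl mul1r lerD.
  rewrite exprS (le_trans (ler_pM (cnr_ge0 _) (cnr_ge0 _) h ih)) //; lra.
have dvk n k : nr (v (n + k)%N - v n) * (1 - q) <= q ^+ n * (1 - q ^+ k).
  elim: k => [|k ih]; first by rewrite addn0 subrr cnr0 mul0r expr0 subrr mulr0.
  have h := cnrD (v (n + k).+1 - v (n + k)%N) (v (n + k)%N - v n).
  rewrite addrA subrK in h; rewrite addnS.
  have := dv (n + k)%N; rewrite exprD exprS => h2.
  have := exprn_ge0 n q0; have := exprn_ge0 k q0; nra.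
have qn e : 0 < e -> exists N, forall n, (N <= n)%N -> q ^+ n <= e.
  move=> e0; have := cvg_geometric (1 : R) (_ : `|q| < 1).
  rewrite ger0_norm // => /(_ q1) /cvgrPdist_le /(_ e e0) [N _ hN].
  exists N => n Nn; have := hN n Nn; rewrite sub0r normrN /geometric /= mul1r.
  by rewrite ger0_norm // exprn_ge0.
have [l hl] : exists l, forall e, 0 < e -> exists N, forall n, (N <= n)%N ->
    nr (v n - l) <= e.
  apply: c_complete => e e0.
  have e10 : 0 < e * (1 - q) by rewrite mulr_gt0 // subr_gt0.
  have [N hN] := qn _ e10; exists N.
  suff H m n : (N <= m)%N -> (m <= n)%N -> nr (v n - v m) <= e.
    move=> m n Nm Nn; case: (leqP m n) => [mn|/ltnW nm]; last exact: H.
    by rewrite cnr_distC; exact: H.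
  move=> Nm mn; have := dvk m (n - m)%N; rewrite subnKC // => h.
  rewrite -(ler_pM2r (_ : 0 < 1 - q)) ?subr_gt0 //.
  rewrite (le_trans h) // (le_trans _ (hN m Nm)) // ler_piMr ?exprn_ge0 //.
  by rewrite gerBl exprn_ge0.
have sl : st l = l.
  apply/subr0_eq/cnr_eq0/eqP; rewrite eq_le cnr_ge0 andbT.
  apply/ler_addgt0Pr => e e0; rewrite add0r.
  have [N /(_ N (leqnn _)) h] := hl (e / 2) (divr_gt0 e0 (ltr0Sn _ 1)).
  have := cnrB (v N - l) (st (v N - l)); rewrite cnr_st rmorphB /= sv => h2.
  rewrite (_ : v N - l - (v N - st l) = st l - l) in h2; last by ring.
  lra.
have fl : l = rs 2^-1 * (w + l ^+ 2).
  apply/subr0_eq/cnr_eq0/eqP; rewrite eq_le cnr_ge0 andbT.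
  apply/ler_addgt0Pr => e e0; rewrite add0r.
  pose M := nr l + q + 1.
  have M0 : 0 < M by rewrite /M; have := cnr_ge0 l; lra.
  have [N hN] := hl (e / (2 * M)) (divr_gt0 e0 (mulr_gt0 (ltr0Sn _ 1) M0)).
  have h1 := hN N.+1 (leqnSn _); have h2 := hN N (leqnn _).
  have -> : l - rs 2^-1 * (w + l ^+ 2)
    = - (v N.+1 - l) + rs 2^-1 * ((v N + l) * (v N - l)).
    by rewrite /=; ring.
  rewrite (le_trans (cnrD _ _)) // cnrN nhalf.
  have h3 := cnrM (v N + l) (v N - l).
  have h4 : nr (v N + l) <= M by have := cnrD (v N) l; have := nv N; rewrite /M; lra.
  have h5 := ler_pM (cnr_ge0 _) (cnr_ge0 _) h4 h2.
  have h6 : M * (e / (2 * M)) = e / 2 by field; rewrite gt_eqF.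
  have h7 : e / (2 * M) <= e / 2.
    rewrite ler_pM2l // lef_pV2 ?posrE ?mulr_gt0 // ler_peMr //.
    by rewrite /M; have := cnr_ge0 l; lra.
  lra.
exists (1 - l); first by rewrite rmorphB rmorph1 sl.
have h2l : 2 * l = w + l ^+ 2 by rewrite [in LHS]fl mulrA rs_half mul1r.
have -> : (1 - l) ^+ 2 = 1 - 2 * l + l ^+ 2 by ring.
by rewrite h2l; ring.
Qed.

Definition cpos x := st x = x /\ exists2 t, 0 <= t & nr (rs t - x) <= t.

Lemma cpos_sa x : cpos x -> st x = x.
Proof. by case. Qed.

Lemma sc_i_sqr : sc 'i%C * sc 'i%C = -1.
Proof. by rewrite -rmorphM -expr2 sqr_i rmorphN1. Qed.

Lemma st_i : st (sc 'i%C) = - sc 'i%C.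
Proof.
rewrite cadj_sc -rmorphN; congr (sc _).
by apply/eqP; rewrite eq_complex /= oppr0 !eqxx.
Qed.

(* [p] and [q] are the real and imaginary parts of [u = p + iq], and
   [u^* u = p^2 + q^2]. *)
Lemma cnr_sqr_le (p q : B) s : st p = p -> st q = q -> 0 <= s ->
  p ^+ 2 + q ^+ 2 = rs s -> nr (p ^+ 2) <= s.
Proof.
move=> sp sq s0 pq; pose u := p + sc 'i%C * q.
have su : st u = p - sc 'i%C * q by rewrite rmorphD rmorphM /= sp sq st_i; ring.
have uu : st u * u = rs s.
  rewrite su -pq; have -> : (p - sc 'i%C * q) * u
    = p ^+ 2 - (sc 'i%C * sc 'i%C) * q ^+ 2 by rewrite /u; ring.
  by rewrite sc_i_sqr; ring.
have nu : nr u ^+ 2 <= s by rewrite -cnr_stM uu (le_trans (cnr_rs _)) ?ger0_norm.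
have pu : nr p <= nr u.
  have : nr (rs 2 * p) <= nr u + nr u.
    rewrite -{2}(cnr_st u) (le_trans _ (cnrD _ _)) // su /u.
    by rewrite le_eqVlt; apply/orP; left; apply/eqP; congr nr; rewrite ?(rs_nat 2); ring.
  by rewrite cnrZ cabs_real ger0_norm //; lra.
rewrite cnr_sa // (le_trans _ nu) // ler_pXn2r ?nnegrE ?cnr_ge0 //.
Qed.

Lemma sqr_lt_le d s : st d = d -> nr (d ^+ 2) < s -> nr (rs s - d ^+ 2) <= s.
Proof.
move=> sd ds.
have s0 : 0 < s by apply: le_lt_trans ds; exact: cnr_ge0.
have ss : rs s * rs s^-1 = 1 by rewrite -rmorphM -rmorphM divff ?gt_eqF //= !rmorph1.
have [e se ee] : exists2 e, st e = e & e ^+ 2 = 1 - rs s^-1 * d ^+ 2.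
  apply: (@sqrt1_sub _ (nr (d ^+ 2) / s)).
  - by rewrite rmorphM rmorphXn /= sd st_rs.
  - by rewrite cnrZ cabs_real gtr0_norm ?invr_gt0 // mulrC.
  - by rewrite ltr_pdivrMr // mul1r.
pose f := rs (Num.sqrt s) * e.
have ff : f ^+ 2 = rs s - d ^+ 2.
  rewrite exprMn -rmorphXn -rmorphXn sqr_sqrtr ?ltW //= ee mulrBr mulr1.
  by rewrite mulrA ss mul1r.
rewrite -ff; apply: (@cnr_sqr_le _ d); rewrite ?ltW //.
- by rewrite rmorphM /= se st_rs.
- by rewrite ff subrK.
Qed.

Lemma cpos_sqr d : st d = d -> cpos (d ^+ 2).
Proof.
move=> sd; split; first by rewrite rmorphXn /= sd.
exists (nr (d ^+ 2) + 1); first by rewrite addr_ge0 ?cnr_ge0.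
by apply: sqr_lt_le => //; rewrite ltrDl.
Qed.

Lemma cpos_sqrt x e : cpos x -> 0 < e -> exists2 d, st d = d & d ^+ 2 = x + rs e.
Proof.
move=> [sx [t t0 xt]] e0; have te0 : 0 < t + e by rewrite ltr_wpDl.
have ss : rs (t + e) * rs (t + e)^-1 = 1.
  by rewrite -rmorphM -rmorphM divff ?gt_eqF //= !rmorph1.
have [d sd dd] : exists2 d, st d = d & d ^+ 2 = 1 - rs (t + e)^-1 * (rs t - x).
  apply: (@sqrt1_sub _ (t / (t + e))).
  - by rewrite rmorphM rmorphB /= sx !st_rs.
  - by rewrite cnrZ cabs_real gtr0_norm ?invr_gt0 // mulrC ler_pM2r ?invr_gt0.
  - by rewrite ltr_pdivrMr // mul1r ltrDl.
exists (rs (Num.sqrt (t + e)) * d); first by rewrite rmorphM /= sd st_rs.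
rewrite exprMn -rmorphXn -rmorphXn sqr_sqrtr ?ltW //= dd mulrBr mulr1.
by rewrite mulrA ss mul1r; ring.
Qed.

Lemma cpos_le x t : cpos x -> nr x <= t -> nr (rs t - x) <= t.
Proof.
move=> px xt; apply/ler_addgt0Pr => e e0.
have e4 : 0 < e / 4 by rewrite divr_gt0.
have [d sd dd] := cpos_sqrt px e4.
have h : nr (d ^+ 2) < t + e / 2.
  rewrite dd (le_lt_trans (cnrD _ _)) //; have := cnr_rs (e / 4).
  by rewrite (ger0_norm (ltW e4)); lra.
have := sqr_lt_le sd h; rewrite dd => h2.
have -> : rs t - x = (rs (t + e / 2) - (x + rs (e / 4))) - rs (e / 4).
  have {1}-> : e = e / 4 + e / 4 + e / 4 + e / 4 by field.
  have -> : (e / 4 + e / 4 + e / 4 + e / 4) / 2 = e / 4 + e / 4 by field.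
  by rewrite !rmorphD /=; ring.
rewrite (le_trans (cnrB _ _)) //; have := cnr_rs (e / 4).
by rewrite (ger0_norm (ltW e4)); lra.
Qed.

Lemma cposD x y : cpos x -> cpos y -> cpos (x + y).
Proof.
move=> px py; split; first by rewrite rmorphD /= !cpos_sa.
exists (nr x + nr y); first by rewrite addr_ge0 ?cnr_ge0.
have := cpos_le px (lexx _); have := cpos_le py (lexx _) => h1 h2.
have -> : rs (nr x + nr y) - (x + y) = (rs (nr x) - x) + (rs (nr y) - y) by ring.
by rewrite (le_trans (cnrD _ _)) // lerD.
Qed.

Lemma cpos_closed x : st x = x ->
  (forall e, 0 < e -> exists2 z, nr z <= e & cpos (x + z)) -> cpos x.
Proof.
move=> sx h; split=> //; exists (nr x + 1); first by rewrite addr_ge0 ?cnr_ge0.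
apply/ler_addgt0Pr => e e0.
have e1 : 0 < Num.min e 1 by rewrite lt_min e0 ltr01.
have [z ze /cpos_le pz] := h _ e1.
move: ze; rewrite le_min => /andP[ze z1].
have -> : rs (nr x + 1) - x = (rs (nr x + 1) - (x + z)) + z by ring.
rewrite (le_trans (cnrD _ _)) // lerD // pz //.
by rewrite (le_trans (cnrD _ _)) // lerD2l.
Qed.

Lemma cpos_mul x y : cpos x -> cpos y -> cpos (x * y).
Proof.
have small (e : R) z : 0 < e -> exists2 e', 0 < e' & nr (rs e' * z) <= e.
  move=> e0; have z0 : 0 < nr z + 1 by rewrite ltr_wpDl ?cnr_ge0.
  exists (e / (nr z + 1)); first by rewrite divr_gt0.
  rewrite cnrZ cabs_real (ger0_norm (divr_ge0 (ltW e0) (ltW z0))) -mulrA.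
  by rewrite ler_piMr ?(ltW e0) // mulrC ltW // ltr_pdivrMr // mul1r ltrDl.
have sqx d z : st d = d -> cpos z -> cpos (d ^+ 2 * z).
  move=> sd pz; apply: cpos_closed => [|e e0].
    by rewrite rmorphM rmorphXn /= sd cpos_sa.
  have [e' e'0 he] := small e (d ^+ 2) e0; exists (rs e' * d ^+ 2) => //.
  have [f sf ff] := cpos_sqrt pz e'0.
  have -> : d ^+ 2 * z + rs e' * d ^+ 2 = (d * f) ^+ 2 by rewrite exprMn ff; ring.
  by apply: cpos_sqr; rewrite rmorphM /= sd sf.
move=> px py; apply: cpos_closed => [|e e0].
  by rewrite rmorphM /= !cpos_sa.
have [e' e'0 he] := small e y e0; exists (rs e' * y) => //.
have [f sf ff] := cpos_sqrt px e'0.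
by rewrite -mulrDl -ff; exact: sqx.
Qed.

Lemma cpos_rs r : 0 <= r -> cpos (rs r).
Proof.
move=> r0; rewrite -(sqr_sqrtr r0) !rmorphXn /=; apply: cpos_sqr; exact: st_rs.
Qed.

Lemma cpos0 : cpos 0.
Proof. by rewrite -(rmorph0 sc); exact: (@cpos_rs 0). Qed.

Lemma cpos_sum (I : finType) (F : I -> B) :
  (forall i, cpos (F i)) -> cpos (\sum_i F i).
Proof.
by move=> h; elim/big_ind: _ => //; [exact: cpos0 | exact: cposD].
Qed.

Lemma cpos_stM x : cpos (st x * x).
Proof.
pose p := rs 2^-1 * (x + st x); pose q := rs 2^-1 * sc 'i%C * (x - st x).
have -> : st x * x = p ^+ 2 + q ^+ 2.
  have -> : p ^+ 2 + q ^+ 2 = rs 2^-1 * rs 2^-1 *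
     ((x + st x) ^+ 2 + (sc 'i%C * sc 'i%C) * (x - st x) ^+ 2) by rewrite /p /q; ring.
  rewrite sc_i_sqr.
  have -> : (x + st x) ^+ 2 + -1 * (x - st x) ^+ 2 = 2 * (2 * (st x * x)) by ring.
  have -> : rs 2^-1 * rs 2^-1 * (2 * (2 * (st x * x)))
    = (2 * rs 2^-1) * (2 * rs 2^-1) * (st x * x) by ring.
  by rewrite rs_half !mul1r.
apply: cposD; apply: cpos_sqr.
  by rewrite /p rmorphM rmorphD /= cadjK st_rs addrC.
by rewrite /q !rmorphM rmorphB /= cadjK st_rs st_i; ring.
Qed.

Lemma cpos_bound x t : 0 <= t -> cpos x -> cpos (rs t - x) -> nr x <= t.
Proof.
move=> t0 px py; apply/ler_addgt0Pr => e e0.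
have e3 : 0 < e / 3 by rewrite divr_gt0.
have [p sp pp] := cpos_sqrt px e3; have [q sq qq] := cpos_sqrt py e3.
have h : nr (p ^+ 2) <= t + e / 3 + e / 3.
  apply: (@cnr_sqr_le _ q) => //; first by rewrite !addr_ge0 // ltW.
  by rewrite pp qq !rmorphD /=; ring.
have -> : x = p ^+ 2 - rs (e / 3) by rewrite pp addrK.
rewrite (le_trans (cnrB _ _)) //; have := cnr_rs (e / 3).
by rewrite (ger0_norm (ltW e3)); lra.
Qed.

Lemma cpos_nr x t : st x = x -> nr x <= t -> cpos (rs t - x).
Proof.
move=> sx xt; split; first by rewrite rmorphB /= sx st_rs.
exists t; first exact: le_trans (cnr_ge0 _) xt.
by rewrite opprB addrC subrK.
Qed.

Lemma cpos_sandwich x y : st x = x -> cpos (y - x) -> cpos (y + x) -> nr x <= nr y.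
Proof.
move=> sx h1 h2.
have h3 : st y = y.
  have := cpos_sa h1; rewrite rmorphB /= sx => h.
  by rewrite -[st y](subrK x) h subrK.
have h4 : cpos (rs (nr y) - y) by exact: cpos_nr.
have h5 : nr (x ^+ 2) <= nr y ^+ 2.
  apply: cpos_bound; [by rewrite exprn_ge0 ?cnr_ge0 | exact: cpos_sqr|].
  have -> : rs (nr y ^+ 2) - x ^+ 2
     = (rs (nr y) - y + (y - x)) * (rs (nr y) - y + (y + x)) by ring.
  by apply: cpos_mul; exact: cposD.
by move: h5; rewrite cnr_sa // ler_pXn2r ?nnegrE ?cnr_ge0.
Qed.

Lemma cpos_mono x y : cpos x -> cpos (y - x) -> nr x <= nr y.
Proof.
move=> px pyx; apply: cpos_sandwich => //; first exact: cpos_sa.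
have -> : y + x = (y - x) + (x + x) by ring.
by apply: cposD => //; exact: cposD.
Qed.

Lemma cpos_antisym x : cpos x -> cpos (- x) -> x = 0.
Proof.
move=> h1 h2; apply/cnr_eq0/eqP; rewrite eq_le cnr_ge0 andbT -cnr0.
by apply: cpos_mono; rewrite ?sub0r.
Qed.

Lemma rs_sqmod (z : C) : rs (sqmod z) = st (sc z) * sc z.
Proof. by rewrite cadj_sc -rmorphM -sqmodE. Qed.

End Positivity.

(** * Expectations and functional calculus *)

Section States.
Context {R : realType} {B : comCStar R}.
Local Notation C := (Cplx R).
Local Notation sc := (@csc R B).
Local Notation st := (@cadj R B).
Local Notation nr := (@cnr R B).
Local Notation rs r := (sc (real_complex R r)).

(* A [B]-valued expectation on [X]; positivity only tests [f] on [K], so that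
   [E] is supported on [K]. *)
Record state (X : Type) (K : set X) (E : (X -> B) -> B) : Prop := State {
  stateD : forall f g, E (fun x => f x + g x) = E f + E g;
  stateZ : forall b f, E (fun x => b * f x) = b * E f;
  state1 : E (fun=> 1) = 1;
  state_st : forall f, E (fun x => st (f x)) = st (E f);
  state_pos : forall f, (forall x, K x -> cpos (f x)) -> cpos (E f)
}.

Section StateTheory.
Context {X : Type} {K : set X} {E : (X -> B) -> B}.
Hypothesis sE : state K E.

Lemma stateZr b f : E (fun x => f x * b) = E f * b.
Proof.
rewrite mulrC -(stateZ sE); congr E; apply/funext => x; exact: mulrC.
Qed.

Lemma state_const b : E (fun=> b) = b.
Proof.
rewrite -[RHS]mulr1 -(state1 sE) -(stateZ sE).
by congr E; apply/funext => x; rewrite mulr1.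
Qed.

Lemma stateN f : E (fun x => - f x) = - E f.
Proof.
rewrite -[RHS]mulN1r -(stateZ sE).
by congr E; apply/funext => x; rewrite mulN1r.
Qed.

Lemma stateB f g : E (fun x => f x - g x) = E f - E g.
Proof. by rewrite (stateD sE) stateN. Qed.

Lemma state_sum (J : Type) (r : seq J) (F : J -> X -> B) :
  E (fun x => \sum_(j <- r) F j x) = \sum_(j <- r) E (F j).
Proof.
elim: r => [|j r ih].
  by rewrite big_nil -[RHS]state_const; congr E; apply/funext => x; rewrite big_nil.
rewrite big_cons -ih -(stateD sE).
by congr E; apply/funext => x; rewrite big_cons.
Qed.

Lemma state_mono f g : (forall x, K x -> cpos (f x)) ->
  (forall x, K x -> cpos (g x - f x)) -> nr (E f) <= nr (E g).
Proof.
move=> hf hg; apply: cpos_mono; first exact: (state_pos sE).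
by rewrite -stateB; exact: (state_pos sE).
Qed.

Lemma state_bound (H : X -> C) (g : X -> B) :
  (forall x, K x -> cpos (g x - rs (cabs (H x)))) ->
  nr (E (fun x => sc (H x))) <= 2 * nr (E g).
Proof.
move=> hg.
have bound (h : X -> R) : (forall x, `|h x| <= cabs (H x)) ->
    nr (E (fun x => rs (h x))) <= nr (E g).
  move=> hh; apply: cpos_sandwich.
  - by rewrite -(state_st sE); congr E; apply/funext => x; exact: st_rs.
  - rewrite -stateB; apply: (state_pos sE) => x Kx.
    have -> : g x - rs (h x) = (g x - rs (cabs (H x))) + rs (cabs (H x) - h x) by ring.
    apply: cposD; first exact: hg.
    by apply: cpos_rs; rewrite subr_ge0; have := hh x; rewrite ler_norml => /andP[].
  - rewrite -(stateD sE); apply: (state_pos sE) => x Kx.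
    have -> : g x + rs (h x) = (g x - rs (cabs (H x))) + rs (cabs (H x) + h x) by ring.
    apply: cposD; first exact: hg.
    by apply: cpos_rs; have := hh x; rewrite ler_norml => /andP[]; lra.
have -> : E (fun x => sc (H x)) = E (fun x => rs (complex.Re (H x)))
    + sc 'i%C * E (fun x => rs (complex.Im (H x))).
  rewrite -(stateZ sE) -(stateD sE); congr E; apply/funext => x.
  by rewrite {1}(cplxE (H x)) rmorphD rmorphM.
rewrite (le_trans (cnrD _ _)) // cnrZ.
have -> : cabs ('i%C : C) = 1 by rewrite /= expr0n expr1n add0r sqrtr1.
have := bound _ (fun x => Re_le_cabs (H x)).
have := bound _ (fun x => Im_le_cabs (H x)); lra.
Qed.

End StateTheory.

Lemma state_dirac (X : Type) (K : set X) x0 : K x0 -> state K (fun f => f x0).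
Proof. by move=> Kx0; split=> // f; apply. Qed.

Lemma state_prod (X Y : Type) (K : set X) (L : set Y) E E' :
  state K E -> state L E' ->
  state (K `*` L) (fun f => E (fun x => E' (fun y => f (x, y)))).
Proof.
move=> sE sE'; split=> [f g|b f||f|f pf].
- by rewrite -(stateD sE); congr E; apply/funext => x; rewrite (stateD sE').
- by rewrite -(stateZ sE); congr E; apply/funext => x; rewrite (stateZ sE').
- by rewrite -[RHS](state1 sE); congr E; apply/funext => x; rewrite (state1 sE').
- by rewrite -(state_st sE); congr E; apply/funext => x; rewrite (state_st sE').
- by apply: (state_pos sE) => x Kx; apply: (state_pos sE') => y Ly; exact: pf.
Qed.

Lemma state_push (X Y : Type) (K : set X) (L : set Y) E (p : X -> Y) :
  state K E -> (forall x, K x -> L (p x)) -> state L (fun f => E (f \o p)).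
Proof.
move=> sE KL; split=> [f g|b f||f|f pf].
- exact: (stateD sE).
- exact: (stateZ sE).
- exact: (state1 sE).
- exact: (state_st sE).
- by apply: (state_pos sE) => x /KL /pf.
Qed.

Section Representation.
Context {X : Type} {I : finType} (K : set X) (phi : I -> X -> C).

Definition dev (a : I -> B) (x : X) : B :=
  \sum_i st (sc (phi i x) - a i) * (sc (phi i x) - a i).

Definition dist2 (x y : X) : R := \sum_i sqmod (phi i x - phi i y).

Lemma cpos_dev a x : cpos (dev a x).
Proof. by apply: cpos_sum => i; exact: cpos_stM. Qed.

Lemma dist2_ge0 x y : 0 <= dist2 x y.
Proof. by apply: sumr_ge0 => i _; exact: sqmod_ge0. Qed.

Lemma dist2C x y : dist2 x y = dist2 y x.
Proof. by apply: eq_bigr => i _; rewrite -opprB sqmodN. Qed.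

Lemma dist2_le_dev a x y : cpos (2 * (dev a x + dev a y) - rs (dist2 x y)).
Proof.
rewrite /dev /dist2 !rmorph_sum /= -big_split /= mulr_sumr -sumrB.
apply: cpos_sum => i; rewrite rs_sqmod (rmorphB sc) /=.
set u := sc (phi i x) - a i; set v := sc (phi i y) - a i.
have -> : sc (phi i x) - sc (phi i y) = u - v by rewrite /u /v; ring.
have -> : 2 * (st u * u + st v * v) - st (u - v) * (u - v) = st (u + v) * (u + v) by ring.
exact: cpos_stM.
Qed.

(* The key estimate: quantities controlled by [dist2] are negligible in
   expectation. *)
Lemma double_bound a E E' (H : X -> X -> C) (e c : R) :
  state K E -> state K E' -> 0 <= e -> 0 <= c ->
  (forall x y, K x -> K y -> cabs (H x y) <= e + c * dist2 x y) ->
  nr (E (fun x => E' (fun y => sc (H x y))))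
    <= 2 * (e + 2 * c * (nr (E (dev a)) + nr (E' (dev a)))).
Proof.
move=> sE sE' e0 c0 hH.
pose g p := rs e + rs c * (2 * (dev a p.1 + dev a p.2)).
have := @state_bound _ _ _ (state_prod sE sE') (fun p => H p.1 p.2) g.
move=> /= h; rewrite (le_trans (h _)) //.
  move=> [x y] /= [Kx Ky]; rewrite /g /=.
  have -> : rs e + rs c * (2 * (dev a x + dev a y)) - rs (cabs (H x y))
    = rs (e + c * dist2 x y - cabs (H x y))
      + rs c * (2 * (dev a x + dev a y) - rs (dist2 x y)) by ring.
  apply: cposD; first by apply: cpos_rs; rewrite subr_ge0 hH.
  by apply: cpos_mul; [exact: cpos_rs | exact: dist2_le_dev].
rewrite ler_pM2l // /g /=.
under eq_fun => x do rewrite (stateD sE') (state_const sE') !(stateZ sE')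
  (stateD sE') (state_const sE').
rewrite (stateD sE) (state_const sE) !(stateZ sE) (stateD sE) (state_const sE).
rewrite -(rs_nat 2) (le_trans (cnrD _ _)) // lerD //.
  by have := cnr_rs (B := B) e; rewrite ger0_norm.
rewrite !cnrZ !cabs_real !ger0_norm //.
by rewrite [2 * c]mulrC -mulrA ler_wpM2l // ler_pM2l // cnrD.
Qed.

Definition unif (f : X -> C) :=
  (exists M, forall x, K x -> cabs (f x) <= M) /\
  forall e, 0 < e -> exists2 c, 0 <= c &
    forall x y, K x -> K y -> cabs (f x - f y) <= e + c * dist2 x y.

Lemma small_mul (c e : R) : 0 <= c -> 0 < e -> exists2 d, 0 < d & c * d <= e.
Proof.
move=> c0 e0; have c1 : 0 < c + 1 by rewrite ltr_wpDl.
exists (e / (c + 1)); first by rewrite divr_gt0.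
by rewrite mulrCA ler_piMr ?(ltW e0) // ler_pdivrMr // mul1r lerDl.
Qed.

Lemma double_small a (H : X -> X -> C) e : 0 < e ->
  (forall e, 0 < e -> exists2 c, 0 <= c &
    forall x y, K x -> K y -> cabs (H x y) <= e + c * dist2 x y) ->
  exists2 d, 0 < d & forall E E', state K E -> state K E' ->
    nr (E (dev a)) <= d -> nr (E' (dev a)) <= d ->
    nr (E (fun x => E' (fun y => sc (H x y)))) <= e.
Proof.
move=> e0 hH; have e4 : 0 < e / 4 by rewrite divr_gt0.
have [c c0 hc] := hH _ e4.
have [d d0 hd] := small_mul (mulr_ge0 (ler0n _ 8) c0) e4.
exists d => // E E' sE sE' hE hE'.
rewrite (le_trans (double_bound a sE sE' (ltW e4) c0 hc)) //.
have := ler_wpM2l c0 hE; have := ler_wpM2l c0 hE'; lra.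
Qed.

Lemma unif_state_close a f e : unif f -> 0 < e -> exists2 d, 0 < d &
  forall E E', state K E -> state K E' -> nr (E (dev a)) <= d ->
    nr (E' (dev a)) <= d ->
    nr (E (fun x => sc (f x)) - E' (fun x => sc (f x))) <= e.
Proof.
move=> [_ uf] e0; have [d d0 hd] := double_small a e0 uf.
exists d => // E E' sE sE' hE hE'; have := hd E E' sE sE' hE hE'.
under eq_fun => x do (under eq_fun => y do rewrite rmorphB);
  under eq_fun => x do rewrite (stateB sE') (state_const sE').
by rewrite (stateB sE) (state_const sE).
Qed.

Lemma unif_cst (z : C) : unif (fun=> z).
Proof.
split; first by exists (cabs z).
move=> e e0; exists 0 => // x y _ _.
by rewrite subrr mul0r addr0 ComplexField.Normc.normc0 ltW.
Qed.

Lemma unif_coord i : (exists M, forall x, K x -> cabs (phi i x) <= M) ->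
  unif (phi i).
Proof.
move=> bd; split=> // e e0; exists (4 * e)^-1 => [|x y _ _].
  by rewrite invr_ge0 mulr_ge0 // ltW.
have h : sqmod (phi i x - phi i y) <= dist2 x y.
  rewrite /dist2 (bigD1 i) //= lerDl sumr_ge0 // => j _; exact: sqmod_ge0.
set t := cabs _; have e4 : 0 < 4 * e by rewrite mulr_gt0.
rewrite -(ler_pM2l e4) mulrDr mulrA divff ?gt_eqF // mul1r.
have := sqr_ge0 (t - 2 * e).
by move: h; rewrite -sqr_cabs -/t; nra.
Qed.

Lemma unifD f g : unif f -> unif g -> unif (fun x => f x + g x).
Proof.
move=> [[M hM] uf] [[N hN] ug]; split.
  exists (M + N) => x Kx.
  by rewrite (le_trans (le_normcD _ _)) // lerD ?hM ?hN.
move=> e e0; have e2 : 0 < e / 2 by rewrite divr_gt0.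
have [c c0 hc] := uf _ e2; have [c' c0' hc'] := ug _ e2.
exists (c + c') => [|x y Kx Ky]; first by rewrite addr_ge0.
have -> : f x + g x - (f y + g y) = (f x - f y) + (g x - g y) by ring.
rewrite (le_trans (le_normcD _ _)) //.
have := hc x y Kx Ky; have := hc' x y Kx Ky; lra.
Qed.

Lemma unifM f g : unif f -> unif g -> unif (fun x => f x * g x).
Proof.
move=> [[M hM] uf] [[N hN] ug].
pose M' := `|M| + 1; pose N' := `|N| + 1.
have M'0 : 0 < M' by rewrite ltr_wpDl.
have N'0 : 0 < N' by rewrite ltr_wpDl.
have hM' x : K x -> cabs (f x) <= M'.
  by move=> /hM h; rewrite (le_trans h) // (le_trans (ler_norm _)) // lerDl.
have hN' x : K x -> cabs (g x) <= N'.
  by move=> /hN h; rewrite (le_trans h) // (le_trans (ler_norm _)) // lerDl.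
clearbody M' N'; split.
  exists (M' * N') => x Kx; rewrite ComplexField.Normc.normcM.
  by rewrite ler_pM ?cabs_ge0 ?hM' ?hN'.
move=> e e0.
have [c c0 hc] := uf _ (divr_gt0 e0 (mulr_gt0 (ltr0Sn _ 1) N'0)).
have [c' c0' hc'] := ug _ (divr_gt0 e0 (mulr_gt0 (ltr0Sn _ 1) M'0)).
exists (N' * c + M' * c') => [|x y Kx Ky]; first by rewrite addr_ge0 // mulr_ge0 // ltW.
have -> : f x * g x - f y * g y = f x * (g x - g y) + (f x - f y) * g y by ring.
rewrite (le_trans (le_normcD _ _)) //.
rewrite !ComplexField.Normc.normcM.
have h1 := ler_pM (cabs_ge0 _) (cabs_ge0 _) (hM' x Kx) (hc' x y Kx Ky).
have h2 := ler_pM (cabs_ge0 _) (cabs_ge0 _) (hc x y Kx Ky) (hN' y Ky).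
rewrite (le_trans (lerD h1 h2)) // le_eqVlt; apply/orP; left; apply/eqP.
by field; rewrite !gt_eqF.
Qed.

Lemma unif_conj f : unif f -> unif (fun x => Num.conj (f x)).
Proof.
have cc (z : C) : cabs (Num.conj z) = cabs z.
  by case: z => x y; rewrite /= sqrrN.
move=> [[M hM] uf]; split; first by exists M => x Kx; rewrite cc hM.
move=> e /uf[c c0 hc]; exists c => // x y Kx Ky.
by rewrite -rmorphB cc hc.
Qed.

Context (a : I -> B).

Definition is_rep (f : X -> C) (b : B) :=
  forall e, 0 < e -> exists2 d, 0 < d & forall E, state K E ->
    nr (E (dev a)) <= d -> nr (E (fun x => sc (f x)) - b) <= e.

Definition approximable :=
  forall d, 0 < d -> exists2 E, state K E & nr (E (dev a)) <= d.

Lemma is_rep_cst z : is_rep (fun=> z) (sc z).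
Proof.
move=> e e0; exists 1 => // E sE _.
by rewrite (state_const sE) subrr cnr0 ltW.
Qed.

Lemma is_repD f g b c :
  is_rep f b -> is_rep g c -> is_rep (fun x => f x + g x) (b + c).
Proof.
move=> hf hg e e0; have e2 : 0 < e / 2 by rewrite divr_gt0.
have [d d0 hd] := hf _ e2; have [d' d0' hd'] := hg _ e2.
exists (Num.min d d'); first by rewrite lt_min d0 d0'.
move=> E sE; rewrite le_min => /andP[/(hd _ sE) h /(hd' _ sE) h'].
under eq_fun do rewrite rmorphD.
rewrite (stateD sE) opprD addrACA (le_trans (cnrD _ _)) //; lra.
Qed.

Lemma is_repZ z f b : is_rep f b -> is_rep (fun x => z * f x) (sc z * b).
Proof.
move=> hf e e0; have [d d0 hd] := small_mul (cabs_ge0 z) e0.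
have [d' d0' hd'] := hf _ d0; exists d' => // E sE /(hd' _ sE) h.
under eq_fun do rewrite rmorphM.
rewrite (stateZ sE) -mulrBr cnrZ (le_trans _ hd) // ler_wpM2l //.
exact: cabs_ge0.
Qed.

Lemma is_rep_conj f b : is_rep f b -> is_rep (fun x => Num.conj (f x)) (st b).
Proof.
move=> hf e /hf[d d0 hd]; exists d => // E sE /(hd _ sE).
by under [in X in _ -> X]eq_fun do rewrite -cadj_sc; rewrite (state_st sE) -rmorphB cnr_st.
Qed.

Lemma is_rep_coord i : is_rep (phi i) (a i).
Proof.
move=> e e0; exists (e ^+ 2) => [|E sE hE]; first by rewrite exprn_gt0.
set m := _ - a i.
have mE : m = E (fun x => sc (phi i x) - a i) by rewrite (stateB sE) (state_const sE).
pose v x := sc (phi i x) - a i.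
have h1 : nr (st m * m) <= nr (E (fun x => st (v x) * v x)).
  apply: cpos_mono; first exact: cpos_stM.
  have -> : E (fun x => st (v x) * v x) - st m * m
      = E (fun x => st (v x - m) * (v x - m)).
    have -> : (fun x => st (v x - m) * (v x - m))
        = (fun x => (st (v x) * v x - st m * v x) - (st (v x) * m - st m * m)).
      by apply/funext => x; ring.
    rewrite !(stateB sE) (state_const sE) (stateZ sE) (stateZr sE) (state_st sE).
    by rewrite -mE; ring.
  by apply: (state_pos sE) => x _; exact: cpos_stM.
have h2 : nr (E (fun x => st (v x) * v x)) <= nr (E (dev a)).
  apply: (state_mono sE) => x _; first exact: cpos_stM.
  rewrite /dev (bigD1 i) //= -/(v x) [_ + _ - _]addrAC subrr add0r.
  by elim/big_ind: _ => [||j _]; [exact: cpos0|exact: cposD|exact: cpos_stM].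
have := le_trans h1 (le_trans h2 hE).
by rewrite cnr_stM ler_pXn2r ?nnegrE ?cnr_ge0 // ltW.
Qed.

Lemma is_rep_eq f g b : (forall x, K x -> f x = g x) -> is_rep f b -> is_rep g b.
Proof.
move=> fg hf e /hf[d d0 hd]; exists d => // E sE /(hd _ sE).
suff -> : E (fun x => sc (f x)) = E (fun x => sc (g x)) by [].
apply: subr0_eq; rewrite -(stateB sE); apply: cpos_antisym.
  by apply: (state_pos sE) => x Kx; rewrite fg // subrr; exact: cpos0.
rewrite -(stateN sE); apply: (state_pos sE) => x Kx.
by rewrite fg // subrr oppr0; exact: cpos0.
Qed.

Hypothesis happ : approximable.

Lemma is_rep_ex f : unif f -> exists b, is_rep f b.
Proof.
move=> uf.
have en n : 0 < (n.+1%:R^-1 : R) by rewrite invr_gt0.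
have /choice[E hE] n : exists E, state K E /\ nr (E (dev a)) <= n.+1%:R^-1.
  by have [E sE hE] := happ (en n); exists E.
have small (d : R) : 0 < d -> exists N, forall n, (N <= n)%N ->
    nr (E n (dev a)) <= d.
  move=> d0; exists (Num.truncn d^-1) => n hn.
  have [_ h] := hE n; rewrite (le_trans h) //.
  rewrite -[leRHS]invrK lef_pV2 ?posrE ?invr_gt0 // ltW //.
  by rewrite (lt_le_trans (truncnS_gt _)) // ler_nat.
have [b hb] : exists l, forall e, 0 < e -> exists N, forall n, (N <= n)%N ->
    nr (E n (fun x => sc (f x)) - l) <= e.
  apply: c_complete => e /(unif_state_close a uf)[d /small[N hN] hd].
  by exists N => m n hm hn; apply: hd; [exact: (hE _).1|exact: (hE _).1|exact: hN|exact: hN].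
exists b => e e0; have e2 : 0 < e / 2 by rewrite divr_gt0.
have [d d0 hd] := unif_state_close a uf e2; have [N hN] := small _ d0.
have [N' hN'] := hb _ e2.
exists d => // F sF hF; pose n := maxn N N'.
have := hd F (E n) sF (hE n).1 hF (hN _ (leq_maxl _ _)).
have := hN' n (leq_maxr _ _) => h h'.
rewrite (_ : _ - b = (F (fun x => sc (f x)) - E n (fun x => sc (f x)))
  + (E n (fun x => sc (f x)) - b)); last by ring.
rewrite (le_trans (cnrD _ _)) //; lra.
Qed.

Lemma is_rep_unique f b c : is_rep f b -> is_rep f c -> b = c.
Proof.
move=> hb hc; apply/subr0_eq/cnr_eq0/eqP; rewrite eq_le cnr_ge0 andbT.
apply/ler_addgt0Pr => e e0; rewrite add0r.
have e2 : 0 < e / 2 by rewrite divr_gt0.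
have [d d0 hd] := hb _ e2; have [d' d0' hd'] := hc _ e2.
have [|E sE hE] := happ (_ : 0 < Num.min d d'); first by rewrite lt_min d0 d0'.
move: hE; rewrite le_min => /andP[/(hd _ sE) h /(hd' _ sE) h'].
rewrite (_ : b - c = (E (fun x => sc (f x)) - c) - (E (fun x => sc (f x)) - b)); last by ring.
rewrite (le_trans (cnrB _ _)) //; lra.
Qed.

Lemma is_repM f g b c : unif f -> unif g -> is_rep f b -> is_rep g c ->
  is_rep (fun x => f x * g x) (b * c).
Proof.
move=> uf ug hf hg; have [m hm] := is_rep_ex (unifM uf ug).
suff -> : b * c = m by [].
have [[M hM] _] := uf; have [_ ug2] := ug.
pose M' := `|M| + 1.
have M'0 : 0 < M' by rewrite ltr_wpDl.
have hM' x : K x -> cabs (f x) <= M'.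
  by move=> /hM h; rewrite (le_trans h) // (le_trans (ler_norm _)) // lerDl.
apply/subr0_eq/cnr_eq0/eqP; rewrite eq_le cnr_ge0 andbT.
apply/ler_addgt0Pr => e e0; rewrite add0r.
have e4 : 0 < e / 4 by rewrite divr_gt0.
have [d1 d10 hd1] : exists2 d, 0 < d & forall E E', state K E -> state K E' ->
    nr (E (dev a)) <= d -> nr (E' (dev a)) <= d ->
    nr (E (fun x => E' (fun y => sc (f x * (g y - g x))))) <= e / 4.
  apply: double_small => // e' e'0.
  have [c' c0' hc'] := ug2 _ (divr_gt0 e'0 M'0).
  exists (M' * c') => [|x y Kx Ky]; first by rewrite mulr_ge0 // ltW.
  rewrite ComplexField.Normc.normcM dist2C.
  rewrite (le_trans (ler_pM (cabs_ge0 _) (cabs_ge0 _) (hM' x Kx) (hc' y x Ky Kx))) //.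
  by rewrite mulrDr mulrCA divff ?gt_eqF // mulr1 mulrA.
have [s s0 hs] := small_mul (addr_ge0 (cnr_ge0 b) (cnr_ge0 c)) e4.
have s10 : 0 < Num.min s (Num.min 1 (e / 4)) by rewrite !lt_min s0 ltr01.
have [d2 d20 hd2] := hf _ s10; have [d3 d30 hd3] := hg _ s10.
have [d4 d40 hd4] := hm _ e4.
have dm : 0 < Num.min (Num.min d1 d2) (Num.min d3 d4).
  by rewrite !lt_min d10 d20 d30.
have [E sE] := happ dm.
rewrite !le_min => /andP[/andP[/[dup] h0 /(hd1 _ _ sE sE) /(_ h0) h1 /(hd2 _ sE)]].
rewrite !le_min => /and3P[h2 h2' h2''] /andP[/(hd3 _ sE) + /(hd4 _ sE) h4].
rewrite !le_min => /and3P[h3 h3' h3''].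
set F := E (fun x => sc (f x)) in h2 h2' h2''.
set G := E (fun x => sc (g x)) in h3 h3' h3''.
have h5 : nr (F * G - E (fun x => sc (f x * g x))) <= e / 4.
  move: h1; under eq_fun => x do (under eq_fun => y do rewrite rmorphM rmorphB).
  under eq_fun => x do rewrite (stateZ sE) (stateB sE) (state_const sE) mulrBr.
  rewrite (stateB sE) (stateZr sE) -/F -/G.
  by under eq_fun do rewrite -rmorphM.
have -> : b * c - m = (F * G - E (fun x => sc (f x * g x)))
   + (E (fun x => sc (f x * g x)) - m)
   - (b * (G - c) + c * (F - b) + (F - b) * (G - c)) by ring.
rewrite (le_trans (cnrB _ _)) // (le_trans (lerD (cnrD _ _) (cnrD _ _))) //.
have := cnrD (b * (G - c)) (c * (F - b)).
have := cnrM b (G - c); have := cnrM c (F - b); have := cnrM (F - b) (G - c).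
have := cnr_ge0 b; have := cnr_ge0 c; have := cnr_ge0 (F - b); have := cnr_ge0 (G - c).
move=> g0 f0 c0 b0.
have := ler_pM f0 g0 h2' h3''; rewrite mul1r.
have := ler_wpM2l b0 h3; have := ler_wpM2l c0 h2; lra.
Qed.

Lemma is_rep_norm f b M : (forall x, K x -> cabs (f x) <= M) -> is_rep f b ->
  nr b <= 2 * `|M|.
Proof.
move=> hM hb; apply/ler_addgt0Pr => e e0.
have [d d0 hd] := hb _ e0; have [E sE hE] := happ d0.
have := hd _ sE hE => h.
have h2 : nr (E (fun x => sc (f x))) <= 2 * nr (E (fun=> rs M)).
  apply: (state_bound sE) => x Kx; rewrite -!rmorphB.
  by apply: cpos_rs; rewrite subr_ge0 hM.
move: h2; rewrite (state_const sE) => h2; have := cnr_rs (B := B) M => h3.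
rewrite (_ : b = E (fun x => sc (f x)) - (E (fun x => sc (f x)) - b)); last by ring.
rewrite (le_trans (cnrB _ _)) //; lra.
Qed.

Lemma is_rep_pos (f : X -> R) b : (forall x, K x -> 0 <= f x) ->
  is_rep (fun x => (f x)%:C) b -> cpos b.
Proof.
move=> f0 hb; have sb : st b = b.
  apply: (is_rep_unique (f := fun x => (f x)%:C)) => //.
  apply: is_rep_eq (is_rep_conj hb) => x _ /=.
  by rewrite conjCE conjc_real.
apply: cpos_closed => // e /hb[d /happ[E sE hE] hd].
exists (E (fun x => rs (f x)) - b); first exact: hd.
rewrite addrC subrK; apply: (state_pos sE) => x Kx; exact/cpos_rs/f0.
Qed.

End Representation.
End States.

(** * The law of large numbers *)

Section Approximation.
Context {R : realType} {B : comCStar R}.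
Local Notation C := (Cplx R).
Local Notation sc := (@csc R B).
Local Notation st := (@cadj R B).
Local Notation nr := (@cnr R B).
Local Notation rs r := (sc (real_complex R r)).
Local Notation id1 := (fun _ : 'I_1 => @id C).

Lemma approximable_push (I : finType) (X Y : Type) (K : set X) (L : set Y)
    (phi : I -> X -> C) (psi : I -> Y -> C) (a : I -> B) :
  approximable K phi a ->
  (forall e, 0 < e -> exists p g, [/\ forall x, K x -> L (p x),
     forall x, K x -> \sum_i sqmod (psi i (p x) - phi i x) <= e + g x &
     is_rep K phi a (fun x => (g x)%:C) 0]) ->
  approximable L psi a.
Proof.
move=> happ hp d d0; have d8 : 0 < d / 8 by rewrite divr_gt0.
have [p [g [KL hpg /(_ _ d8)[d' d'0 hg]]]] := hp _ d8.
have [|E sE] := happ (Num.min d' (d / 8)); first by rewrite lt_min d'0.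
rewrite le_min => /andP[/(hg _ sE)]; rewrite subr0 => h1 h2.
exists (fun f => E (f \o p)); first exact: state_push KL.
have h3 : nr (E (dev psi a \o p))
    <= nr (E (fun x => 2 * (rs (d / 8) + rs (g x) + dev phi a x))).
  apply: (state_mono sE) => x Kx; first exact: cpos_dev.
  have -> : 2 * (rs (d / 8) + rs (g x) + dev phi a x) - (dev psi a \o p) x
    = 2 * rs (d / 8 + g x - \sum_i sqmod (psi i (p x) - phi i x))
      + (2 * (rs (\sum_i sqmod (psi i (p x) - phi i x)) + dev phi a x)
         - dev psi a (p x)).
    by rewrite !(rmorphB, rmorphD) /=; ring.
  apply: cposD.
    rewrite -(rs_nat 2) -!rmorphM; apply: cpos_rs.
    by rewrite mulr_ge0 // subr_ge0 hpg.
  rewrite /dev !rmorph_sum /= -big_split /= mulr_sumr -sumrB.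
  apply: cpos_sum => i; rewrite rs_sqmod (rmorphB sc) /=.
  set u := sc (psi i (p x)); set v := sc (phi i x).
  have -> : 2 * (st (u - v) * (u - v) + st (v - a i) * (v - a i))
    - st (u - a i) * (u - a i) = st (u - 2 * v + a i) * (u - 2 * v + a i) by ring.
  exact: cpos_stM.
rewrite (le_trans h3) // (stateZ sE) !(stateD sE) (state_const sE) -(rs_nat 2).
rewrite cnrZ cabs_real ger0_norm // .
have := cnrD (rs (d / 8) + E (fun x => rs (g x))) (E (dev phi a)).
have := cnrD (rs (d / 8)) (E (fun x => rs (g x))).
have := cnr_rs (B := B) (d / 8); rewrite (ger0_norm (ltW d8)); lra.
Qed.

Section LargeNumbers.
Context (a : B).
Let M := 2 * nr a + 1.
Let M0 : 0 < M.
Proof. by rewrite ltr_wpDl // mulr_ge0 // cnr_ge0. Qed.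

Let w (u : C) := rs 4^-1 * (1 + rs M^-1 * (st (sc u) * a + sc u * st a)).

(* The weights sum to 1, and the four points [M u], [u^4 = 1], average to [a]. *)
Let E1 (f : C -> B) :=
  f M%:C * w 1 + f (- M%:C) * w (-1) + f (M%:C * 'i%C) * w 'i%C
  + f (- (M%:C * 'i%C)) * w (- 'i%C).

Let quarter : 4 * rs 4^-1 = 1.
Proof. by rewrite -(rs_nat 4) -!rmorphM divff //= !rmorph1. Qed.

Let Minv : rs M * rs M^-1 = 1.
Proof. by rewrite -!rmorphM divff ?gt_eqF //= !rmorph1. Qed.

Let cpos_w u : cabs u = 1 -> cpos (w u).
Proof.
move=> u1; apply: cpos_mul; first by apply: cpos_rs; rewrite invr_ge0.
set y := st (sc u) * a + _; have sy : st y = y by rewrite /y rmorphD !rmorphM /= !cadjK; ring.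
have := @cpos_nr _ B (- (rs M^-1 * y)) 1.
rewrite !rmorph1 opprK; apply; first by rewrite rmorphN rmorphM /= st_rs sy.
rewrite cnrN cnrZ cabs_real gtr0_norm ?invr_gt0 // mulrC ler_pdivrMr // mul1r.
rewrite (le_trans (cnrD _ _)) // cadj_sc !cnrZ cnr_st u1.
have -> : cabs (Num.conj u) = 1 by rewrite -u1; case: (u) => p q; rewrite /= sqrrN.
by rewrite /M !mul1r; have := cnr_ge0 a; lra.
Qed.

Let cabs_i : cabs ('i%C : C) = 1.
Proof. by rewrite /= expr0n expr1n add0r sqrtr1. Qed.

Let disc (r : R) : set C := [set z | cabs z <= r].

Let state_E1 : state (disc M) E1.
Proof.
have sw u : cabs u = 1 -> st (w u) = w u by move=> /cpos_w/cpos_sa.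
have c1 : cabs (1 : C) = 1 by rewrite ComplexField.Normc.normc1.
have cN (z : C) : cabs (- z) = cabs z by rewrite normcN.
have cM : cabs (M%:C : C) = M by rewrite cabs_real gtr0_norm.
split.
- by move=> f g; rewrite /E1; ring.
- by move=> b f; rewrite /E1; ring.
- rewrite /E1 /w !rmorphN !rmorph1 st_i.
  by rewrite -[RHS]quarter; ring.
- move=> f; have := sw 1 c1; have := sw (-1) (etrans (cN _) c1).
  have := sw 'i%C cabs_i; have := sw (- 'i%C) (etrans (cN _) cabs_i).
  rewrite /E1; move: (w 1) (w (-1)) (w 'i%C) (w (- 'i%C)) => w1 w2 w3 w4.
  by move=> h4 h3 h2 h1; rewrite !rmorphD !rmorphM /= h1 h2 h3 h4.
- move=> f pf; have dM z : cabs z = M -> cpos (f z) by move=> h; apply: pf; rewrite /disc /= h.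
  rewrite /E1; repeat (apply: cposD); apply: cpos_mul;
    (apply: cpos_w || apply: dM);
    by rewrite ?cN ?ComplexField.Normc.normcM ?cabs_i ?cM ?mulr1.
Qed.

Let mean_E1 : E1 (fun z => sc z) = a.
Proof.
rewrite /E1 /w !rmorphN !rmorph1 st_i !rmorphM /=.
set j := sc 'i%C; have jj : j * j = -1 := sc_i_sqr.
set m := rs M; set n := rs M^-1; set q := rs _.
transitivity (4 * q * (m * n) * a + (j * j + 1) * (2 * q * m * n * (st a - a))).
  ring.
by rewrite jj addNr mul0r addr0 quarter Minv !mul1r.
Qed.

Let dev1 (b : B) (z : C) := st (sc z - b) * (sc z - b).

Let E_ n : (C -> B) -> B :=
  (fix E_ n := if n is m.+1 then fun f => E_ m (fun s => E1 (fun z => f (s + z)))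
               else fun f => f 0) n.

Let state_E n : state (disc (n%:R * M)) (E_ n).
Proof.
elim: n => [|n ih]; first by apply: state_dirac; rewrite /disc /mkset ComplexField.Normc.normc0 mul0r.
apply: (state_push (p := fun p => p.1 + p.2) (state_prod ih state_E1)).
move=> [s z] [/= hs hz]; rewrite /disc /= (le_trans (le_normcD _ _)) //.
by rewrite -natr1 mulrDl mul1r lerD.
Qed.

Let dev_E n : E_ n (dev1 (n%:R * a)) = n%:R * E1 (dev1 a).
Proof.
elim: n => [|n ih].
  by rewrite /= /dev1 rmorph0 !mul0r subr0 mulr0.
rewrite [LHS]/=.
have -> : (fun s => E1 (fun z => dev1 (n.+1%:R * a) (s + z)))
    = (fun s => dev1 (n%:R * a) s + E1 (dev1 a)).
  apply/funext => s.
  have -> : (fun z => dev1 (n.+1%:R * a) (s + z)) = (fun z =>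
      dev1 (n%:R * a) s + st (sc s - n%:R * a) * (sc z - a)
      + (sc s - n%:R * a) * st (sc z - a) + dev1 a z).
    apply/funext => z; rewrite /dev1 -natr1.
    have -> : sc (s + z) - (n%:R + 1) * a = (sc s - n%:R * a) + (sc z - a).
      by rewrite rmorphD /=; ring.
    by rewrite rmorphD /=; ring.
  rewrite !(stateD state_E1) (state_const state_E1) !(stateZ state_E1).
  rewrite (state_st state_E1) (stateB state_E1) mean_E1 (state_const state_E1).
  by rewrite subrr rmorph0 !mulr0 !addr0.
by rewrite (stateD (state_E n)) ih (state_const (state_E n)) -natr1 mulrDl mul1r.
Qed.

Lemma approximable_disc :
  approximable [set z | cabs z <= 2 * nr a + 1] id1 (fun=> a).
Proof.
move=> d d0; have [s s0 hs] := small_mul (cnr_ge0 (E1 (dev1 a))) d0.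
pose n := (Num.truncn s^-1).+1.
have n0 : 0 < n%:R :> R by rewrite ltr0n.
have ns : n%:R^-1 <= s.
  by rewrite -[leRHS]invrK lef_pV2 ?posrE ?invr_gt0 // ltW // truncnS_gt.
exists (fun f => E_ n (f \o (fun z : C => (n%:R^-1)%:C * z))).
  apply: (state_push (state_E n)) => z; rewrite /disc /= => hz.
  rewrite ComplexField.Normc.normcM cabs_real gtr0_norm ?invr_gt0 //.
  by rewrite mulrC ler_pdivrMr // mulrC.
have -> : dev id1 (fun=> a) \o (fun z : C => (n%:R^-1)%:C * z)
    = (fun z => rs n%:R^-1 * rs n%:R^-1 * dev1 (n%:R * a) z).
  apply/funext => z; rewrite /= /dev big_ord1 /dev1 rmorphM /=.
  have h : rs n%:R^-1 * n%:R = 1.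
    by rewrite -(rs_nat n) -!rmorphM mulVf ?gt_eqF //= !rmorph1.
  have {1 2}-> : a = rs n%:R^-1 * n%:R * a by rewrite h mul1r.
  by rewrite -mulrA -mulrBr rmorphM /= st_rs; ring.
rewrite (stateZ (state_E n)) dev_E.
have -> : rs n%:R^-1 * rs n%:R^-1 * (n%:R * E1 (dev1 a))
   = (rs n%:R^-1 * n%:R) * (rs n%:R^-1 * E1 (dev1 a)) by ring.
rewrite -(rs_nat n) -!rmorphM mulVf ?gt_eqF //= !rmorph1 mul1r.
rewrite cnrZ cabs_real gtr0_norm ?invr_gt0 // (le_trans _ hs) // mulrC.
by rewrite ler_wpM2l ?cnr_ge0.
Qed.

End LargeNumbers.

End Approximation.

(** * Localization at the spectrum *)

Section SpectralSupport.
Context {R : realType} {B : comCStar R}.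
Local Notation C := (Cplx R).
Local Notation sc := (@csc R B).
Local Notation st := (@cadj R B).
Local Notation nr := (@cnr R B).
Local Notation rs r := (sc (real_complex R r)).
Local Notation id1 := (fun _ : 'I_1 => @id C).

Lemma unif_max0 (X : Type) (I : finType) (K : set X) (phi : I -> X -> C) (f : X -> R) :
  unif K phi (fun x => (f x)%:C) -> unif K phi (fun x => (Num.max 0 (f x))%:C).
Proof.
have maxB (s t : R) : `|Num.max 0 s - Num.max 0 t| <= `|s - t|.
  rewrite /Num.max; case: ifP => s0; case: ifP => t0 //; rewrite ?subrr ?normr0 //.
  - rewrite subr0 !gtr0_norm //; move: t0 => /negbT; rewrite -leNgt => t0; lra.
  - move: s0 => /negbT; rewrite -leNgt => s0.
    rewrite distrC subr0 [leRHS]distrC !gtr0_norm //; lra.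
move=> [[M hM] uf]; split.
  exists M => x /hM; rewrite !cabs_real; apply: le_trans.
  by have := maxB (f x) 0; rewrite /Num.max ltxx !subr0.
move=> e /uf[c c0 hc]; exists c => // x y Kx Ky.
by have := hc x y Kx Ky; rewrite -!rmorphB !cabs_real; apply: le_trans.
Qed.

Definition bump (rho : R) (z0 z : C) : R := Num.max 0 (2 * rho - sqmod (z - z0)).

Section Bump.
Context (K : set C) (M : R) (a : B).
Hypothesis KM : forall z, K z -> cabs z <= M.
Hypothesis happ : approximable K id1 (fun=> a).

Lemma unif_id : unif K id1 id.
Proof. by apply: (@unif_coord _ _ _ K id1 ord0); exists M. Qed.

Lemma is_rep_id : is_rep K id1 (fun=> a) id a.
Proof. exact: (is_rep_coord K id1 (fun=> a) ord0). Qed.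

(* With [P] representing the bump and [b = a - z0], [P^2 + P (b^* b - 2 rho) = 0]
   is a sum of two positive elements. *)
Lemma bump_rep0 z0 c : (a - sc z0) * c = 1 ->
  exists2 rho, 0 < rho & is_rep K id1 (fun=> a) (fun z => (bump rho z0 z)%:C) 0.
Proof.
set b := a - sc z0 => bc.
have c1 : 0 < nr c + 1 by rewrite ltr_wpDl // cnr_ge0.
pose r := (nr c + 1)^-1; have r0 : 0 < r by rewrite invr_gt0.
exists (r ^+ 2 / 2); first by rewrite divr_gt0 // exprn_gt0.
pose h z := 2 * (r ^+ 2 / 2) - sqmod (z - z0).
have hE : (fun z => (h z)%:C) =
    (fun z => (r ^+ 2)%:C + (-1) * (Num.conj (z + - z0) * (z + - z0))) :> (C -> C).
  by apply/funext => z; rewrite /h rmorphB /= -sqmodE mulN1r mulrCA divff // mulr1.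
have uid := unif_id; have ucst z := unif_cst K id1 z.
have u1 : unif K id1 (fun z => z + - z0) := unifD uid (ucst (- z0)).
have u2 := unifM (unif_conj u1) u1.
have uh : unif K id1 (fun z => (h z)%:C).
  rewrite hE; exact: (unifD (ucst _) (unifM (ucst (-1)) u2)).
have r1 : is_rep K id1 (fun=> a) (fun z => z + - z0) b.
  rewrite /b -rmorphN; exact: is_repD is_rep_id (is_rep_cst _ _ _ _).
have r2 := is_repM happ (unif_conj u1) u1 (is_rep_conj r1) r1.
have rh : is_rep K id1 (fun=> a) (fun z => (h z)%:C) (rs (r ^+ 2) + sc (-1) * (st b * b)).
  rewrite hE; exact: (is_repD (is_rep_cst _ _ _ _) (is_repZ (-1) r2)).
have ug := unif_max0 uh.
have [P rP] := is_rep_ex happ ug.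
have PP : P * P = P * (rs (r ^+ 2) + sc (-1) * (st b * b)).
  apply: is_rep_unique (is_repM happ ug ug rP rP) _ => //.
  apply: is_rep_eq (is_repM happ ug uh rP rh) => z _.
  rewrite -!rmorphM; congr (_%:C); rewrite /Num.max.
  by case: ifP => // _; rewrite !mul0r.
have pP : cpos P by apply: is_rep_pos rP => // z _; rewrite le_max lexx.
have pY : cpos (st b * b - rs (r ^+ 2)).
  have -> : st b * b - rs (r ^+ 2) = st b * b * (1 - rs (r ^+ 2) * (st c * c)).
    have -> : st b * b * (1 - rs (r ^+ 2) * (st c * c))
      = st b * b - rs (r ^+ 2) * (st (b * c) * (b * c)) by ring.
    by rewrite bc rmorph1 !mulr1.
  apply: cpos_mul; first exact: cpos_stM.
  have := @cpos_nr _ B (rs (r ^+ 2) * (st c * c)) 1; rewrite !rmorph1; apply.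
    by rewrite !rmorphM /= cadjK st_rs; ring.
  rewrite cnrZ cabs_real ger0_norm ?sqr_ge0 // cnr_stM -exprMn.
  rewrite exprn_ile1 ?mulr_ge0 ?cnr_ge0 ?(ltW r0) //.
  by rewrite mulrC ler_pdivrMr // mul1r lerDl.
have P0 : P ^+ 2 = 0.
  apply: cpos_antisym; first exact/cpos_sqr/cpos_sa.
  rewrite expr2 PP rmorphN1.
  have -> : - (P * (rs (r ^+ 2) + -1 * (st b * b))) = P * (st b * b - rs (r ^+ 2)) by ring.
  exact: cpos_mul.
suff <- : P = 0 by [].
apply/cnr_eq0/eqP; rewrite -sqrf_eq0 -cnr_sa ?P0 ?cnr0 //; exact: cpos_sa.
Qed.

End Bump.

Lemma is_rep_sum0 (X : Type) (I : finType) (J : Type) (K : set X) (phi : I -> X -> C)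
    (a : I -> B) (r : seq J) (F : J -> X -> R) :
  (forall j, is_rep K phi a (fun x => (F j x)%:C) 0) ->
  is_rep K phi a (fun x => (\sum_(j <- r) F j x)%:C) 0.
Proof.
move=> hF; elim: r => [|j r ih].
  under eq_fun do rewrite big_nil.
  by rewrite -(rmorph0 sc); exact: is_rep_cst.
have := is_repD (hF j) ih; rewrite addr0; apply: is_rep_eq => x _.
by rewrite big_cons rmorphD.
Qed.

Lemma approximable_spectrum (a : B) (S : set C) s0 :
  S s0 -> (forall z, S z -> cabs z <= 1) ->
  (forall z, ~ S z -> exists c, (a - sc z) * c = 1) ->
  approximable S id1 (fun=> a).
Proof.
move=> Ss0 S1 Sinv; pose M := 2 * nr a + 1; pose D : set C := [set z | cabs z <= M].
have happ : approximable D id1 (fun=> a) := @approximable_disc _ _ a.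
have M0 : 0 <= M by rewrite addr_ge0 // mulr_ge0 // cnr_ge0.
have DM z : D z -> cabs z <= M by [].
apply: (approximable_push happ) => e e0.
have /choice[rho hrho] z : exists rho, 0 < rho /\
    (S z /\ rho = e \/
     ~ S z /\ is_rep D id1 (fun=> a) (fun w => (bump rho z w)%:C) 0).
  have [Sz|nSz] := pselect (S z); first by exists e; split=> //; left.
  have [c hc] := Sinv z nSz; have [r r0 hr] := bump_rep0 DM happ hc.
  by exists r; split=> //; right.
pose cc (q : R * R) : C := q.1 +i* q.2.
pose O (z : C) := [set q : R * R | sqmod (cc q - z) < rho z].
have Oo z : open (O z).
  case: z => x y; pose F (q : R * R) := (q.1 - x) * (q.1 - x) + (q.2 - y) * (q.2 - y).
  apply: (@open_comp _ _ F [set t | t < rho (x +i* y)]); last exact: open_lt.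
  have c1 : continuous (fun q : R * R => q.1 - x).
    by move=> q; apply: cvgB; [exact: cvg_fst | exact: cvg_cst].
  have c2 : continuous (fun q : R * R => q.2 - y).
    by move=> q; apply: cvgB; [exact: cvg_snd | exact: cvg_cst].
  by move=> q _; exact: (cvgD (cvgM (c1 q) (c1 q)) (cvgM (c2 q) (c2 q))).
have [l hl] : exists l : seq C, forall q : R * R, `|q.1| <= M -> `|q.2| <= M ->
    exists2 z, z \in l & O z q.
  have cK := compact_setX (@segment_compact R (- M) M) (@segment_compact R (- M) M).
  pose F : set_system (seq C) := [set P | exists l0 : seq C,
    forall l : seq C, {subset l0 <= l} -> P l].
  have FF : Filter F.
    split=> [|P P' [l0 h0] [l1 h1]|P P' PP' [l0 h0]]; first by exists [::].
      exists (l0 ++ l1) => l hl; split; [apply: h0 | apply: h1] => z hz;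
        by apply: hl; rewrite mem_cat hz ?orbT.
    by exists l0 => l /h0/PP'.
  have /compact_near_coveringP/(_ _ F (fun l q => exists2 z, z \in l & O z q) FF) := cK.
  case=> [q _|l hl]; last first.
    by exists l => q h1 h2; apply: (hl l) => //; split; rewrite /= in_itv /= -ler_norml.
  exists (O (cc q), [set l : seq C | cc q \in l]) => /=; last first.
    by move=> [q' l] /= [h1 h2]; exists (cc q).
  split; last by exists [:: cc q] => l; apply; rewrite mem_head.
  apply: open_nbhs_nbhs; split; first exact: Oo.
  by rewrite /O /= subrr sqmod0; have [] := hrho (cc q).
pose Q := (1 + M) ^+ 2.
pose g1 z w := if pselect (S z) then 0 else Q / rho z * bump (rho z) z w.
pose g w := \sum_(z <- l) g1 z w.
have g10 z w : 0 <= g1 z w.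
  rewrite /g1; case: pselect => [//|nSz]; apply: mulr_ge0.
    by apply: divr_ge0; [exact: sqr_ge0 | have [/ltW] := hrho z].
  by rewrite le_max lexx.
have g1rep z : is_rep D id1 (fun=> a) (fun w => (g1 z w)%:C) 0.
  rewrite /g1; case: pselect => Sz.
    by rewrite -(rmorph0 sc); exact: (is_rep_cst _ _ _ 0).
  have [_ [[/Sz //]|[_ h]]] := hrho z.
  have := is_repZ (Q / rho z)%:C h; rewrite mulr0; apply: is_rep_eq => w _.
  exact/esym/(rmorphM (real_complex R)).
have /choice[p hp] w : exists q, S q /\
    (sqmod (q - w) <= e \/ forall q, S q -> ~ sqmod (q - w) <= e).
  have [[q [Sq hq]]|nq] := pselect (exists q, S q /\ sqmod (q - w) <= e).
    by exists q; split=> //; left.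
  by exists s0; split=> //; right => q Sq hq; apply: nq; exists q.
exists p, g; split=> [x _|x Dx|]; [exact: (hp x).1| |exact: is_rep_sum0].
rewrite big_ord1 /=.
have gx0 : 0 <= g x by apply: sumr_ge0.
have [Sp [hle|hlt]] := hp x; first by rewrite (le_trans hle) // lerDl.
have [z zl Oz] := hl (complex.Re x, complex.Im x)
  (le_trans (Re_le_cabs x) (DM x Dx)) (le_trans (Im_le_cabs x) (DM x Dx)).
have {}Oz : sqmod (x - z) < rho z by move: Oz; rewrite /O /cc /=; case: (x).
have [rho0 [[Sz rz]|[nSz _]]] := hrho z.
  by case: (hlt z Sz); rewrite -sqmodN opprB -rz ltW.
have hQ : Q <= g1 z x.
  rewrite /g1; case: pselect => [//|nSz2].
  rewrite mulrAC ler_pdivlMr // ler_wpM2l ?sqr_ge0 // le_max.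
  by apply/orP; right; lra.
have : sqmod (p x - x) <= Q.
  rewrite -sqr_cabs ler_pXn2r ?nnegrE ?cabs_ge0 ?(addr_ge0 ler01 M0) //.
  by rewrite (le_trans (le_normcD _ _)) // normcN lerD ?S1 ?DM.
have hg : g1 z x <= g x by rewrite /g (big_rem z) //= lerDl sumr_ge0.
by move=> /le_trans; apply; rewrite (le_trans hQ) // (le_trans hg) // lerDr ltW.
Qed.

End SpectralSupport.

Section StarConjugate.
Context {R : realType} {B : comCStar R}.
Local Notation C := (Cplx R).
Local Notation sc := (@csc R B).
Local Notation st := (@cadj R B).
Local Notation nr := (@cnr R B).
Local Notation rs r := (sc (real_complex R r)).
Local Notation id1 := (fun _ : 'I_1 => @id C).

(* On a ray [z = r w] with [w^k = 1] this is [rho_n conj(w)], where the real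
   numbers [rho_n] increase to [r] by [r - rho_(n+1) <= (r - rho_n) (1 - r^(2k-2) / k)]. *)
Fixpoint conj_approx (T : pzRingType) (k : nat) (q z : T) (n : nat) : T :=
  if n is m.+1 then
    let v := conj_approx k q z m in v + q * (z ^+ k.-1 * (z ^+ k - v ^+ k))
  else 0.

Lemma conj_approx_cvg (k : nat) (e : R) : (0 < k)%N -> 0 < e ->
  exists n, forall (r : R) (w : C), 0 <= r <= 1 -> w ^+ k = 1 ->
    cabs (conj_approx k (k%:R^-1)%:C (r%:C * w) n - Num.conj (r%:C * w)) <= e.
Proof.
move=> k0 e0.
pose rho := fix rho n (r : R) := if n is m.+1 then
   rho m r + k%:R^-1 * (r ^+ k.-1 * (r ^+ k - rho m r ^+ k)) else 0.
have kR : 0 < k%:R :> R by rewrite ltr0n.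
have step (r s : R) : 0 <= r <= 1 -> 0 <= s <= r ->
    let s' := s + k%:R^-1 * (r ^+ k.-1 * (r ^+ k - s ^+ k)) in
    s <= s' <= r /\ r - s' <= (r - s) * (1 - k%:R^-1 * (r ^+ k.-1) ^+ 2).
  move=> /andP[r0 r1] /andP[s0 sr] s'.
  pose T := \sum_(i < k) r ^+ (k.-1 - i) * s ^+ i.
  have TE : r ^+ k - s ^+ k = (r - s) * T.
    rewrite /T -[in LHS](prednK k0) subrXX prednK //.
  have rk : 0 <= r ^+ k.-1 by exact: exprn_ge0.
  have rk1 : r ^+ k.-1 <= 1 by exact: exprn_ile1.
  have T0 : r ^+ k.-1 <= T.
    rewrite /T; case: (k) k0 => // k' _; rewrite big_ord_recl subn0 expr0 mulr1 lerDl.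
    by apply: sumr_ge0 => i _; rewrite mulr_ge0 // exprn_ge0.
  have Tk : T <= k%:R.
    rewrite /T (le_trans (ler_sum _ (_ : forall i, true -> _ <= 1))) //.
      by move=> i _; rewrite mulr_ile1 ?exprn_ge0 ?exprn_ile1 // (le_trans sr).
    by rewrite sumr_const card_ord.
  have q0 : 0 < k%:R^-1 :> R by rewrite invr_gt0.
  have qT : k%:R^-1 * T <= 1 by rewrite mulrC ler_pdivrMr // mul1r.
  have qT0 : 0 <= k%:R^-1 * T by rewrite mulr_ge0 ?(ltW q0) ?(le_trans rk).
  have s'E : s' = s + (r - s) * (r ^+ k.-1 * (k%:R^-1 * T)) by rewrite /s' TE; ring.
  have rsT : r ^+ k.-1 * (k%:R^-1 * T) <= 1 by rewrite mulr_ile1.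
  have rsT0 : 0 <= r ^+ k.-1 * (k%:R^-1 * T) by rewrite mulr_ge0.
  have rs0 : 0 <= r - s by rewrite subr_ge0.
  split; first by rewrite s'E; apply/andP; split; nra.
  have -> : r - s' = (r - s) * (1 - r ^+ k.-1 * (k%:R^-1 * T)) by rewrite s'E; ring.
  rewrite ler_wpM2l // lerB // expr2 mulrCA ler_wpM2l // ler_wpM2l //.
have rhoP n (r : R) : 0 <= r <= 1 -> 0 <= rho n r <= r /\
    r - rho n r <= r * (1 - k%:R^-1 * (r ^+ k.-1) ^+ 2) ^+ n.
  move=> r01; have /andP[r0 r1] := r01.
  elim: n => [|n [ih1 ih2]]; first by rewrite /= lexx r0 subr0 expr0 mulr1.
  have /= [/andP[h1 h2] h3] := step r _ r01 ih1; have /andP[ih10 _] := ih1.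
  split; first by rewrite h2 (le_trans ih10).
  rewrite (le_trans h3) // [_ ^+ n.+1]exprSr [leRHS]mulrA ler_wpM2r //.
  rewrite subr_ge0 mulr_ile1 ?invr_ge0 ?exprn_ge0 ?exprn_ile1 ?exprn_ge0 //.
  by rewrite invf_le1 // ler1n.
have [n hn] : exists n, forall r : R, 0 <= r <= 1 -> r - rho n r <= e.
  have [e1|e1] := leP 1 e.
    exists 0%N => r /andP[r0 r1] /=; rewrite subr0; exact: le_trans e1.
  pose x := 1 - k%:R^-1 * (e ^+ k.-1) ^+ 2.
  have ek : 0 < k%:R^-1 * (e ^+ k.-1) ^+ 2 by rewrite mulr_gt0 ?invr_gt0 ?exprn_gt0.
  have x0 : 0 <= x.
    rewrite subr_ge0 mulr_ile1 ?invr_ge0 ?exprn_ge0 ?exprn_ile1 ?exprn_ge0 ?(ltW e0) ?(ltW e1) //.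
    by rewrite invf_le1 // ler1n.
  have x1 : `|x| < 1 by rewrite ger0_norm // /x; lra.
  have := cvg_geometric (1 : R) x1 => /cvgrPdist_le /(_ e e0) [N _ /(_ N (leqnn N))].
  rewrite sub0r normrN /geometric /= mul1r ger0_norm ?exprn_ge0 // => hN.
  exists N => r r01; have /andP[r0 r1] := r01; have [/andP[h0 _] h] := rhoP N r r01.
  have [re|re] := leP r e; first by rewrite (le_trans _ re) // lerBlDr lerDl.
  rewrite (le_trans h) // (le_trans _ hN) // (le_trans (ler_piMl _ r1)) //.
    rewrite exprn_ge0 // subr_ge0 mulr_ile1 ?invr_ge0 ?exprn_ge0 ?exprn_ile1 ?exprn_ge0 //.
    by rewrite invf_le1 // ler1n.
  rewrite lerXn2r ?nnegrE //.
    rewrite subr_ge0 mulr_ile1 ?invr_ge0 ?exprn_ge0 ?exprn_ile1 ?exprn_ge0 //.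
    by rewrite invf_le1 // ler1n.
  rewrite lerB // ler_wpM2l ?invr_ge0 // lerXn2r ?nnegrE ?exprn_ge0 ?(ltW e0) //.
  by rewrite lerXn2r ?nnegrE ?(ltW e0) // ltW.
exists n => r w r01 wk.
have wu : cabs w = 1 := cabs_root k0 wk.
have wwc : Num.conj w * w = 1 by rewrite -sqmodE -sqr_cabs wu expr1n.
have wc : Num.conj w ^+ k = 1 by rewrite -rmorphXn wk rmorph1.
have wk1 : w ^+ k.-1 = Num.conj w.
  by rewrite -[RHS]mul1r -wk -[in RHS](prednK k0) exprSr -mulrA [w * _]mulrC wwc mulr1.
have -> : conj_approx k (k%:R^-1)%:C (r%:C * w) n = (rho n r)%:C * Num.conj w.
  elim: (n) => [|m ih]; first by rewrite /= mul0r.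
  rewrite /= ih !exprMn wk wc wk1 !mulr1.
  by rewrite rmorphD !rmorphM rmorphB !rmorphXn /=; ring.
have -> : Num.conj (r%:C * w) = r%:C * Num.conj w.
  by rewrite rmorphM /= [Num.conj (_%:C)]conjCE conjc_real.
rewrite -mulrBl -rmorphB ComplexField.Normc.normcM cabs_real.
have -> : cabs (Num.conj w) = 1 by rewrite -wu; case: (w) => p q; rewrite /= sqrrN.
have [/andP[_ h] _] := rhoP n r r01.
by rewrite mulr1 distrC ger0_norm ?subr_ge0 // hn.
Qed.

Lemma conj_approx_rep (S : set C) (a : B) k q n : 
  approximable S id1 (fun=> a) -> (forall z, S z -> cabs z <= 1) ->
  unif S id1 (fun z => conj_approx k q z n) /\
  is_rep S id1 (fun=> a) (fun z => conj_approx k q z n) (conj_approx k (sc q) a n).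
Proof.
move=> happ S1.
have X f b m : unif S id1 f -> is_rep S id1 (fun=> a) f b ->
    unif S id1 (fun z => f z ^+ m) /\ is_rep S id1 (fun=> a) (fun z => f z ^+ m) (b ^+ m).
  move=> uf rf; elim: m => [|m [ih1 ih2]].
    by rewrite expr0 -(rmorph1 sc); split; [exact: unif_cst|exact: is_rep_cst].
  have -> : (fun z => f z ^+ m.+1) = (fun z => f z * f z ^+ m).
    by apply/funext => z; rewrite exprS.
  by rewrite exprS; split; [exact: unifM|exact: is_repM].
have uid := unif_id S1; have rid := is_rep_id S a.
elim: n => [|n [ih1 ih2]] /=.
  by rewrite -(rmorph0 sc); split; [exact: unif_cst|exact: is_rep_cst].
have [u1 r1] := X _ _ k.-1 uid rid; have [u2 r2] := X _ _ k uid rid.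
have [u3 r3] := X _ _ k ih1 ih2.
have u4 := unifM (unif_cst S id1 (-1)) u3; have r4 := is_repZ (-1) r3.
have -> : a ^+ k - conj_approx k (sc q) a n ^+ k
   = a ^+ k + sc (-1) * conj_approx k (sc q) a n ^+ k by rewrite rmorphN1 mulN1r.
have -> : (fun z => conj_approx k q z n
      + q * (z ^+ k.-1 * (z ^+ k - conj_approx k q z n ^+ k)))
   = (fun z => conj_approx k q z n
      + q * (z ^+ k.-1 * (z ^+ k + -1 * conj_approx k q z n ^+ k))) :> (C -> C).
  by apply/funext => z; rewrite mulN1r.
have u5 := unifM u1 (unifD u2 u4).
split; first exact: (unifD ih1 (unifM (unif_cst _ _ q) u5)).
exact: (is_repD ih2 (is_repZ q (is_repM happ u1 (unifD u2 u4) r1 (is_repD r2 r4)))).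
Qed.

Lemma star_conj_limit (S : set C) (a : B) k : (0 < k)%N ->
  approximable S id1 (fun=> a) ->
  (forall z, S z -> exists (r : R) (w : C), [/\ 0 <= r <= 1, w ^+ k = 1 & z = r%:C * w]) ->
  (forall z, S z -> cabs z <= 1) ->
  forall e, 0 < e -> exists n, nr (conj_approx k (rs k%:R^-1) a n - st a) <= e.
Proof.
move=> k0 happ hS S1 e e0; have e2 : 0 < e / 2 by rewrite divr_gt0.
have [n hn] := conj_approx_cvg k0 e2; exists n.
have [_ r1] := conj_approx_rep k (k%:R^-1)%:C n happ S1.
have r2 := is_repD r1 (is_repZ (-1) (is_rep_conj (is_rep_id S a))).
move: r2; rewrite rmorphN1 mulN1r => r2.
have := is_rep_norm happ _ r2 => /(_ (e / 2)); rewrite ger0_norm ?(ltW e2) //.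
have -> : 2 * (e / 2) = e by field.
by apply=> z /hS[r [w [r01 wk ->]]]; rewrite mulN1r hn.
Qed.

End StarConjugate.

(** * Automorphisms *)

Section Equivariance.
Context {R : realType} {B : comCStar R}.
Local Notation C := (Cplx R).
Local Notation sc := (@csc R B).
Local Notation st := (@cadj R B).
Local Notation nr := (@cnr R B).
Local Notation rs r := (sc (real_complex R r)).

Record cstar_auto (al : B -> B) : Prop := CStarAuto {
  autoD : {morph al : x y / x + y};
  autoM : {morph al : x y / x * y};
  auto_sc : forall c, al (sc c) = sc c;
  auto_st : forall x, al (st x) = st (al x)
}.

Lemma autoB al : cstar_auto al -> {morph al : x y / x - y}.
Proof.
move=> hal x y; rewrite (autoD hal); congr (_ + _).
by rewrite -mulN1r -(rmorphN1 sc) (autoM hal) (auto_sc hal) rmorphN1 mulN1r.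
Qed.

Lemma auto_nr al x : cstar_auto al -> nr (al x) <= nr x.
Proof.
move=> hal; suff : nr (al x) ^+ 2 <= nr x ^+ 2.
  by rewrite ler_pXn2r ?nnegrE ?cnr_ge0.
apply/ler_addgt0Pr => e e0; rewrite -(cnr_stM (al x)).
apply: cpos_bound; first by rewrite addr_ge0 ?sqr_ge0 // ltW.
  exact: cpos_stM.
have px : cpos (rs (nr x ^+ 2) - st x * x).
  by apply: cpos_nr; rewrite ?cnr_stM // rmorphM /= cadjK mulrC.
have [d sd dd] := cpos_sqrt px e0.
have -> : rs (nr x ^+ 2 + e) - st (al x) * al x = al d ^+ 2.
  rewrite [RHS]expr2 -(autoM hal) -expr2 dd (autoD hal) (autoB hal) (autoM hal).
  by rewrite !(auto_sc hal) (auto_st hal) !rmorphD /=; ring.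
by apply: cpos_sqr; rewrite -(auto_st hal) sd.
Qed.

Lemma auto_cpos al x : cstar_auto al -> cpos x -> cpos (al x).
Proof.
move=> hal [sx [t t0 xt]]; split; first by rewrite -(auto_st hal) sx.
by exists t => //; rewrite -(auto_sc hal) -(autoB hal) (le_trans (auto_nr _ hal)).
Qed.

Lemma auto_sum al (I : finType) (F : I -> B) : cstar_auto al ->
  al (\sum_i F i) = \sum_i al (F i).
Proof.
move=> hal; apply: (big_morph al) => [x y|]; first exact: (autoD hal).
by rewrite -(rmorph0 sc) (auto_sc hal).
Qed.

Lemma state_auto (X : Type) (K : set X) E al al' : cstar_auto al ->
  cstar_auto al' -> cancel al' al -> state K E ->
  state K (fun f : X -> B => al (E (al' \o f))).
Proof.
move=> hal hal' al'K sE; split=> [f g|b f||f|f pf].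
- rewrite -(autoD hal) -(stateD sE); congr (al (E _)); apply/funext => x.
  exact: (autoD hal').
- rewrite -{2}(al'K b) -(autoM hal) -(stateZ sE); congr (al (E _)).
  by apply/funext => x; exact: (autoM hal').
- have -> : al' \o (fun=> 1) = (fun=> 1) :> (X -> B).
    by apply/funext => x /=; rewrite -(rmorph1 sc) (auto_sc hal').
  by rewrite (state1 sE) -(rmorph1 sc) (auto_sc hal).
- rewrite -(auto_st hal) -(state_st sE); congr (al (E _)); apply/funext => x.
  exact: (auto_st hal').
- apply: (auto_cpos hal); apply: (state_pos sE) => x Kx.
  by apply: (auto_cpos hal'); exact: pf.
Qed.

(* The transported states [al E al^-1] and [E (. o h)] both approximate the
   family [lam a]. *)
Lemma is_rep_auto (X : Type) (I : finType) (K : set X) (phi : I -> X -> C)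
    (a : I -> B) al al' (lam : C) (h : X -> X) f b c :
  cstar_auto al -> cstar_auto al' -> cancel al al' -> cancel al' al ->
  cabs lam = 1 -> (forall i, al (a i) = sc lam * a i) ->
  (forall x, K x -> K (h x)) -> (forall i x, phi i (h x) = lam * phi i x) ->
  approximable K phi a -> unif K phi f ->
  is_rep K phi a f b -> is_rep K phi a (f \o h) c -> c = al b.
Proof.
move=> hal hal' alK al'K lam1 ala Kh phih happ uf rb rc.
apply/subr0_eq/cnr_eq0/eqP; rewrite eq_le cnr_ge0 andbT.
apply/ler_addgt0Pr => e e0; rewrite add0r.
have e3 : 0 < e / 3 by rewrite divr_gt0.
pose a' i := sc lam * a i.
have [d d0 hd] := unif_state_close a' uf e3.
have [d1 d10 hd1] := rb _ e3; have [d2 d20 hd2] := rc _ e3.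
have [|E sE] := happ (Num.min d (Num.min d1 d2)); first by rewrite !lt_min d0 d10.
rewrite !le_min => /and3P[hE /(hd1 _ sE) h1 /(hd2 _ sE) h2].
have s1 := state_auto hal hal' al'K sE.
have s2 := state_push sE Kh.
have m1 : nr (al (E (al' \o dev phi a'))) <= d.
  rewrite (le_trans (auto_nr _ hal)) //.
  have -> // : al' \o dev phi a' = dev phi a.
  apply/funext => x; rewrite /= (auto_sum _ hal'); apply: eq_bigr => i _.
  rewrite (autoM hal') (auto_st hal') (autoB hal') (auto_sc hal').
  by rewrite /a' -ala alK.
have m2 : nr (E (dev phi a' \o h)) <= d.
  have -> // : dev phi a' \o h = dev phi a.
  apply/funext => x; apply: eq_bigr => i _; rewrite phih rmorphM -mulrBr.
  rewrite rmorphM mulrACA -rs_sqmod -sqr_cabs lam1 expr1n.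
  by rewrite !rmorph1 mul1r.
have := hd _ _ s1 s2 m1 m2.
have -> : al (E (al' \o (fun x => sc (f x)))) = al (E (fun x => sc (f x))).
  by congr (al (E _)); apply/funext => x; exact: (auto_sc hal').
move=> h3; set u := E (fun x => sc (f x)) in h1 h3.
set v := E _ in h2 h3.
have h4 := le_trans (auto_nr (u - b) hal) h1; rewrite (autoB hal) in h4.
have -> : c - al b = (al u - al b) - (al u - v) - (v - c) by ring.
rewrite (le_trans (cnrB _ _)) // (le_trans (lerD (cnrB _ _) (lexx _))) //; lra.
Qed.

End Equivariance.

(** * Bicommutants *)

Section AlgebraNorm.
Context {R : realType} {A : cstarAlgType R}.
Local Notation C := (Cplx R).
Implicit Types (x y : A) (c : C).

Lemma amul0l x : (0 ** x)%A = 0.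
Proof. by apply: (addrI (0 ** x)%A); rewrite -amulDl !addr0. Qed.

Lemma amul0r x : (x ** 0)%A = 0.
Proof. by apply: (addrI (x ** 0)%A); rewrite -amulDr !addr0. Qed.

Lemma amulNl x y : ((- x) ** y)%A = - (x ** y)%A.
Proof. by apply: (addrI (x ** y)%A); rewrite -amulDl !subrr amul0l. Qed.

Lemma amulNr x y : (x ** (- y))%A = - (x ** y)%A.
Proof. by apply: (addrI (x ** y)%A); rewrite -amulDr !subrr amul0r. Qed.

Lemma amulBl x y z : ((x - y) ** z)%A = (x ** z)%A - (y ** z)%A.
Proof. by rewrite amulDl amulNl. Qed.

Lemma amulBr x y z : (x ** (y - z))%A = (x ** y)%A - (x ** z)%A.
Proof. by rewrite amulDr amulNr. Qed.

Lemma star0 : star (0 : A) = 0.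
Proof. by apply: (addrI (star 0)); rewrite -starD !addr0. Qed.

Lemma starN x : star (- x) = - star x.
Proof. by apply: (addrI (star x)); rewrite -starD !subrr star0. Qed.

Lemma star1 : star (1%A : A) = 1%A.
Proof. by rewrite -[LHS]amul1l -{1}[1%A]starK -starM amul1l starK. Qed.

Definition nrm x : R := complex.Re (`|x| : C).

Lemma nrmE x : `|x| = (nrm x)%:C :> C.
Proof. by rewrite /nrm RRe_real // ger0_real. Qed.

Lemma nrmD x y : nrm (x + y) <= nrm x + nrm y.
Proof. by rewrite -lecR rmorphD /= -!nrmE ler_normD. Qed.

Lemma nrmM x y : nrm (x ** y)%A <= nrm x * nrm y.
Proof. by rewrite -lecR rmorphM /= -!nrmE anormM. Qed.

Lemma nrmZ c x : nrm (c *: x) = cabs c * nrm x.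
Proof. by apply: (@complexI R); rewrite rmorphM /= -!nrmE -normCE normrZ. Qed.

Lemma nrm_eq0 x : nrm x = 0 -> x = 0.
Proof. by move=> h; apply/eqP; rewrite -normr_eq0 nrmE h. Qed.

Lemma nrm_stM x : nrm (star x ** x)%A = nrm x ^+ 2.
Proof. by apply: (@complexI R); rewrite rmorphXn /= -!nrmE cstar_norm. Qed.

Lemma nrmN x : nrm (- x) = nrm x.
Proof. by rewrite /nrm normrN. Qed.

Lemma nrm_ge0 x : 0 <= nrm x.
Proof. by rewrite -lecR -nrmE normr_ge0. Qed.

Lemma gt0_cplx c : 0 < c -> exists2 e : R, 0 < e & c = e%:C.
Proof.
by rewrite ltcE => /andP[/eqP h h2]; exists (complex.Re c) => //; case: c h h2 => p q /= ->.
Qed.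

Lemma nrm_complete (u : nat -> A) :
  (forall e, 0 < e -> exists N, forall m n, (N <= m)%N -> (N <= n)%N ->
     nrm (u m - u n) <= e) ->
  exists l, forall e, 0 < e -> exists N, forall n, (N <= n)%N -> nrm (u n - l) <= e.
Proof.
move=> hu; have : cauchy (u @ \oo).
  apply/cauchy_exP => _ /gt0_cplx[e e0 ->].
  have [N hN] := hu _ (divr_gt0 e0 (ltr0Sn _ 1)); exists (u N), N => // n Nn.
  rewrite -ball_normE /= nrmE ltcR (le_lt_trans (hN _ _ (leqnn _) Nn)) //.
  by rewrite ltr_pdivrMr // ltr_pMr // ltr1n.
move=> /cauchy_cvg /cvg_ex[l /cvgrPdist_le hl]; exists l => e e0.
have [|N _ hN] := hl e%:C; first by rewrite ltcR.
by exists N => n /hN; rewrite distrC nrmE lecR.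
Qed.

Definition commutant (S : set A) : set A :=
  [set x | forall y, S y -> (x ** y = y ** x)%A].

Definition bicommutant (S : set A) : set A := commutant (commutant S).

Lemma sub_bicommutant S : S `<=` bicommutant S.
Proof. by move=> x Sx y /(_ x Sx). Qed.

Record comm_star (S : set A) : Prop := CommStar {
  comm_starC : forall x y, S x -> S y -> (x ** y = y ** x)%A;
  comm_star_st : forall x, S x -> S (star x)
}.

Section CommutantClosure.
Context (T : set A).

Lemma commutantD x y : commutant T x -> commutant T y -> commutant T (x + y).
Proof. by move=> hx hy z Tz; rewrite amulDl amulDr hx ?hy. Qed.

Lemma commutant0 : commutant T 0.
Proof. by move=> z Tz; rewrite amul0l amul0r. Qed.

Lemma commutantZ c x : commutant T x -> commutant T (c *: x).
Proof. by move=> hx z Tz; rewrite -ascaleAl -ascaleAr hx. Qed.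

Lemma commutantN x : commutant T x -> commutant T (- x).
Proof. by rewrite -scaleN1r; exact: commutantZ. Qed.

Lemma commutant1 : commutant T 1%A.
Proof. by move=> z Tz; rewrite amul1l amul1r. Qed.

Lemma commutantM x y : commutant T x -> commutant T y -> commutant T (x ** y)%A.
Proof. by move=> hx hy z Tz; rewrite -amulA hy // amulA hx // amulA. Qed.

Lemma commutant_lim x : (forall e, 0 < e -> exists2 y, commutant T y & nrm (y - x) <= e) ->
  commutant T x.
Proof.
move=> hx z Tz; apply/subr0_eq/nrm_eq0/eqP; rewrite eq_le nrm_ge0 andbT.
apply/ler_addgt0Pr => e e0; rewrite add0r.
have [d d0 hd] := small_mul (mulr_ge0 (ler0n R 2) (nrm_ge0 z)) e0.
have [y hy hyx] := hx _ d0.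
have -> : (x ** z)%A - (z ** x)%A = (z ** (y - x))%A - ((y - x) ** z)%A.
  by rewrite amulBl amulBr hy // opprB addrCA addrAC subrr add0r addrC.
rewrite (le_trans (nrmD _ _)) // nrmN (le_trans _ hd) //.
rewrite (le_trans (lerD (nrmM _ _) (nrmM _ _))) //.
have := ler_wpM2l (nrm_ge0 z) hyx; lra.
Qed.

End CommutantClosure.

Lemma commutant_star S x : (forall y, S y -> S (star y)) ->
  commutant S x -> commutant S (star x).
Proof.
by move=> hS hx y Sy; rewrite -{1}[y]starK -starM -hx ?starM ?starK //; exact: hS.
Qed.

Lemma bicommutantC S x y : comm_star S -> bicommutant S x -> bicommutant S y ->
  (x ** y = y ** x)%A.
Proof.
move=> hS hx hy; apply: hx => z Sz; apply: hy => w Sw; exact: (comm_starC hS).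
Qed.

End AlgebraNorm.

Section Bicommutant.
Context {R : realType} {A : cstarAlgType R} (S : set A) (hS : comm_star S).
Local Notation C := (Cplx R).

(* The proof [h] is a parameter of the type because commutativity depends on it. *)
Record bicomm (h : comm_star S) := Bicomm {
  bval : A;
  bvalP : `[< bicommutant S bval >]
}.

HB.instance Definition _ h := [isSub for @bval h].
HB.instance Definition _ h := [Choice of @bicomm h by <:].

Local Notation B := (bicomm hS).

Lemma bval_inj : injective (@bval hS).
Proof. exact: val_inj. Qed.

Lemma bvalT (x : B) : bicommutant S (bval x).
Proof. exact/asboolP/bvalP. Qed.

Definition bmk x (hx : bicommutant S x) : B := Bicomm hS (asboolT hx).

Definition badd (x y : B) := bmk (commutantD (bvalT x) (bvalT y)).
Definition bopp (x : B) := bmk (commutantN (bvalT x)).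
Definition bzero : B := bmk (@commutant0 _ _ (commutant S)).
Definition bone : B := bmk (@commutant1 _ _ (commutant S)).
Definition bmul (x y : B) := bmk (commutantM (bvalT x) (bvalT y)).
Definition bstar (x : B) := bmk (commutant_star
  (fun y => commutant_star (comm_star_st hS)) (bvalT x)).
Definition bscal (c : C) : B := bmk (commutantZ c (@commutant1 _ _ (commutant S))).

End Bicommutant.

Section BicommutantRing.
Context {R : realType} {A : cstarAlgType R} (S : set A) (hS : comm_star S).
Local Notation C := (Cplx R).
Local Notation B := (bicomm hS).

Fact baddA : associative (@badd _ _ _ hS).
Proof. by move=> x y z; apply: bval_inj; rewrite /= addrA. Qed.
Fact baddC : commutative (@badd _ _ _ hS).
Proof. by move=> x y; apply: bval_inj; rewrite /= addrC. Qed.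
Fact badd0 : left_id (@bzero _ _ _ hS) (@badd _ _ _ hS).
Proof. by move=> x; apply: bval_inj; rewrite /= add0r. Qed.
Fact baddN : left_inverse (@bzero _ _ _ hS) (@bopp _ _ _ hS) (@badd _ _ _ hS).
Proof. by move=> x; apply: bval_inj; rewrite /= addNr. Qed.

HB.instance Definition _ := GRing.isZmodule.Build B baddA baddC badd0 baddN.

Fact bmulA : associative (@bmul _ _ _ hS).
Proof. by move=> x y z; apply: bval_inj; rewrite /= amulA. Qed.
Fact bmulC : commutative (@bmul _ _ _ hS).
Proof. by move=> x y; apply: bval_inj; exact: (bicommutantC hS (bvalT x) (bvalT y)). Qed.
Fact bmul1 : left_id (@bone _ _ _ hS) (@bmul _ _ _ hS).
Proof. by move=> x; apply: bval_inj; rewrite /= amul1l. Qed.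
Fact bmulDl : left_distributive (@bmul _ _ _ hS) +%R.
Proof. by move=> x y z; apply: bval_inj; rewrite /= amulDl. Qed.

HB.instance Definition _ := GRing.Zmodule_isComPzRing.Build B bmulA bmulC bmul1 bmulDl.

Lemma bvalD (x y : B) : bval (x + y) = bval x + bval y. Proof. by []. Qed.
Lemma bval0 : bval (0 : B) = 0. Proof. by []. Qed.
Lemma bval1 : bval (1 : B) = 1%A. Proof. by []. Qed.
Lemma bvalM (x y : B) : bval (x * y) = (bval x ** bval y)%A. Proof. by []. Qed.

Fact bscal_additive : zmod_morphism (@bscal _ _ _ hS).
Proof. by move=> c d; apply: bval_inj; rewrite /= scalerBl. Qed.
Fact bscal_mult : monoid_morphism (@bscal _ _ _ hS).
Proof.
split=> [|c d]; apply: bval_inj; rewrite /= ?scale1r //.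
by rewrite -ascaleAl amul1l scalerA.
Qed.
HB.instance Definition _ := GRing.isZmodMorphism.Build C B (@bscal _ _ _ hS) bscal_additive.
HB.instance Definition _ := GRing.isMonoidMorphism.Build C B (@bscal _ _ _ hS) bscal_mult.

Fact bstar_additive : zmod_morphism (@bstar _ _ _ hS).
Proof. by move=> x y; apply: bval_inj; rewrite /= starD starN. Qed.
Fact bstar_mult : monoid_morphism (@bstar _ _ _ hS).
Proof.
split=> [|x y]; first by apply: bval_inj; rewrite /= star1.
by rewrite mulrC; apply: bval_inj; rewrite /= starM.
Qed.
HB.instance Definition _ := GRing.isZmodMorphism.Build B B (@bstar _ _ _ hS) bstar_additive.
HB.instance Definition _ := GRing.isMonoidMorphism.Build B B (@bstar _ _ _ hS) bstar_mult.

Fact bnrmZ (c : C) (x : B) : nrm (bval (bscal hS c * x)) = cabs c * nrm (bval x).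
Proof. by rewrite /= -ascaleAl amul1l nrmZ. Qed.

Fact bnrm_eq0 (x : B) : nrm (bval x) = 0 -> x = 0.
Proof. by move=> h; apply: bval_inj; exact: nrm_eq0. Qed.

Fact bstarK : involutive (@bstar _ _ _ hS).
Proof. by move=> x; apply: bval_inj; rewrite /= starK. Qed.

Fact bstar_scal (c : C) : bstar (bscal hS c) = bscal hS (Num.conj c).
Proof. by apply: bval_inj; rewrite /= starZ star1. Qed.

Fact bcomplete (u : nat -> B) :
  (forall e, 0 < e -> exists N, forall m n, (N <= m)%N -> (N <= n)%N ->
     nrm (bval (u m - u n)) <= e) ->
  exists l : B, forall e, 0 < e -> exists N, forall n, (N <= n)%N ->
     nrm (bval (u n - l)) <= e.
Proof.
move=> /nrm_complete[l hl].
suff hbl : bicommutant S l by exists (bmk hS hbl).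
apply: commutant_lim => e /hl[N /(_ N (leqnn N)) hN].
by exists (bval (u N)) => //; exact: bvalT.
Qed.

Definition bicommCStar : comCStar R := @ComCStar R B (@bscal _ _ _ hS)
  (@bstar _ _ _ hS) (fun x => nrm (bval x)) (fun x y => nrmD _ _)
  (fun x y => nrmM _ _) bnrmZ bnrm_eq0 bstarK bstar_scal
  (fun x => nrm_stM _) bcomplete.

End BicommutantRing.

(** * Stars and products of stars *)

Section RootsOfUnity.
Context {R : realType} (k : nat) (hk : (2 <= k)%N).
Local Notation C := (Cplx R).

Definition cis (x : R) : C := cos x +i* sin x.

Lemma cisD x y : cis (x + y) = cis x * cis y.
Proof. by apply/eqP; rewrite eq_complex /= cosD sinD eqxx addrC eqxx. Qed.

Lemma cis0 : cis 0 = 1.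
Proof. by rewrite /cis cos0 sin0. Qed.

Definition zeta : C := cis (2 * pi / k%:R).

Lemma zetaX m : zeta ^+ m = cis (2 * pi * m%:R / k%:R).
Proof.
elim: m => [|m ih]; first by rewrite mulr0 mul0r cis0.
rewrite exprS ih -cisD; congr cis; rewrite -natr1; ring.
Qed.

Lemma zeta_prim : k.-primitive_root zeta.
Proof.
have k0 : (0 < k)%N by exact: ltnW.
have kR : 0 < k%:R :> R by rewrite ltr0n.
apply/andP; split=> //; apply/forallP => i; rewrite unity_rootE zetaX.
apply/eqP; have [->|ik] := eqVneq i.+1 k.
  by rewrite (mulfK (lt0r_neq0 kR)) /cis mulr_natl cos2pi sin2pi !eqxx.
apply/negP => /eqP[]; set x := _ / _.
have hik : (i.+1 < k)%N by rewrite ltn_neqAle ik ltn_ord.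
pose y : R := pi * i.+1%:R / k%:R.
have -> : x = y + y by rewrite /x /y; ring.
rewrite cosD -!expr2 cos2sin2 => h _.
have : 0 < sin y.
  apply: sin_gt0_pi; rewrite /y divr_gt0 ?mulr_gt0 ?pi_gt0 // andTb.
  by rewrite ltr_pdivrMr // ltr_pM2l ?pi_gt0 // ltr_nat.
by move=> s0; have := exprn_gt0 2 s0; lra.
Qed.

Context (gamma : 'Z_k -> C) (hgamma : dual_generator gamma).

Lemma gammaD g h : gamma (g + h) = gamma g * gamma h.
Proof. by have [[]] := hgamma. Qed.

Lemma cabs_gamma g : cabs (gamma g) = 1.
Proof.
have [[_ h] _] := hgamma.
by apply: (@complexI R); rewrite -normCE h.
Qed.

Lemma gamma_neq0 g : gamma g != 0.
Proof.
apply/eqP => h; have := cabs_gamma g.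
by rewrite h ComplexField.Normc.normc0 => /eqP; rewrite eq_sym oner_eq0.
Qed.

Lemma gamma0 : gamma 0 = 1.
Proof.
by apply: (mulfI (gamma_neq0 0)); rewrite -gammaD addr0 mulr1.
Qed.

Lemma gammaMn g n : gamma (g *+ n) = gamma g ^+ n.
Proof.
elim: n => [|n ih]; first by rewrite mulr0n gamma0.
by rewrite mulrS gammaD ih exprS.
Qed.

Lemma gammaN g : gamma (- g) = (gamma g)^-1.
Proof.
by apply: (mulfI (gamma_neq0 g)); rewrite -gammaD subrr gamma0 divff ?gamma_neq0.
Qed.

Lemma Zk_mulk (g : 'Z_k) : g *+ k = 0.
Proof. by rewrite -mulr_natr pchar_Zp // mulr0. Qed.

Lemma gammaX g : gamma g ^+ k = 1.
Proof. by rewrite -gammaMn Zk_mulk gamma0. Qed.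

Let chi (g : 'Z_k) : C := zeta ^+ g.

Let chi_char : is_character chi.
Proof.
split=> [g h|g].
  rewrite /chi -exprD -(prim_expr_mod zeta_prim (g + h)%N) -[RHS](prim_expr_mod zeta_prim).
  by case: (k) hk g h => [|[|k']] // _ g h /=; rewrite modn_mod.
by rewrite normCE (@cabs_root _ k) ?(ltnW hk) // /chi exprAC (prim_expr_order zeta_prim) expr1n.
Qed.

Lemma gamma_inj : injective gamma.
Proof.
have [_ /(_ chi chi_char)[m hm]] := hgamma.
move=> g h gh; have : chi g == chi h by rewrite !hm gh.
rewrite /chi (eq_prim_root_expr zeta_prim) => /eqP.
case: (k) hk g h {gh} => [|[|k']] // _ g h.
by rewrite !modn_small ?ltn_ord // => /val_inj.
Qed.

Lemma gamma_root (z : C) : z ^+ k = 1 -> exists g, gamma g = z.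
Proof.
move=> /(prim_rootP zeta_prim)[i ->].
have [_ /(_ chi chi_char)[m hm]] := hgamma.
have hi : chi i%:R = zeta ^+ i by rewrite /chi val_Zp_nat // modn_small.
have hX g n : gamma (g *+ n) = gamma g ^+ n := gammaMn g n.
case: m hm => n hm; first by exists (i%:R *+ n); rewrite hX -hi hm.
by exists (- (i%:R *+ n.+1)); rewrite gammaN hX -hi hm.
Qed.

Lemma StarP (z : C) : @Star R k z <-> exists (s : R) g, 0 <= s <= 1 /\ z = s%:C * gamma g.
Proof.
split=> [[s [m [s01 mk ->]]]|[s [g [s01 ->]]]].
  have [g hg] : exists g, gamma g = zeta ^+ m.
    by apply: gamma_root; rewrite exprAC (prim_expr_order zeta_prim) expr1n.
  by exists s, g; rewrite hg zetaX.
have [m hm] := prim_rootP zeta_prim (gammaX g).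
exists s, m; split=> //.
by rewrite hm zetaX.
Qed.

Lemma Star_cabs (z : C) : @Star R k z -> cabs z <= 1.
Proof.
move=> /StarP[s [g [/andP[s0 s1] ->]]].
by rewrite ComplexField.Normc.normcM cabs_gamma mulr1 cabs_real ger0_norm.
Qed.

Lemma Star0 : @Star R k 0.
Proof. by apply/StarP; exists 0, 0; rewrite lexx ler01 mul0r. Qed.

Lemma Star_scale (r : R) (z : C) : @Star R k z -> 0 <= r -> cabs (r%:C * z) <= 1 ->
  @Star R k (r%:C * z).
Proof.
move=> /StarP[s [g [/andP[s0 s1] ->]]] r0 h; apply/StarP; exists (r * s), g.
rewrite rmorphM mulrA mulr_ge0 //; split=> //.
move: h; rewrite mulrA -rmorphM ComplexField.Normc.normcM cabs_gamma mulr1 cabs_real.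
by rewrite ger0_norm // mulr_ge0.
Qed.

End RootsOfUnity.

Section FamilyCalculus.
Context {R : realType} (k : nat) (hk : (2 <= k)%N).
Context (gamma : 'Z_k -> Cplx R) (hgamma : dual_generator gamma).
Local Notation C := (Cplx R).
Local Notation id1 := (fun _ : 'I_1 => @id C).
Local Notation St := (@Star R k).

Lemma spectrum_approximable (A : cstarAlgType R) (S : set A) (hS : comm_star S)
    (a : bicommCStar hS) :
  spectrum (bval a) `<=` St -> approximable St id1 (fun=> a).
Proof.
move=> ha; apply: (@approximable_spectrum _ _ _ _ 0).
- exact: (Star0 hk hgamma).
- exact: (Star_cabs hk hgamma).
move=> z nz; have [b [h1 h2]] : invertible (bval a - z *: 1%A).
  by apply: contrapT => h; apply/nz/ha.
have hb : bicommutant S b.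
  move=> y hy.
  have hay : ((bval a - z *: 1%A) ** y = y ** (bval a - z *: 1%A))%A.
    by rewrite amulBl amulBr (bvalT a hy) -ascaleAl -ascaleAr amul1l amul1r.
  by rewrite -[LHS]amul1r -h1 amulA -(amulA b y) -hay amulA h2 amul1l.
exists (bmk hS hb); apply: bval_inj; rewrite bvalM bval1 -h1.
by congr (_ ** _)%A.
Qed.

Lemma dev1E (B : comCStar R) (X : Type) (x : X) (phi : X -> C) (b : B) :
  dev (fun _ : 'I_1 => phi) (fun=> b) x
    = cadj B (csc B (phi x) - b) * (csc B (phi x) - b).
Proof. by rewrite /dev big_ord1. Qed.

Lemma approximable_prod (B : comCStar R) (I : finType) (K : set C) z0 (a : I -> B) :
  K z0 -> (forall i, approximable K id1 (fun=> a i)) ->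
  approximable [set x : I -> C | forall i, K (x i)] (fun i x => x i) a.
Proof.
move=> Kz0 hap.
pose KK := [set x : I -> C | forall i, K (x i)].
pose upd (x : I -> C) i z := fun j => if j == i then z else x j.
pose dv i (x : I -> C) := cadj B (csc B (x i) - a i) * (csc B (x i) - a i).
have H (r : seq I) d : 0 < d -> exists2 E, state KK E &
    forall i, i \in r -> cnr (E (dv i)) <= d.
  move=> d0; elim: r => [|i r [E sE hE]].
    by exists (fun f => f (fun=> z0)) => //; apply: state_dirac => i.
  have [F sF hF] := hap i d d0.
  exists (fun f => E (fun x => F (fun z => f (upd x i z)))).
    apply: (state_push (p := fun q => upd q.1 i q.2) (state_prod sE sF)).
    by move=> [x z] [/= hx hz] j; rewrite /upd; case: ifP.
  move=> j; rewrite inE; have [->|ji] := eqVneq j i => /= [_|jr].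
    have -> : (fun x => F (fun z => dv i (upd x i z))) = (fun=> F (dev id1 (fun=> a i))).
      apply/funext => x; congr F; apply/funext => z.
      by rewrite dev1E /dv /upd eqxx.
    by rewrite (state_const sE).
  have -> : (fun x => F (fun z => dv j (upd x i z))) = dv j.
    apply/funext => x; rewrite -[RHS](state_const sF); congr F; apply/funext => z.
    by rewrite /dv /upd (negPf ji).
  exact: hE.
move=> d d0; have [e e0 he] := small_mul (ler0n R #|I|) d0.
have [E sE hE] := H (enum I) e e0; exists E => //.
rewrite (_ : dev _ _ = (fun x => \sum_(i <- enum I) dv i x)); last first.
  by apply/funext => x; rewrite /dev big_enum.
rewrite (state_sum sE) (le_trans _ he) //.
rewrite (le_trans (y := \sum_(i <- enum I) e)) //.
  elim: (enum I) hE => [|i r ih] hE; first by rewrite !big_nil cnr0.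
  rewrite !big_cons (le_trans (cnrD _ _)) // lerD ?hE ?mem_head // ih //.
  by move=> j jr; rewrite hE // inE jr orbT.
by rewrite big_enum sumr_const mulr_natl.
Qed.

(* The point [x] of the product of stars is moved to [x / |x|]. *)
Lemma approximable_sphere (B : comCStar R) n (a : 'I_n.+1 -> B) (Y : Type)
    (psi : 'I_n.+1 -> Y -> C) :
  (forall i, approximable St id1 (fun=> a i)) ->
  \sum_i cadj B (a i) * a i = 1 ->
  (forall x : 'I_n.+1 -> C, (forall i, St (x i)) -> \sum_i sqmod (x i) = 1 ->
     exists y, forall i, psi i y = x i) ->
  approximable setT psi a.
Proof.
move=> hap ha hY.
pose K := [set x : 'I_n.+1 -> C | forall i, St (x i)].
pose phi i (x : 'I_n.+1 -> C) := x i.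
have happ : approximable K phi a := approximable_prod (Star0 hk hgamma) hap.
pose N (x : 'I_n.+1 -> C) := \sum_i sqmod (x i).
have N0 x : 0 <= N x by apply: sumr_ge0 => i _; exact: sqmod_ge0.
have hp x : exists y, K x -> \sum_i sqmod (psi i y - x i) = (1 - Num.sqrt (N x)) ^+ 2.
  have [Kx|nK] := pselect (K x); last first.
    have [i||y _] := hY (fun i => if i == ord0 then 1 else 0); last by exists y.
    - case: ifP => _; last exact: (Star0 hk hgamma).
      by apply/(StarP hk hgamma); exists 1, 0; rewrite ler01 lexx mul1r (gamma0 hgamma).
    - rewrite (bigD1 ord0) //= big1 => [|i /negPf->]; last exact: sqmod0.
      by rewrite /sqmod /= expr1n expr0n !addr0.
  have [Nx|Nx] := eqVneq (N x) 0.
    have x0 i : x i = 0.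
      apply: sqmod_eq0; apply/eqP; move/eqP: Nx; rewrite psumr_eq0 => [|j _]; last exact: sqmod_ge0.
      by move=> /allP/(_ i); rewrite mem_index_enum => /(_ isT).
    have [i||y hy] := hY (fun i => if i == ord0 then 1 else 0).
    - case: ifP => _; last exact: (Star0 hk hgamma).
      by apply/(StarP hk hgamma); exists 1, 0; rewrite ler01 lexx mul1r (gamma0 hgamma).
    - rewrite (bigD1 ord0) //= big1 => [|i /negPf->]; last exact: sqmod0.
      by rewrite /sqmod /= expr1n expr0n !addr0.
    exists y => _; rewrite Nx sqrtr0 subr0 expr1n (bigD1 ord0) //= big1.
      by rewrite hy x0 subr0 /sqmod /= expr1n expr0n !addr0.
    by move=> i /negPf i0; rewrite hy x0 i0 subr0 sqmod0.
  have Np : 0 < N x by rewrite lt_neqAle eq_sym Nx N0.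
  have sp : 0 < Num.sqrt (N x) by rewrite sqrtr_gt0.
  have ss : Num.sqrt (N x) ^+ 2 = N x by rewrite sqr_sqrtr.
  set q := Num.sqrt (N x) in sp ss *.
  have sqr_real (r : R) : sqmod (r%:C : C) = r ^+ 2.
    by rewrite /sqmod /= expr0n addr0.
  have [||y hy] := hY (fun i => (q^-1)%:C * x i).
  - move=> i; apply: (Star_scale hk hgamma); [exact: Kx|by rewrite invr_ge0 ltW|].
    rewrite -(ler_pXn2r (n := 2)) ?nnegrE ?cabs_ge0 // expr1n sqr_cabs sqmodM sqr_real.
    rewrite exprVn ss mulrC ler_pdivrMr // mul1r /N (bigD1 i) //= lerDl.
    by apply: sumr_ge0 => j _; exact: sqmod_ge0.
  - under eq_bigr do rewrite sqmodM sqr_real.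
    by rewrite -mulr_sumr -/(N x) exprVn ss mulVf ?gt_eqF.
  exists y => _.
  under eq_bigr => i _.
    rewrite hy -{2}[x i]mul1r -mulrBl -(rmorph1 (real_complex R)) -rmorphB sqmodM sqr_real.
    over.
  by rewrite -mulr_sumr -/(N x) -ss -exprMn mulrBl mulVf ?gt_eqF // mul1r.
have /choice[p {}hp] := hp.
apply: (approximable_push happ) => e e0.
pose g x := (1 - N x) ^+ 2.
exists p, g; split=> // [x Kx|].
  rewrite hp // (le_trans (y := g x)) ?lerDr ?(ltW e0) // /g.
  have s0 := sqrtr_ge0 (N x); have ss : Num.sqrt (N x) ^+ 2 = N x by rewrite sqr_sqrtr.
  set q := Num.sqrt (N x) in s0 ss *; rewrite -ss.
  have -> : 1 - q ^+ 2 = (1 - q) * (1 + q) by ring.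
  rewrite [leRHS]exprMn ler_peMr ?sqr_ge0 // exprn_ege1 // lerDl //.
have ui i : unif K phi (phi i).
  apply: unif_coord; exists 1 => x Kx; exact: (Star_cabs hk hgamma (Kx i)).
have ri i := is_rep_coord K phi a i.
pose h (r : seq 'I_n.+1) (x : 'I_n.+1 -> C) : C := \sum_(i <- r) Num.conj (x i) * x i.
have hr r : unif K phi (h r) /\ is_rep K phi a (h r) (\sum_(i <- r) cadj B (a i) * a i).
  elim: r => [|i r [ih1 ih2]].
    have -> : h [::] = (fun=> 0) by apply/funext => x; rewrite /h big_nil.
    by rewrite big_nil -(rmorph0 (csc B)); split; [exact: unif_cst|exact: is_rep_cst].
  have -> : h (i :: r) = (fun x => Num.conj (phi i x) * phi i x + h r x).
    by apply/funext => x; rewrite /h big_cons.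
  rewrite big_cons; split; first exact: unifD (unifM (unif_conj (ui i)) (ui i)) ih1.
  exact: is_repD (is_repM happ (unif_conj (ui i)) (ui i) (is_rep_conj (ri i)) (ri i)) ih2.
have [uh rh] := hr (index_enum 'I_n.+1); rewrite ha in rh.
have u1 := unifD (unif_cst K phi 1) (unifM (unif_cst K phi (-1)) uh).
have r1 := is_repD (is_rep_cst K phi a 1) (is_repZ (-1) rh).
have := is_repM happ u1 u1 r1 r1.
have -> : csc B 1 + csc B (-1) * 1 = 0 by rewrite rmorphN !rmorph1 mulr1 subrr.
rewrite mul0r; apply: is_rep_eq => x _.
have -> : h (index_enum 'I_n.+1) x = (N x)%:C.
  by rewrite /N rmorph_sum; apply: eq_bigr => i _; rewrite /= sqmodE.
by rewrite /g rmorphXn rmorphB rmorph1 expr2 mulN1r.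
Qed.

End FamilyCalculus.

(** * Compactness estimates *)

Section CompactBounds.
Context {R : realType}.
Local Notation C := (Cplx R).

Lemma compact_dominated (X : topologicalType) (K : set X) (D d : X -> R) e :
  compact K -> continuous D -> continuous d -> (forall x, 0 <= d x) ->
  (forall x, K x -> d x = 0 -> D x <= 0) -> 0 < e ->
  exists2 c, 0 <= c & forall x, K x -> D x <= e + c * d x.
Proof.
move=> /compact_near_coveringP cK cD cd d0 dD e0.
have /(_ _)[|N _ hN] := cK nat \oo (fun N x => D x <= e + N%:R * d x) _; last first.
  by exists N%:R => // x Kx; exact: (hN N (leqnn N)).
move=> x Kx; have [dx0|dxn] := eqVneq (d x) 0.
  have Dx : D x < e by rewrite (le_lt_trans (dD x Kx dx0)).
  exists ([set y | D y < e], setT) => /=.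
    by split; [exact: (cvgr_lt _ (cD x) _ Dx) | exact: filterT].
  move=> [y n] /= [/ltW hy _]; rewrite (le_trans hy) // lerDl mulr_ge0 //.
have dx : 0 < d x / 2 by rewrite divr_gt0 // lt_neqAle eq_sym dxn d0.
pose m := (Num.truncn ((`|D x| + 1) / (d x / 2))).+1.
exists ([set y | D y < D x + 1] `&` [set y | d x / 2 < d y], [set n | (m <= n)%N]) => /=.
  split; last by exists m.
  apply: filterI.
    by apply: (cvgr_lt _ (cD x)); rewrite ltrDl.
  apply: (cvgr_gt _ (cd x)).
  by rewrite ltr_pdivrMr // ltr_pMr ?ltr1n // lt_neqAle eq_sym dxn d0.
move=> [y n] /= [[hD hd] mn].
have h1 : (`|D x| + 1) / (d x / 2) < n%:R.
  by rewrite (lt_le_trans (truncnS_gt _)) // ler_nat.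
rewrite ltr_pdivrMr // in h1.
have h2 : n%:R * (d x / 2) <= n%:R * d y by rewrite ler_wpM2l // ltW.
have := ler_norm (D x); lra.
Qed.

Lemma cabs_lip (z w : C) : `|cabs z - cabs w| <= cabs (z - w).
Proof.
have H (u v : C) : cabs u - cabs v <= cabs (u - v).
  by rewrite lerBlDr -{1}(subrK v u) le_normcD.
rewrite ler_norml H andbT lerNl opprB.
by rewrite (le_trans (H w z)) // -normcN opprB.
Qed.

Lemma continuous_cplxP (X : topologicalType) (f : X -> C) x :
  {for x, continuous f} <->
  forall e : R, 0 < e -> \forall y \near x, cabs (f x - f y) <= e.
Proof.
split=> [/cvgrPdist_le h e e0|h].
  have := h e%:C; rewrite ltcR => /(_ e0); apply: filterS => y.
  by rewrite normCE lecR.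
apply/cvgrPdist_le => _ /gt0_cplx[e e0 ->]; have := h e e0.
by apply: filterS => y hy; rewrite normCE lecR.
Qed.

Lemma continuous_cabs (X : topologicalType) (f : X -> C) :
  continuous f -> continuous (fun x => cabs (f x)).
Proof.
move=> cf x; apply/cvgrPdist_le => e e0.
have /continuous_cplxP/(_ e e0) := cf x; apply: filterS => y.
exact/le_trans/cabs_lip.
Qed.

Lemma continuous_sqmod (X : topologicalType) (f : X -> C) :
  continuous f -> continuous (fun x => sqmod (f x)).
Proof.
move=> cf; under eq_fun do rewrite -sqr_cabs expr2.
by move=> x; apply: cvgM; exact: (continuous_cabs cf).
Qed.

Lemma continuous_rc (X : topologicalType) (f : X -> R) :
  continuous f -> continuous (fun x => (f x)%:C : C).
Proof.
move=> cf x; apply/continuous_cplxP => e e0.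
have /cvgrPdist_le/(_ e e0) := cf x; apply: filterS => y.
by rewrite -rmorphB cabs_real.
Qed.

Lemma continuous_conj (X : topologicalType) (f : X -> C) :
  continuous f -> continuous (fun x => Num.conj (f x)).
Proof.
move=> cf x; apply/continuous_cplxP => e e0.
have /continuous_cplxP/(_ e e0) := cf x; apply: filterS => y.
by rewrite -rmorphB; case: (f x - f y) => p q /=; rewrite sqrrN.
Qed.

Lemma continuous_fst (X Y Z : topologicalType) (f : X -> Z) :
  continuous f -> continuous (fun p : X * Y => f p.1).
Proof. by move=> cf p; apply: continuous_comp; [exact: cvg_fst | exact: cf]. Qed.

Lemma continuous_snd (X Y Z : topologicalType) (f : Y -> Z) :
  continuous f -> continuous (fun p : X * Y => f p.2).
Proof. by move=> cf p; apply: continuous_comp; [exact: cvg_snd | exact: cf]. Qed.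

Lemma continuous_discrete (T : choiceType) (Y : topologicalType)
  (f : discrete_topology T -> Y) : continuous f.
Proof.
move=> x U /nbhs_singleton Ux; change (nbhs x (f @^-1` U)).
by rewrite nbhs_principalE; apply/principal_filterP.
Qed.

Lemma compact_discrete (T : finType) : compact [set: discrete_topology T].
Proof. apply: finite_compact; exact: (@finite_finset T). Qed.

Lemma continuous_bigsum (X : topologicalType) (J : Type) (r : seq J) (F : J -> X -> R) :
  (forall j, continuous (F j)) -> continuous (fun x => \sum_(j <- r) F j x).
Proof.
move=> cF; elim: r => [|j r ih] x.
  under eq_fun do rewrite big_nil.
  exact: cvg_cst.
under eq_fun do rewrite big_cons.
by apply: cvgD; [exact: cF | exact: ih].
Qed.

Lemma unif_compact (X : topologicalType) (I : finType) (K : set X)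
    (phi : I -> X -> C) (f : X -> C) e :
  compact K -> continuous f -> (forall i, continuous (phi i)) ->
  (forall x y, K x -> K y -> (forall i, phi i x = phi i y) -> f x = f y) ->
  0 < e -> exists2 c, 0 <= c &
    forall x y, K x -> K y -> cabs (f x - f y) <= e + c * dist2 phi x y.
Proof.
move=> cK cf cphi sep e0.
have cB (g : X -> C) : continuous g -> continuous (fun p : X * X => g p.1 - g p.2).
  move=> cg p; apply: cvgB; [exact: (continuous_fst cg) | exact: (continuous_snd cg)].
have [|||||c c0 hc] := @compact_dominated (X * X)%type (K `*` K)
   (fun p => cabs (f p.1 - f p.2)) (fun p => dist2 phi p.1 p.2) e (compact_setX cK cK).
- exact: (continuous_cabs (cB f cf)).
- apply: (@continuous_bigsum _ _ (index_enum I)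
    (fun i (p : X * X) => sqmod (phi i p.1 - phi i p.2))) => i.
  exact: (continuous_sqmod (cB (phi i) (cphi i))).
- by move=> p; exact: dist2_ge0.
- move=> [x y] [/= Kx Ky] /eqP; rewrite psumr_eq0 => [/allP h|i _]; last exact: sqmod_ge0.
  rewrite (sep x y) ?subrr ?ComplexField.Normc.normc0 // => i.
  by apply/subr0_eq/sqmod_eq0/eqP; exact: (h i (mem_index_enum i)).
- by [].
by exists c => // x y Kx Ky; exact: (hc (x, y)).
Qed.

Lemma dist2_le (X : Type) (I : finType) (K : set X) (phi : I -> X -> C) x y :
  (forall i x, K x -> cabs (phi i x) <= 1) -> K x -> K y ->
  dist2 phi x y <= 4 * #|I|%:R.
Proof.
move=> h Kx Ky; rewrite (le_trans (ler_sum _ (_ : forall i, true -> _ <= 4))) //.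
  move=> i _; rewrite (le_trans (sqmodD_le _ _)) // sqmodN -!sqr_cabs.
  have := exprn_ile1 2 (cabs_ge0 (phi i x)) (h i x Kx).
  have := exprn_ile1 2 (cabs_ge0 (phi i y)) (h i y Ky); lra.
by rewrite sumr_const mulr_natr.
Qed.

Lemma unif_bounded (X : Type) (I : finType) (K : set X) (phi : I -> X -> C) f :
  (forall i x, K x -> cabs (phi i x) <= 1) ->
  (forall e, 0 < e -> exists2 c, 0 <= c &
    forall x y, K x -> K y -> cabs (f x - f y) <= e + c * dist2 phi x y) ->
  unif K phi f.
Proof.
move=> phi1 uf; split=> //; have [[x0 Kx0]|nK] := pselect (exists x, K x); last first.
  by exists 0 => x Kx; case: nK; exists x.
have [c c0 hc] := uf 1 ltr01; exists (1 + c * (4 * #|I|%:R) + cabs (f x0)) => x Kx.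
rewrite -[f x](subrK (f x0)) (le_trans (le_normcD _ _)) // lerD2r.
by rewrite (le_trans (hc x x0 Kx Kx0)) // lerD2l ler_wpM2l // (dist2_le phi1).
Qed.

End CompactBounds.

(** * The cone over the group *)

Section ConeTopology.
Context {R : realType} (k : nat) (hk : (2 <= k)%N).
Context (gamma : 'Z_k -> Cplx R) (hgamma : dual_generator gamma).
Local Notation C := (Cplx R).
Local Notation St := (@Star R k).
Local Notation I01 := (set_type (`]0%R, 1%R] : set R)).
Local Notation cone := (cone_gspace R 'Z_k).

Lemma I01P (s : I01) : 0 < val s <= 1.
Proof. by have := valP s; rewrite inE /= in_itv. Qed.

Lemma I01_mk (s : R) : 0 < s <= 1 -> exists t : I01, val t = s.
Proof.
by move=> hs; have hm : s \in (`]0, 1]%classic : set R) by [rewrite inE /= in_itv];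
  exists (SigSub hm).
Qed.

Definition cone_coord (p : cone) : C := (Num.sqrt (val p.1))%:C * gamma p.2.

Lemma continuous_sigval : continuous (fun s : I01 => val s : R).
Proof. exact: initial_continuous. Qed.

Lemma continuous_cone_val : continuous (fun p : cone => val p.1 : R).
Proof. exact: (continuous_fst continuous_sigval). Qed.

Lemma continuous_cone_coord : continuous cone_coord.
Proof.
have h1 : continuous (fun p : cone => (Num.sqrt (val p.1))%:C : C).
  apply: continuous_rc => p; apply: continuous_comp; first exact: continuous_cone_val.
  exact: sqrt_continuous.
have h2 : continuous (fun p : cone => gamma p.2).
  apply: (@continuous_snd I01 (discrete_topology 'Z_k) C gamma).
  exact: continuous_discrete.
move=> p; apply: cvgM; [exact: h1 | exact: h2].
Qed.

Lemma sqmod_cone_coord p : sqmod (cone_coord p) = val p.1.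
Proof.
have /andP[/ltW h _] := I01P p.1.
rewrite /cone_coord sqmodM -(sqr_cabs (gamma _)) (cabs_gamma hgamma) expr1n mulr1.
by rewrite /sqmod /= expr0n addr0 sqr_sqrtr.
Qed.

Lemma Star_cone_coord p : St (cone_coord p).
Proof.
apply/(StarP hk hgamma); exists (Num.sqrt (val p.1)), p.2; split=> //.
have /andP[h0 h1] := I01P p.1.
by rewrite sqrtr_ge0 /= (le_trans (ler_wsqrtr h1)) // sqrtr1.
Qed.

Lemma Star_cone_dense z e : St z -> 0 < e -> exists p, sqmod (cone_coord p - z) <= e.
Proof.
move=> /(StarP hk hgamma)[s [g [/andP[s0 s1] ->]]] e0.
have [->|sn] := eqVneq s 0.
  have [|t ht] := @I01_mk (Num.min e 1); first by rewrite lt_min e0 ltr01 ge_min lexx orbT.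
  exists (t, g); rewrite mul0r subr0 sqmod_cone_coord /= ht ge_min lexx //.
have sp : 0 < s by rewrite lt_neqAle eq_sym sn.
have [|t ht] := @I01_mk (s ^+ 2); first by rewrite exprn_gt0 ?exprn_ile1.
exists (t, g); rewrite /cone_coord /= ht sqrtr_sqr ger0_norm // subrr sqmod0 ltW //.
Qed.

Lemma cone_coord_act g p : cone_coord (gact g p) = gamma g * cone_coord p.
Proof. by rewrite /cone_coord /= (gammaD hgamma); ring. Qed.

Lemma cone_coord_inj p q : cone_coord p = cone_coord q -> p = q.
Proof.
move=> h; have h1 : val p.1 = val q.1 by rewrite -!sqmod_cone_coord h.
have h2 : p.2 = q.2.
  apply: (gamma_inj hk hgamma); move: h; rewrite /cone_coord h1; apply: mulfI.
  rewrite fmorph_eq0 sqrtr_eq0 -ltNge; by have /andP[] := I01P q.1.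
by case: p q h1 h2 {h} => [s g] [t h] /= /val_inj -> ->.
Qed.

Lemma compact_cone (d : R) : 0 < d -> exists2 K : set cone, compact K &
  forall p, d <= val p.1 -> K p.
Proof.
move=> d0; have [one hone] := @I01_mk 1 (introT andP (conj ltr01 (lexx 1))).
pose cl (s : R) := Num.max (Num.min d 1) (Num.min s 1).
have clP s : 0 < cl s <= 1.
  rewrite /cl lt_max lt_min d0 ltr01 /= ge_max !ge_min lexx !orbT //.
pose mk s : I01 := insubd one (cl s).
have mkE s : val (mk s) = cl s.
  have h : cl s \in (`]0, 1]%classic : set R) by rewrite inE /= in_itv /= clP.
  by rewrite val_insubd h.
have cmk : continuous mk.
  apply: continuous_comp_initial => s.
  have -> : set_val \o mk = cl by apply/funext => t /=; rewrite set_valE mkE.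
  apply: (@continuous_max R R (fun=> Num.min d 1) (fun s => Num.min s 1)).
    exact: cvg_cst.
  by apply: (@continuous_min R R id (fun=> 1)); [exact: cvg_id | exact: cvg_cst].
exists ((mk @` `[0, 1]) `*` [set: discrete_topology 'Z_k]).
  apply: compact_setX; last exact: compact_discrete.
  apply: continuous_compact; last exact: segment_compact.
  exact: continuous_subspaceT.
move=> [s g] /= ds; split=> //; have /andP[s0 s1] := I01P s.
exists (val s); first by rewrite /= in_itv /= (ltW s0).
apply: val_inj; rewrite mkE /cl (min_l s1) max_r // ge_min ds //.
Qed.

Lemma compact_Czero (f : cone -> C) : continuous f ->
  (forall e : R, 0 < e -> exists2 d, 0 < d & forall p, e <= cabs (f p) -> d <= val p.1) ->
  Czero f.
Proof.
move=> cf hf; split=> // e e0; have [d d0 hd] := hf e e0.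
have [K cK hK] := compact_cone d0.
apply: (subclosed_compact _ cK) => [|p /=]; last by rewrite normCE lecR => /hd/hK.
have -> : [set x | e%:C <= `|f x|] = (fun p => cabs (f p)) @^-1` [set t | e <= t].
  by apply/seteqP; split=> p /=; rewrite normCE lecR.
apply: closed_comp; last exact: closed_ge.
by move=> p _; exact: (continuous_cabs cf).
Qed.

Lemma Czero_unif (f : cone -> C) : Czero f ->
  unif setT (fun _ : 'I_1 => cone_coord) f.
Proof.
move=> [cf hf]; apply: unif_bounded => [i p _|e e0].
  exact: (Star_cabs hk hgamma (Star_cone_coord p)).
have c1 (a : R) : continuous (fun _ : cone => a) by move=> p; exact: cvg_cst.
have e2 : 0 < e / 2 by rewrite divr_gt0.
pose Kf := [set p | (e / 2)%:C <= `|f p|]; have cKf : compact Kf := hf _ e2.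
have nKf p : ~ Kf p -> cabs (f p) < e / 2.
  by rewrite /Kf /= normCE lecR => /negP; rewrite -ltNge.
have v0 (p : cone) : 0 < val p.1 by have /andP[] := I01P p.1.
have h2 : (0 : R) < 2^-1 by rewrite invr_gt0.
have [c c0 hc] := compact_dominated cKf (c1 1) continuous_cone_val (fun p => ltW (v0 p))
  (fun p _ h => ltac:(by have := v0 p; rewrite h ltxx)) h2.
pose d := (2 * (c + 1))^-1; have c10 : 0 < c + 1 by rewrite ltr_wpDl.
have d0 : 0 < d by rewrite invr_gt0 mulr_gt0.
have hd p : Kf p -> d <= val p.1.
  move=> /hc h; have := v0 p => vp; rewrite /d -[leLHS]mulr1 mulrC.
  by rewrite ler_pdivrMr ?mulr_gt0 //; lra.
have [b b0 hb] := compact_dominated cKf (continuous_cabs cf) (c1 1) (fun _ => ler01)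
  (fun p _ h => ltac:(by move/eqP: h; rewrite oner_eq0)) ltr01.
pose F := 1 + b + e / 2; have F0 : 0 <= F by rewrite !addr_ge0 // ltW.
have hF p : cabs (f p) <= F.
  have [/hb|/nKf] := pselect (Kf p); rewrite /F ?mulr1; lra.
have d4 : 0 < d / 4 by rewrite divr_gt0.
have [K cK hK] := compact_cone d4.
have [c' c'0 hc'] := @unif_compact _ _ _ K (fun _ : 'I_1 => cone_coord) f e cK cf
  (fun _ => continuous_cone_coord)
  (fun p q _ _ h => congr1 f (cone_coord_inj (h ord0))) e0.
pose m := (3 * d / 8) ^+ 2.
have m0 : 0 < m by rewrite exprn_gt0 // divr_gt0 // mulr_gt0.
pose c'' := 2 * F / m; have c''0 : 0 <= c'' by rewrite divr_ge0 ?mulr_ge0 // ltW.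
have far p q : d <= val p.1 -> val q.1 < d / 4 ->
    cabs (f p - f q) <= c'' * sqmod (cone_coord p - cone_coord q).
  move=> dp dq; rewrite (le_trans (y := 2 * F)) //.
    rewrite (le_trans (le_normcD _ _)) // normcN.
    by have := hF p; have := hF q; lra.
  rewrite /c'' mulrAC ler_pdivlMr // ler_wpM2l ?mulr_ge0 //.
  have hp := sqmod_cone_coord p; have hq := sqmod_cone_coord q.
  have p1 := Star_cabs hk hgamma (Star_cone_coord p).
  have q1 := Star_cabs hk hgamma (Star_cone_coord q).
  have q0 := cabs_ge0 (cone_coord q).
  have p0 := cabs_ge0 (cone_coord p).
  rewrite -sqr_cabs in hp; rewrite -sqr_cabs in hq.
  have := cabs_lip (cone_coord p) (cone_coord q); rewrite ler_norml => /andP[_ hl].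
  have d38 : 0 <= 3 * d / 8 by lra.
  rewrite -sqr_cabs /m ler_pXn2r ?nnegrE ?cabs_ge0 //.
  rewrite (le_trans _ hl) //.
  rewrite -hp in dp; rewrite -hq in dq.
  move: (cabs (cone_coord p)) (cabs (cone_coord q)) p1 q1 p0 q0 dp dq => u v.
  move=> *; nra.
have dE x y : dist2 (fun _ : 'I_1 => cone_coord) x y = sqmod (cone_coord x - cone_coord y).
  by rewrite /dist2 big_ord1.
exists (c' + c'') => [|p q _ _]; first by rewrite addr_ge0.
have D0 := sqmod_ge0 (cone_coord p - cone_coord q).
have c'D := mulr_ge0 c'0 D0; have c''D := mulr_ge0 c''0 D0.
rewrite mulrDl.
have close : ~ Kf p -> ~ Kf q -> cabs (f p - f q) <= e.
  move=> /nKf hp /nKf hq; rewrite (le_trans (le_normcD _ _)) // normcN; lra.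
have nK r : ~ K r -> val r.1 < d / 4 by move=> nKr; rewrite ltNge; apply/negP => /hK.
have KfK r : Kf r -> K r.
  by move=> /hd h; apply: hK; rewrite (le_trans _ h) // ler_pdivrMr // ler_peMr ?(ltW d0) // ler1n.
have [Kp|nKp] := pselect (K p); have [Kq|nKq] := pselect (K q).
- by have := hc' p q Kp Kq; rewrite !dE; lra.
- have [/hd hp|nf] := pselect (Kf p).
    by have := far p q hp (nK q nKq); rewrite dE; lra.
  have := close nf (fun h => nKq (KfK q h)); rewrite dE; lra.
- have [/hd hq|nf] := pselect (Kf q).
    have := far q p hq (nK p nKp).
    by rewrite -normcN opprB -sqmodN opprB dE; lra.
  have := close (fun h => nKp (KfK p h)) nf; rewrite dE; lra.
- have := close (fun h => nKp (KfK p h)) (fun h => nKq (KfK q h)); rewrite dE; lra.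
Qed.

End ConeTopology.

(** * Iterated joins *)

Section JoinTopology.
Context {R : realType} (k : nat) (hk : (2 <= k)%N).
Context (gamma : 'Z_k -> Cplx R) (hgamma : dual_generator gamma).
Local Notation C := (Cplx R).
Local Notation St := (@Star R k).
Local Notation I := (set_type (`[0%R, 1%R] : set R)).
Local Notation G := (group_gspace 'Z_k).
Local Notation E := (EG R 'Z_k).

Lemma IP (s : I) : 0 <= val s <= 1.
Proof. by have := valP s; rewrite inE /= in_itv. Qed.

Lemma I_mk (s : R) : 0 <= s <= 1 -> exists t : I, val t = s.
Proof.
by move=> hs; have hm : s \in (`[0, 1]%classic : set R) by [rewrite inE /= in_itv];
  exists (SigSub hm).
Qed.

Lemma compact_I : compact [set: I].
Proof.
have [z0 hz0] := @I_mk 0 (introT andP (conj (lexx 0) ler01)).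
pose cl (s : R) := Num.max 0 (Num.min s 1).
have clP s : 0 <= cl s <= 1 by rewrite le_max lexx ge_max ler01 ge_min lexx orbT.
pose mk s : I := insubd z0 (cl s).
have mkE s : val (mk s) = cl s.
  have h : cl s \in (`[0, 1]%classic : set R) by rewrite inE /= in_itv /= clP.
  by rewrite val_insubd h.
have cmk : continuous mk.
  apply: continuous_comp_initial => s.
  have -> : set_val \o mk = cl by apply/funext => t /=; rewrite set_valE mkE.
  apply: (@continuous_max R R (fun=> 0) (fun s => Num.min s 1)); first exact: cvg_cst.
  by apply: (@continuous_min R R id (fun=> 1)); [exact: cvg_id | exact: cvg_cst].
have -> : [set: I] = mk @` `[0, 1].
  apply/seteqP; split=> // s _; have /andP[s0 s1] := IP s.
  exists (val s); first by rewrite /= in_itv /= s0.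
  by apply: val_inj; rewrite mkE /cl (min_l s1) max_r.
apply: continuous_compact; last exact: segment_compact.
exact: continuous_subspaceT.
Qed.

Section JoinCoordinates.
Context (X : gspace 'Z_k).
Local Notation T := (X * I * G)%type.
Local Notation J := (join R X G).

Definition join_left (u : X -> C) (q : T) : C :=
  (Num.sqrt (1 - val q.1.2))%:C * u q.1.1.

Definition join_right (q : T) : C := (Num.sqrt (val q.1.2))%:C * gamma q.2.

Lemma join_eqP (p q : T) : \pi_J p == \pi_J q :> J ->
  [/\ p.1.2 = q.1.2, val p.1.2 < 1 -> p.1.1 = q.1.1 & 0 < val p.1.2 -> p.2 = q.2].
Proof. by move=> /eqP/eqmodP/asboolP. Qed.

Lemma join_eq (p q : T) : p.1.2 = q.1.2 -> (val p.1.2 < 1 -> p.1.1 = q.1.1) ->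
  (0 < val p.1.2 -> p.2 = q.2) -> \pi_J p = \pi_J q.
Proof. by move=> h1 h2 h3; apply/eqmodP/asboolP. Qed.

Lemma join_left_homo u : {homo join_left u : p q / \pi_J p == \pi_J q :> J >-> p == q}.
Proof.
move=> p q /join_eqP[e h1 _]; apply/eqP; rewrite /join_left -e.
have /andP[_] := IP p.1.2; rewrite le_eqVlt => /predU1P[->|/h1 -> //].
by rewrite subrr sqrtr0 !mul0r.
Qed.

Lemma join_right_homo : {homo join_right : p q / \pi_J p == \pi_J q :> J >-> p == q}.
Proof.
move=> p q /join_eqP[e _ h2]; apply/eqP; rewrite /join_right -e.
have /andP[] := IP p.1.2; rewrite le_eqVlt => /predU1P[<-|/h2 -> //] _.
by rewrite sqrtr0 !mul0r.
Qed.

Lemma join_leftE u q : join_left u (repr (\pi_J q)) = join_left u q.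
Proof. by apply/eqP/join_left_homo; rewrite reprK. Qed.

Lemma join_rightE q : join_right (repr (\pi_J q)) = join_right q.
Proof. by apply/eqP/join_right_homo; rewrite reprK. Qed.

Lemma continuous_I : continuous (fun q : T => val q.1.2 : R).
Proof.
apply: (@continuous_fst _ _ _ (fun p : X * I => val p.2 : R)).
apply: (@continuous_snd _ _ _ (fun s : I => val s : R)).
exact: initial_continuous.
Qed.

Lemma continuous_join_left u : continuous u -> continuous (join_left u \o repr : J -> C).
Proof.
move=> cu; apply: (@repr_comp_continuous _ J) => [|p q]; last exact: join_left_homo.
have h1 : continuous (fun q : T => (Num.sqrt (1 - val q.1.2))%:C : C).
  apply: continuous_rc => q; apply: continuous_comp; last exact: sqrt_continuous.
  by apply: cvgB; [exact: cvg_cst | exact: continuous_I].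
have h2 : continuous (fun q : T => u q.1.1).
  apply: (@continuous_fst _ _ _ (fun p : X * I => u p.1)).
  exact: (@continuous_fst _ _ _ u).
by move=> q; apply: cvgM; [exact: h1 | exact: h2].
Qed.

Lemma continuous_join_right : continuous (join_right \o repr : J -> C).
Proof.
apply: (@repr_comp_continuous _ J) => [|p q]; last exact: join_right_homo.
have h1 : continuous (fun q : T => (Num.sqrt (val q.1.2))%:C : C).
  apply: continuous_rc => q; apply: continuous_comp; last exact: sqrt_continuous.
  exact: continuous_I.
have h2 : continuous (fun q : T => gamma q.2).
  apply: (@continuous_snd _ _ _ (gamma : G -> C)); exact: continuous_discrete.
by move=> q; apply: cvgM; [exact: h1 | exact: h2].
Qed.

Lemma compact_join : compact [set: X] -> compact [set: J].
Proof.
move=> cX; have -> : [set: J] = \pi_J @` ([set: X] `*` [set: I] `*` [set: G]).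
  by apply/seteqP; split=> // p _; exists (repr p); rewrite ?reprK.
apply: continuous_compact.
  apply: continuous_subspaceT; exact: (@pi_continuous _ J).
by apply: compact_setX; [apply: compact_setX => //; exact: compact_I
  | exact: compact_discrete].
Qed.

End JoinCoordinates.

Fixpoint ecoord n (i : nat) : E n -> C :=
  if n is m.+1 return E n -> C then
    fun p => if i == n then join_right (repr (p : join R (E m) G))
             else join_left (@ecoord m i) (repr (p : join R (E m) G))
  else fun x => gamma x.

Lemma continuous_ecoord n i : continuous (@ecoord n i).
Proof.
elim: n => [|n ih] /=; first exact: continuous_discrete.
by case: (i == n.+1); [exact: continuous_join_right | exact: continuous_join_left].
Qed.

Lemma compact_EG n : compact [set: E n].
Proof. by elim: n => [|n ih]; [exact: compact_discrete | exact: compact_join]. Qed.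

Lemma ecoord_act n i g (x : E n) : ecoord i (gact g x) = gamma g * ecoord i x.
Proof.
elim: n x => [|n ih] x /=; first by rewrite (gammaD hgamma) mulrC.
case: ifP => _.
  by rewrite join_rightE /join_right /= (gammaD hgamma); ring.
by rewrite join_leftE /join_left /= ih; ring.
Qed.

Lemma ecoord_Star n i (x : E n) : St (ecoord i x).
Proof.
elim: n x => [|n ih] x /=.
  by apply/(StarP hk hgamma); exists 1, x; rewrite ler01 lexx mul1r.
set q := repr _; have /andP[s0 s1] := IP q.1.2; case: ifP => _.
  apply/(StarP hk hgamma); exists (Num.sqrt (val q.1.2)), q.2; split=> //.
  by rewrite sqrtr_ge0 /= (le_trans (ler_wsqrtr s1)) // sqrtr1.
apply: (Star_scale hk hgamma); [exact: ih | exact: sqrtr_ge0 |].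
rewrite ComplexField.Normc.normcM cabs_real ger0_norm ?sqrtr_ge0 //.
rewrite mulr_ile1 ?sqrtr_ge0 ?cabs_ge0 ?(Star_cabs hk hgamma (ih _)) //.
by rewrite -[leRHS]sqrtr1 ler_wsqrtr // gerBl.
Qed.

Lemma sqmod_scale (r : R) (z : C) : 0 <= r -> sqmod ((Num.sqrt r)%:C * z) = r * sqmod z.
Proof. by move=> r0; rewrite sqmodM {1}/sqmod /= expr0n addr0 sqr_sqrtr. Qed.

Lemma sqmod_gamma g : sqmod (gamma g) = 1.
Proof. by rewrite -sqr_cabs (cabs_gamma hgamma) expr1n. Qed.

Lemma ecoord_sum n (x : E n) : \sum_(i < n.+1) sqmod (ecoord i x) = 1.
Proof.
elim: n x => [|n ih] x; first by rewrite big_ord1 /= sqmod_gamma.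
rewrite big_ord_recr /= eqxx; set q := repr _.
have /andP[s0 s1] := IP q.1.2.
rewrite sqmod_scale // sqmod_gamma mulr1.
under eq_bigr => i _ do rewrite (ltn_eqF (ltn_ord i)) sqmod_scale ?subr_ge0 //.
by rewrite -mulr_sumr ih mulr1 subrK.
Qed.

Lemma ecoord_inj n (x y : E n) :
  (forall i, (i < n.+1)%N -> ecoord i x = ecoord i y) -> x = y.
Proof.
elim: n x y => [|n ih] x y h; first by apply: (gamma_inj hk hgamma); exact: (h 0%N).
rewrite -(reprK (x : join R (E n) G)) -(reprK (y : join R (E n) G)).
have h1 := h n.+1 (ltnSn _); rewrite /= eqxx in h1.
have h2 i : (i < n.+1)%N -> join_left (@ecoord n i) (repr (x : join R (E n) G))
   = join_left (@ecoord n i) (repr (y : join R (E n) G)).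
  by move=> hi; have := h i (ltnW hi : (i < n.+2)%N); rewrite /= (ltn_eqF hi).
move: (repr _) (repr _) h1 h2 => p q h1 h2 {h}.
have /andP[p0 p1] := IP p.1.2; have /andP[q0 q1] := IP q.1.2.
have e : p.1.2 = q.1.2.
  apply: val_inj; have := congr1 (@sqmod R) h1.
  by rewrite !sqmod_scale // !sqmod_gamma !mulr1.
apply: join_eq => // [lt1|gt0].
  apply: ih => i hi; have := h2 i hi; rewrite /join_left -e; apply: mulfI.
  by rewrite fmorph_eq0 sqrtr_eq0 -ltNge subr_gt0 e.
apply: (gamma_inj hk hgamma); have := h1; rewrite /join_right -e; apply: mulfI.
by rewrite fmorph_eq0 sqrtr_eq0 -ltNge e.
Qed.

Lemma ecoord_surj n (z : nat -> C) : (forall i, (i < n.+1)%N -> St (z i)) ->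
  \sum_(i < n.+1) sqmod (z i) = 1 ->
  exists x : E n, forall i, (i < n.+1)%N -> ecoord i x = z i.
Proof.
elim: n z => [|n ih] z hz hs.
  have /(StarP hk hgamma)[s [g [/andP[s0 _] zE]]] := hz 0%N isT.
  exists g => -[|//] _ /=; move: hs; rewrite big_ord1 zE sqmodM sqmod_gamma mulr1.
  rewrite /sqmod /= expr0n addr0 => /eqP; rewrite sqrf_eq1 => /orP[]/eqP s1.
    by rewrite s1 mul1r.
  by exfalso; move: s0; rewrite s1; lra.
rewrite big_ord_recr /= in hs.
set S := \sum_(i < n.+1) _ in hs.
have S0 : 0 <= S by apply: sumr_ge0 => i _; exact: sqmod_ge0.
have z0 := sqmod_ge0 (z n.+1).
have [t ht] : exists t : I, val t = sqmod (z n.+1) by apply: I_mk; lra.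
have /(StarP hk hgamma)[s [g [/andP[s0 _] zE]]] := hz n.+1 (ltnSn _).
have sE : Num.sqrt (sqmod (z n.+1)) = s.
  by rewrite zE sqmodM sqmod_gamma mulr1 /sqmod /= expr0n addr0 sqrtr_sqr ger0_norm.
have [x hx] : exists x : E n, forall i, (i < n.+1)%N ->
    (Num.sqrt S)%:C * ecoord i x = z i.
  have [S1|S1] := eqVneq S 0.
    have zi i : (i < n.+1)%N -> z i = 0.
      move=> hi; apply: sqmod_eq0; apply/eqP; move/eqP: S1; rewrite psumr_eq0.
        by move=> /allP/(_ (Ordinal hi) (mem_index_enum _)).
      by move=> j _; exact: sqmod_ge0.
    have [i _||x _] := ih (fun i => if i == 0%N then 1 else 0).
    - case: ifP => _; last exact: (Star0 hk hgamma).
      by apply/(StarP hk hgamma); exists 1, 0; rewrite ler01 lexx mul1r (gamma0 hgamma).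
    - rewrite big_ord_recl /= big1 => [|i _]; last exact: sqmod0.
      by rewrite /sqmod /= expr1n expr0n !addr0.
    by exists x => i hi; rewrite S1 sqrtr0 mul0r zi.
  have Sp : 0 < S by rewrite lt_neqAle eq_sym S1.
  have sp : 0 < Num.sqrt S by rewrite sqrtr_gt0.
  have SS : Num.sqrt S ^+ 2 = S by rewrite sqr_sqrtr.
  have sm (r : R) (w : C) : sqmod (r%:C * w) = r ^+ 2 * sqmod w.
    by rewrite sqmodM {1}/sqmod /= expr0n addr0.
  have [i hi||x hx] := ih (fun i => ((Num.sqrt S)^-1)%:C * z i).
  - apply: (Star_scale hk hgamma); [by apply: hz; exact: ltnW|by rewrite invr_ge0 ltW|].
    rewrite -(ler_pXn2r (n := 2)) ?nnegrE ?cabs_ge0 // expr1n sqr_cabs sm.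
    rewrite exprVn SS mulrC ler_pdivrMr // mul1r /S (bigD1 (Ordinal hi)) //= lerDl.
    by apply: sumr_ge0 => j _; exact: sqmod_ge0.
  - under eq_bigr do rewrite sm.
    by rewrite -mulr_sumr -/S exprVn SS mulVf.
  exists x => i hi; rewrite hx // mulrA -rmorphM divff ?mul1r //.
  by rewrite gt_eqF.
exists (\pi_(join R (E n) G) (x, t, (g : G))) => i; rewrite ltnS leq_eqVlt => /predU1P[->|hi] /=.
  by rewrite eqxx join_rightE /join_right /= ht sE zE.
rewrite (ltn_eqF hi) join_leftE /join_left /= ht -hs addrK; exact: hx.
Qed.

Lemma Ccont_unif n (f : E n -> C) : Ccont f ->
  unif setT (fun (i : 'I_n.+1) (x : E n) => ecoord i x) f.
Proof.
move=> cf; apply: unif_bounded => [i x _|e e0].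
  exact: (Star_cabs hk hgamma (ecoord_Star _ _)).
apply: (@unif_compact R (E n) 'I_n.+1 setT (fun i x => ecoord i x) f e
  (@compact_EG n) cf (fun i => @continuous_ecoord n i) _ e0) => x y _ _ h.
by congr f; apply: ecoord_inj => i hi; exact: (h (Ordinal hi)).
Qed.

End JoinTopology.

(** * Calculus for families of star elements *)

Section Families.
Context {R : realType} (k : nat) (hk : (2 <= k)%N).
Context (gamma : 'Z_k -> Cplx R) (hgamma : dual_generator gamma).
Context (A : cstarAlgType R).
Local Notation C := (Cplx R).
Local Notation St := (@Star R k).
Local Notation id1 := (fun _ : 'I_1 => @id C).

Definition family_set (I : Type) (a : I -> A) : set A :=
  [set x | exists i, x = a i \/ x = star (a i)].

Lemma family_comm_star (I : Type) (a : I -> A) :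
  (forall i j, a i ** a j = a j ** a i)%A ->
  (forall i j, a i ** star (a j) = star (a j) ** a i)%A ->
  comm_star (family_set a).
Proof.
move=> h1 h2; split=> [x y [i [->|->]] [j [->|->]]|x [i [->|->]]] //.
- by rewrite -!starM h1.
- by exists i; right.
- by exists i; left; rewrite starK.
Qed.

Lemma normal_comm_star (a : A) : normal_elt a -> comm_star (family_set (fun _ : 'I_1 => a)).
Proof. by move=> na; apply: family_comm_star. Qed.

Definition family_elt (I : Type) (a : I -> A) (hS : comm_star (family_set a)) (i : I) :
  bicommCStar hS :=
  bmk hS (sub_bicommutant (ex_intro _ i (or_introl erefl))).

Lemma bval_conj_approx (S : set A) (hS : comm_star S) (q : C) (x : bicommCStar hS) n y :
  (y ** bval x = bval x ** y)%A ->
  commutant [set y] (bval (conj_approx k (csc (bicommCStar hS) q) x n)).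
Proof.
move=> yx; pose P (b : bicommCStar hS) := commutant [set y] (bval b).
have PM b c : P b -> P c -> P (b * c) by exact: commutantM.
have PX b m : P b -> P (b ^+ m).
  by move=> hb; elim: m => [|m ih]; rewrite ?expr0 ?exprS; [exact: commutant1|exact: PM].
have Px : P x by move=> _ ->.
elim: n => [|n ih]; first exact: commutant0.
apply: commutantD => //; apply: (PM); first by apply: commutantZ; exact: commutant1.
apply: (PM); first exact: PX.
by apply: commutantD; [exact: PX | apply: commutantN; exact: PX].
Qed.

(* A substitute for Fuglede's theorem: on the star, [conj z] is a uniform limit of
   polynomials in [z]. *)
Lemma star_commute (a y : A) : normal_elt a -> spectrum a `<=` St ->
  (y ** a = a ** y)%A -> (y ** star a = star a ** y)%A.
Proof.
move=> na sa ya; have hS := normal_comm_star na.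
pose x := family_elt hS ord0.
have happ := spectrum_approximable hk hgamma (a := x) sa.
suff /(_ y erefl) : commutant [set y] (star a) by [].
apply: commutant_lim => e e0.
have [n hn] := star_conj_limit (ltnW hk) happ
  (fun z hz => match iffLR (StarP hk hgamma z) hz with
    | ex_intro r (ex_intro g (conj r01 zE)) =>
        ex_intro _ r (ex_intro _ (gamma g) (And3 r01 (gammaX hk hgamma g) zE))
    end) (fun z => @Star_cabs _ _ hk _ hgamma z) e0.
exists (bval (conj_approx k (csc (bicommCStar hS) (k%:R^-1)%:C) x n)).
  exact: bval_conj_approx.
exact: hn.
Qed.

Context (alpha : 'Z_k -> A -> A) (halpha : is_action alpha).

Lemma alphaK g x : alpha (- g) (alpha g x) = x.
Proof. by rewrite -(actionD halpha) addNr (action0 halpha). Qed.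

Lemma alphaKV g x : alpha g (alpha (- g) x) = x.
Proof. by rewrite -(actionD halpha) subrr (action0 halpha). Qed.

Section Calculus.
Context (I : finType) (a : I -> A) (hS : comm_star (family_set a)).
Hypothesis ha : forall i, spectral_subspace alpha gamma (a i).
Local Notation B := (bicommCStar hS).

Lemma alpha_family g s : family_set a s -> exists c : C, alpha g s = c *: s.
Proof.
move=> [i [->|->]]; first by exists (gamma g); exact: ha.
by exists (Num.conj (gamma g)); rewrite (action_star halpha) ha starZ.
Qed.

Lemma bicommutant_alpha g x : bicommutant (family_set a) x ->
  bicommutant (family_set a) (alpha g x).
Proof.
move=> hx y hy.
have hy' : commutant (family_set a) (alpha (- g) y).
  move=> s Ss; rewrite -(alphaK g (_ ** _)%A) (action_mul halpha) alphaKV.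
  have [c hc] := alpha_family g Ss.
  rewrite hc -ascaleAr hy // ascaleAl -hc -{1}(alphaKV g y) -(action_mul halpha).
  exact: alphaK.
by rewrite -{1}(alphaKV g y) -(action_mul halpha) hx // (action_mul halpha) alphaKV.
Qed.

Definition bauto g (x : B) : B := bmk hS (bicommutant_alpha g (bvalT x)).

Lemma bauto_auto g : cstar_auto (bauto g).
Proof.
split=> [x y|x y|c|x]; apply: bval_inj; rewrite /=.
- exact: (action_add halpha).
- exact: (action_mul halpha).
- by rewrite (action_scale halpha) (action_one halpha).
- exact: (action_star halpha).
Qed.

Lemma family_calculus (X : Type) (act : 'Z_k -> X -> X) (phi : I -> X -> C) :
  (forall i g x, phi i (act g x) = gamma g * phi i x) ->
  approximable setT phi (family_elt hS) ->
  exists rho : (X -> C) -> A, [/\ star_hom (unif setT phi) rho,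
    forall g f, unif setT phi f -> rho (f \o act g) = alpha g (rho f),
    rho (fun=> 1) = 1%A & forall i, rho (phi i) = a i].
Proof.
move=> hphi happ.
have /choice[rb hrb] (f : X -> C) : exists b : B,
    (exists b, is_rep setT phi (family_elt hS) f b) ->
    is_rep setT phi (family_elt hS) f b.
  have [[b hb]|nb] := pselect (exists b, is_rep setT phi (family_elt hS) f b).
    by exists b.
  by exists 0 => /nb.
have rbE f b : is_rep setT phi (family_elt hS) f b -> rb f = b.
  by move=> hb; exact: (is_rep_unique happ (hrb f (ex_intro _ b hb)) hb).
have rbP f : unif setT phi f -> is_rep setT phi (family_elt hS) f (rb f).
  by move=> uf; apply: hrb; exact: is_rep_ex.
exists (fun f => bval (rb f)); split.
- split=> [f g uf ug|c f uf|f g uf ug|f uf].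
  + rewrite (rbE _ _ (is_repD (rbP f uf) (rbP g ug))); reflexivity.
  + by rewrite (rbE _ _ (is_repZ c (rbP f uf))) /= -ascaleAl amul1l.
  + rewrite (rbE _ _ (is_repM happ uf ug (rbP f uf) (rbP g ug))); reflexivity.
  + rewrite (rbE _ _ (is_rep_conj (rbP f uf))); reflexivity.
- move=> g f uf; have ufg : unif setT phi (f \o act g).
    have [[M hM] uf2] := uf; split; first by exists M => x _; exact: hM.
    move=> e /uf2[c c0 hc]; exists c => // x y _ _.
    suff -> : dist2 phi x y = dist2 phi (act g x) (act g y) by exact: hc.
    apply: eq_bigr => i _; rewrite !hphi -mulrBr sqmodM.
    by rewrite -(sqr_cabs (gamma g)) (cabs_gamma hgamma) expr1n mul1r.
  have := @is_rep_auto _ _ _ _ setT phi (family_elt hS) (bauto g) (bauto (- g))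
    (gamma g) (act g) f (rb f) (rb (f \o act g)) (bauto_auto g) (bauto_auto (- g)).
  move=> -> //; try exact: rbP.
  + by move=> x; apply: bval_inj; rewrite /= alphaK.
  + by move=> x; apply: bval_inj; rewrite /= alphaKV.
  + exact: (cabs_gamma hgamma).
  + by move=> i; apply: bval_inj; rewrite /= -ascaleAl amul1l; exact: ha.
- by rewrite (rbE _ _ (is_rep_cst _ _ _ 1)) rmorph1.
- by move=> i; rewrite (rbE _ _ (is_rep_coord _ _ _ i)).
Qed.

End Calculus.

Lemma star_hom_sub (X : Type) (F G : set (X -> C)) (rho : (X -> C) -> A) :
  F `<=` G -> star_hom G rho -> star_hom F rho.
Proof.
move=> FG h; split=> [f g /FG ? /FG|c f /FG|f g /FG ? /FG|f /FG].
- exact: (star_hom_add h).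
- exact: (star_hom_scale h).
- exact: (star_hom_mul h).
- exact: (star_hom_star h).
Qed.

(* [g = f / (z (f - z))], so that [(f - z) (g - 1/z) = 1]. *)
Lemma star_hom_resolvent (X : Type) (F : set (X -> C)) (rho : (X -> C) -> A) z f :
  star_hom F rho -> z != 0 -> F f -> (forall x, f x != z) ->
  (forall c g, F g -> F (fun x => c * g x)) ->
  F (fun x => f x / (z * (f x - z))) ->
  invertible (rho f - z *: 1%A).
Proof.
move=> hr z0 Ff fz FZ; set g := fun x => _ => Fg.
have gf : rho (fun x => f x * g x) = z *: rho g + z^-1 *: rho f.
  rewrite -!(star_hom_scale hr) // -(star_hom_add hr); [|exact: FZ|exact: FZ].
  congr rho; apply/funext => x; rewrite /g; have := fz x; rewrite -subr_eq0 => h.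
  by field; rewrite z0 h.
have h1 := star_hom_mul hr Ff Fg; have h2 := star_hom_mul hr Fg Ff.
rewrite gf in h1.
have E : (fun x => g x * f x) = (fun x => f x * g x) by apply/funext => x; exact: mulrC.
rewrite E gf in h2.
exists (rho g - z^-1 *: 1%A); split.
  rewrite amulBl !amulBr -h1 -!ascaleAr -!ascaleAl !amul1r !amul1l.
  rewrite scalerA mulVf // scale1r addrK.
  by rewrite opprB addrCA subrr addr0.
rewrite amulBl !amulBr -h2 -!ascaleAr -!ascaleAl !amul1r !amul1l.
rewrite scalerA divff // scale1r opprB.
by rewrite (addrC (z *: rho g)) addrK addrCA subrr addr0.
Qed.

End Families.

(** * The two characterizations *)

Section Characterizations.
Context {R : realType} (k : nat) (hk : (2 <= k)%N).
Context (A : cstarAlgType R) (alpha : 'Z_k -> A -> A) (halpha : is_action alpha).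
Context (gamma : 'Z_k -> Cplx R) (hgamma : dual_generator gamma).
Local Notation C := (Cplx R).
Local Notation St := (@Star R k).
Local Notation cone := (cone_gspace R 'Z_k).
Local Notation E := (EG R 'Z_k).
Local Notation coord := (cone_coord gamma).

Definition star_element (a : A) :=
  [/\ normal_elt a, spectral_subspace alpha gamma a & spectrum a `<=` St].

Lemma not_Star_neq0 z : ~ St z -> z != 0.
Proof. by move=> nz; apply/eqP => z0; apply: nz; rewrite z0; exact: (Star0 hk hgamma). Qed.

Lemma Star_neq z w : ~ St z -> St w -> w != z.
Proof. by move=> nz hw; apply/eqP => h; apply: nz; rewrite -h. Qed.

Lemma continuous_resolvent (X : topologicalType) (f : X -> C) z :
  continuous f -> z != 0 -> (forall x, f x != z) ->
  continuous (fun x => f x / (z * (f x - z))).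
Proof.
move=> cf z0 fz x; apply: cvgM; first exact: cf.
apply: cvgV; first by rewrite mulf_neq0 // subr_eq0.
by apply: cvgM; [exact: cvg_cst | apply: cvgB; [exact: cf | exact: cvg_cst]].
Qed.

Lemma Czero_scale c (f : cone -> C) : Czero f -> Czero (fun x => c * f x).
Proof.
move=> [cf hf]; split; first by move=> x; apply: cvgM; [exact: cvg_cst | exact: cf].
move=> e e0; have [->|c0] := eqVneq c 0.
  have -> : [set x | e%:C <= `|0 * f x|] = set0; last exact: compact0.
  apply/seteqP; split=> // x /=; rewrite mul0r normr0.
  by rewrite lecR leNgt e0.
have cp : 0 < cabs c.
  rewrite lt_neqAle cabs_ge0 andbT eq_sym; apply: contra_neq c0.
  exact: ComplexField.Normc.eq0_normc.
have := hf (e / cabs c) (divr_gt0 e0 cp); congr compact; apply/seteqP.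
by split=> x /=; rewrite !normCE !lecR ComplexField.Normc.normcM ler_pdivrMr // mulrC.
Qed.

Lemma Czero_conj (f : cone -> C) : Czero f -> Czero (fun x => Num.conj (f x)).
Proof.
move=> [cf hf]; split; first exact: continuous_conj.
by move=> e /hf; under [in X in _ -> X]eq_set do rewrite norm_conjC.
Qed.

Lemma Czero_coord : Czero coord.
Proof.
apply: compact_Czero => [|e e0]; first exact: continuous_cone_coord.
exists (e ^+ 2) => [|p hp]; first by rewrite exprn_gt0.
by rewrite -(sqmod_cone_coord hgamma) -sqr_cabs ler_pXn2r ?nnegrE ?cabs_ge0 ?(ltW e0).
Qed.

Lemma Czero_resolvent z : ~ St z -> Czero (fun p => coord p / (z * (coord p - z))).
Proof.
move=> nz; have z0 := not_Star_neq0 nz.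
have fz p : coord p != z := Star_neq nz (Star_cone_coord hk hgamma p).
apply: compact_Czero => [|e e0].
  by apply: continuous_resolvent => //; exact: continuous_cone_coord.
have zp : 0 < cabs z.
  rewrite lt_neqAle cabs_ge0 andbT eq_sym; apply: contra_neq z0.
  exact: ComplexField.Normc.eq0_normc.
pose m := Num.min (cabs z / 2) (e * cabs z ^+ 2 / 2).
have m0 : 0 < m by rewrite lt_min !divr_gt0 // mulr_gt0 // exprn_gt0.
exists (m ^+ 2) => [|p]; first by rewrite exprn_gt0.
rewrite -(sqmod_cone_coord hgamma) -sqr_cabs ler_pXn2r ?nnegrE ?cabs_ge0 ?(ltW m0) //.
apply: contraTT; rewrite -!ltNge lt_min => /andP[h1 h2].
rewrite ComplexField.Normc.normcM ComplexField.Normc.normcV (ComplexField.Normc.normcM z).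
have h3 : cabs z / 2 < cabs (coord p - z).
  have -> : cabs (coord p - z) = cabs (z - coord p) by rewrite -normcN opprB.
  by have := cabs_lip z (coord p); rewrite ler_norml => /andP[_]; lra.
have h4 : 0 < cabs (coord p - z) by rewrite (lt_trans _ h3) // divr_gt0.
rewrite ltr_pdivrMr; last exact: mulr_gt0.
rewrite (lt_trans h2) // expr2 -!mulrA ltr_pM2l // ltr_pM2l //.
Qed.

Lemma cone_homP (b : A) :
  (exists rho, cone_hom alpha rho /\ rho (@t_tensor_1 R 'Z_k) = b) <->
  (exists a, star_element a /\ (a ** star a)%A = b).
Proof.
have FZ := Czero_scale; have F1 := Czero_coord; have F2 := Czero_conj F1.
have tE : (fun p => coord p * Num.conj (coord p)) = @t_tensor_1 R 'Z_k.
  apply/funext => p; rewrite mulrC -sqmodE (sqmod_cone_coord hgamma).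
  by rewrite /t_tensor_1 /tensor mulr1.
split=> [[rho [[hrho heq] <-]]|[a [[na aa sa] <-]]].
  have aa : (rho coord ** star (rho coord))%A = rho (@t_tensor_1 R 'Z_k).
    by rewrite -(star_hom_star hrho) // -(star_hom_mul hrho) // tE.
  exists (rho coord); split=> //; split.
  - rewrite /normal_elt aa -tE -(star_hom_star hrho) // -(star_hom_mul hrho) //.
    by congr rho; apply/funext => p; rewrite mulrC.
  - move=> g; rewrite -heq // -(star_hom_scale hrho) //; congr rho.
    by apply/funext => p; exact: (cone_coord_act hgamma).
  - move=> z; apply: contraPP => nz; apply.
    apply: (star_hom_resolvent hrho (not_Star_neq0 nz) F1 _ FZ).
      by move=> p; exact: (Star_neq nz (Star_cone_coord hk hgamma p)).
    exact: Czero_resolvent.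
have hS := normal_comm_star na; pose x := family_elt hS ord0.
have happ := spectrum_approximable hk hgamma (a := x) sa.
have happ' : approximable setT (fun _ : 'I_1 => coord) (family_elt hS).
  have -> : family_elt hS = (fun=> x).
    by apply/funext => i; rewrite (ord1 i).
  apply: (approximable_push happ) => e e0.
  have /choice[p hp] z : exists q : cone, St z -> sqmod (coord q - z) <= e.
    have [Sz|nS] := pselect (St z).
      by have [q hq] := Star_cone_dense hk hgamma Sz e0; exists q.
    by have [q _] := Star_cone_dense hk hgamma (Star0 hk hgamma) e0; exists q.
  exists p, (fun=> 0); split=> // [z Sz|].
    by rewrite big_ord1 addr0 hp.
  by rewrite -(rmorph0 (csc _)); exact: (is_rep_cst _ _ _ 0).
have [rho [h1 h2 _ h4]] := family_calculus hgamma halpha (fun _ => aa)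
  (fun _ g p => cone_coord_act hgamma g p) happ'.
have sub : @Czero R cone `<=` unif setT (fun _ : 'I_1 => coord).
  by move=> f; exact: (Czero_unif hk hgamma).
have h1' := star_hom_sub sub h1.
exists rho; split; first by split=> // g f /sub; exact: h2.
by rewrite -tE (star_hom_mul h1') // (star_hom_star h1') // (h4 ord0).
Qed.

Lemma join_homP n :
  (exists rho : (E n -> C) -> A, [/\ star_hom (@Ccont R (E n)) rho,
      rho (fun=> 1) = 1%A & equivariant alpha (@Ccont R (E n)) rho]) <->
  (exists a : 'I_n.+1 -> A, [/\ forall i, star_element (a i),
      forall i j, (a i ** a j = a j ** a i)%A &
      \sum_(i < n.+1) (a i ** star (a i))%A = 1%A]).
Proof.
pose f (i : 'I_n.+1) (x : E n) : C := ecoord gamma i x.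
have F1 i : Ccont (f i) by exact: continuous_ecoord.
have F2 i : Ccont (fun x => Num.conj (f i x)) by exact: (continuous_conj (F1 i)).
have FZ c g : @Ccont R (E n) g -> Ccont (fun x => c * g x).
  by move=> cg x; apply: cvgM; [exact: cvg_cst | exact: cg].
have fS i x : St (f i x) := ecoord_Star hk hgamma i x.
split=> [[rho [hrho rho1 heq]]|[a [ha hc hs]]].
  have aa i : (rho (f i) ** star (rho (f i)))%A = rho (fun x => f i x * Num.conj (f i x)).
    by rewrite -(star_hom_star hrho) // -(star_hom_mul hrho).
  exists (fun i => rho (f i)); split=> [i|i j|].
  - split.
    + rewrite /normal_elt aa -(star_hom_star hrho) // -(star_hom_mul hrho) //.
      by congr rho; apply/funext => x; rewrite mulrC.
    + move=> g; rewrite -heq // -(star_hom_scale hrho) //; congr rho.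
      by apply/funext => x; exact: (ecoord_act hgamma).
    + move=> z; apply: contraPP => nz; apply.
      have fz x : f i x != z := Star_neq nz (fS i x).
      have z0 := not_Star_neq0 nz.
      apply: (star_hom_resolvent hrho z0 (F1 i) fz FZ).
      exact: (continuous_resolvent (F1 i) z0 fz).
  - rewrite -!(star_hom_mul hrho) //; congr rho.
    by apply/funext => x; rewrite mulrC.
  - under eq_bigr do rewrite aa.
    have FM i : Ccont (fun x => f i x * Num.conj (f i x)).
      by move=> x; apply: cvgM; [exact: F1 | exact: F2].
    have H (r : seq 'I_n.+1) : Ccont (fun x => \sum_(i <- r) f i x * Num.conj (f i x)) /\
      rho (fun x => \sum_(i <- r) f i x * Num.conj (f i x))
        = \sum_(i <- r) rho (fun x => f i x * Num.conj (f i x)).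
      elim: r => [|i r [ih1 ih2]].
        have -> : (fun x => \sum_(i <- [::]) f i x * Num.conj (f i x)) = (fun=> 0).
          by apply/funext => x; rewrite big_nil.
        split; first by move=> x; exact: cvg_cst.
        rewrite big_nil -[RHS](scale0r (rho (f ord0))) -(star_hom_scale hrho) //.
        by congr rho; apply/funext => x; rewrite mul0r.
      have -> : (fun x => \sum_(j <- i :: r) f j x * Num.conj (f j x))
        = (fun x => f i x * Num.conj (f i x) + \sum_(j <- r) f j x * Num.conj (f j x)).
        by apply/funext => x; rewrite big_cons.
      split; first by move=> x; apply: cvgD; [exact: FM | exact: ih1].
      by rewrite (star_hom_add hrho (FM i) ih1) ih2 big_cons.
    rewrite -(H _).2 -rho1; congr rho; apply/funext => x.
    rewrite -[RHS](rmorph1 (real_complex R)) -(ecoord_sum hgamma x) rmorph_sum.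
    by apply: eq_bigr => i _; rewrite /= sqmodE mulrC.
have hS : comm_star (family_set a).
  apply: family_comm_star => // i j; have [na _ sa] := ha j.
  exact: (star_commute hk hgamma na sa).
have happ : approximable setT f (family_elt hS).
  apply: (approximable_sphere hk hgamma) => [i||z hz hz1].
  - by have [_ _ sa] := ha i; exact: (spectrum_approximable hk hgamma).
  - apply: bval_inj; rewrite -[RHS]hs (big_morph (@bval _ _ _ hS) (@bvalD _ _ _ hS) (@bval0 _ _ _ hS)).
    by apply: eq_bigr => i _; have [na _ _] := ha i; rewrite /= -na.
  - pose z' (i : nat) := z (inord i).
    have zE (i : 'I_n.+1) : z' i = z i by rewrite /z' inord_val.
    have [i hi||x hx] := @ecoord_surj R k hk gamma hgamma n z'.
    + exact: hz.
    + by under eq_bigr do rewrite zE.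
    by exists x => i; rewrite /f hx // zE.
have [rho [h1 h2 h3 _]] := family_calculus hgamma halpha
  (fun i => let: And3 _ h _ := ha i in h)
  (fun (i : 'I_n.+1) g x => ecoord_act hgamma i g x : f i (gact g x) = _) happ.
have sub : @Ccont R (E n) `<=` unif setT f.
  by move=> g; exact: (Ccont_unif hk hgamma).
exists rho; split; [exact: (star_hom_sub sub h1) | exact: h3 |].
by move=> g h hh; exact: (h2 g h (sub h hh)).
Qed.

Lemma exists_cone_homs n (P : A -> Prop) :
  (exists rho : 'I_n.+1 -> (cone -> C) -> A, (forall i, cone_hom alpha (rho i)) /\
     P (\sum_(i < n.+1) rho i (@t_tensor_1 R 'Z_k))) <->
  (exists a : 'I_n.+1 -> A, (forall i, star_element (a i)) /\
     P (\sum_(i < n.+1) (a i ** star (a i))%A)).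
Proof.
split=> [[rho [hrho hP]]|[a [ha hP]]].
  have /choice[a ha] i : exists a, star_element a /\
      (a ** star a)%A = rho i (@t_tensor_1 R 'Z_k).
    by apply/cone_homP; exists (rho i).
  exists a; split=> [i|]; first by have [] := ha i.
  by under eq_bigr => i _ do rewrite (ha i).2.
have /choice[rho hrho] i : exists rho, cone_hom alpha rho /\
    rho (@t_tensor_1 R 'Z_k) = (a i ** star (a i))%A.
  by apply/cone_homP; exists (a i).
exists rho; split=> [i|]; first by have [] := hrho i.
by under eq_bigr => i _ do rewrite (hrho i).2.
Qed.

End Characterizations.

Theorem proposition3p2 (R : realType) (k : nat) (hk : (2 <= k)%N)
    (A : cstarAlgType R) (alpha : 'Z_k -> A -> A) (halpha : is_action alpha)
    (gamma : 'Z_k -> Cplx R) (hgamma : dual_generator gamma) :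
  [/\ dimLT alpha =
        min_infty [set n | exists a : 'I_n.+1 -> A,
          (forall i, [/\ normal_elt (a i),
                         spectral_subspace alpha gamma (a i) &
                         spectrum (a i) `<=` @Star R k]) /\
          \sum_(i < n.+1) (a i ** (a i)^*)%A = 1%A],
      dimWLT alpha =
        min_infty [set n | exists a : 'I_n.+1 -> A,
          (forall i, [/\ normal_elt (a i),
                         spectral_subspace alpha gamma (a i) &
                         spectrum (a i) `<=` @Star R k]) /\
          invertible (\sum_(i < n.+1) (a i ** (a i)^*)%A)] &
      dimSLT alpha =
        min_infty [set n | exists a : 'I_n.+1 -> A,
          [/\ forall i, [/\ normal_elt (a i),
                            spectral_subspace alpha gamma (a i) &
                            spectrum (a i) `<=` @Star R k],
              forall i j, (a i ** a j = a j ** a i)%A &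
              \sum_(i < n.+1) (a i ** (a i)^*)%A = 1%A]]].
Proof.
split; congr min_infty; apply/seteqP.
- by split=> n /(exists_cone_homs hk halpha hgamma n (fun x => x = 1%A)).
- by split=> n /(exists_cone_homs hk halpha hgamma n invertible).
- by split=> n /(join_homP hk halpha hgamma n).
Qed.
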